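(* Assume $q_{a0}=\mathrm{const}$ for all $a=1,\dots,N$. Then $IGL_{q,r}(N)$, with the coactions $\delta_L,\delta_R$ given on generators by $\delta_L(x^a)=T^a{}_b\otimes x^b$, $\delta_L(u)=I\otimes u$, $\delta_R(x^a)=x^a\otimes I$, $\delta_R(u)=u\otimes I$, $\delta_L(c)=\delta_R(c)=\Delta(c)$ for $c\in GL_{q,r}(N)$, and extended multiplicatively, is a bicovariant bimodule over $GL_{q,r}(N)$ which is freely generated, as a right $GL_{q,r}(N)$-module, by the ordered monomials $$\zeta^i=u^{i_0}(x^1)^{i_1}\cdots(x^N)^{i_N},\qquad i_0\in\mathbf Z,\ i_1,\dots,i_N\in\mathbf N\cup\{0\}.$$ Moreover each submodule $\Gamma^{(h,k)}$ ($h\in\mathbf Z$, $k\in\mathbf N\cup\{0\}$) of elements of degree $(h,k)$ is a bicovariant bimodule over $GL_{q,r}(N)$ freely generated by the elements $\zeta^i$ of degree $(h,k)$.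
   Context: Indices $A,B,\dots$ run over $\{0,1,\dots,N\}$, lower-case $a,b,\dots$ over $\{1,\dots,N\}$; repeated indices are summed. $r$ and $q_{AB}$ are nonzero complex parameters with $q_{AB}=r^2/q_{BA}$, $q_{AA}=r$. Let $\theta^{AB}=1$ for $A>B$ and $0$ otherwise, and $$R^{AB}{}_{CD}=\delta^A_C\delta^B_D\Big[\frac{r}{q_{AB}}+(r-1)\delta^{AB}\Big]+(r-r^{-1})\,\delta^A_D\delta^B_C\,\theta^{AB}.$$ $GL_{q,r}(N+1)$ is the unital $\mathbf C$-algebra generated by $T^A{}_B$ and the inverse $\Xi$ of the quantum determinant $$\det T=\sum_\sigma\Big[\prod_{A<B,\ \sigma(A)>\sigma(B)}\Big(-\frac{r^2}{q_{\sigma(B)\sigma(A)}}\Big)\Big]T^0{}_{\sigma(0)}\cdots T^N{}_{\sigma(N)},$$ modulo $R^{AB}{}_{EF}T^E{}_CT^F{}_D=T^B{}_FT^A{}_ER^{EF}{}_{CD}$; it is a Hopf algebra with $\Delta(T^A{}_B)=T^A{}_C\otimes T^C{}_B$, $\varepsilon(T^A{}_B)=\delta^A_B$, $\kappa(T)=T^{-1}$, $\Xi$ group-like. $IGL_{q,r}(N)$ is its quotient by the Hopf ideal generated by the $T^0{}_a$; write $x^a$, $u$, $T^a{}_b$ for the images of $T^a{}_0$, $T^0{}_0$, $T^a{}_b$. $u$ is invertible in $IGL_{q,r}(N)$. $GL_{q,r}(N)$ (same definition with indices $1,\dots,N$ and parameters $q_{ab}$) is the Hopf subalgebra of $IGL_{q,r}(N)$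 generated by the $T^a{}_b$ and the inverse of $\det T^a{}_b$. Grading: $x^a$ has degree $(0,1)$, $u^{\pm1}$ degree $(\pm1,0)$, elements of $GL_{q,r}(N)$ degree $(0,0)$; $\Gamma^{(h,k)}=\{u^hx^{a_1}\cdots x^{a_k}b_{a_1\ldots a_k}\ /\ b_{a_1\ldots a_k}\in GL_{q,r}(N)\}$. A bicovariant bimodule over a Hopf algebra $B$ is a $B$-bimodule $\Gamma$ with a left coaction $\delta_L:\Gamma\to B\otimes\Gamma$ and a right coaction $\delta_R:\Gamma\to\Gamma\otimes B$ satisfying $\delta_L(b\rho c)=\Delta(b)\delta_L(\rho)\Delta(c)$, $\delta_R(b\rho c)=\Delta(b)\delta_R(\rho)\Delta(c)$ and $(id\otimes\delta_R)\delta_L=(\delta_L\otimes id)\delta_R$. Here the bimodule structure is multiplication in $IGL_{q,r}(N)$. *)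

(* Defs.v *)
From HB Require Import structures.
From mathcomp Require Import all_boot all_order all_algebra all_fingroup.
From mathcomp Require Import finmap generic_quotient ring_quotient monalg.
From mathcomp Require Import boolp reals complex.

Set Implicit Arguments.
Unset Strict Implicit.
Unset Printing Implicit Defensive.

Import GRing.Theory Num.Theory.
Local Open Scope ring_scope.
Local Open Scope quotient_scope.

Reserved Notation "V ⊗ W" (at level 40, left associativity).

Section LinearSpan.
Variables (K : fieldType) (V : lmodType K) (S : V -> Prop).

Inductive span : V -> Prop :=
| span0 : span 0
| span_cons c s v : S s -> span v -> span (c *: s + v).

Definition span_pred : {pred V} := fun v => `[< span v >].

Lemma span_predP v : reflect (span v) (v \in span_pred).
Proof. exact: asboolP. Qed.

Lemma span_gen s : S s -> span s.
Proof. by move=> Ss; rewrite -[s]scale1r -[1 *: s]addr0; apply: span_cons => //; exact: span0. Qed.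

Lemma spanD v w : span v -> span w -> span (v + w).
Proof.
move=> Sv Sw; elim: Sv => [|c s {}v Ss _ IH]; first by rewrite add0r.
by rewrite -addrA; apply: span_cons.
Qed.

Lemma spanZ c v : span v -> span (c *: v).
Proof.
elim=> [|d s {}v Ss _ IH]; first by rewrite scaler0; apply: span0.
by rewrite scalerDr scalerA; apply: span_cons.
Qed.

Fact span_zmod_closed : zmod_closed span_pred.
Proof.
split=> [|v w /span_predP Sv /span_predP Sw]; first by apply/span_predP/span0.
by apply/span_predP; apply: spanD => //; rewrite -scaleN1r; apply: spanZ.
Qed.
HB.instance Definition _ := GRing.isZmodClosed.Build V span_pred span_zmod_closed.

Definition quot_span := Quotient.quot span_pred.
HB.instance Definition _ := GRing.Zmodule.on quot_span.
End LinearSpan.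

(* Operations on quotients are locked to keep unification from unfolding them. *)
HB.lock Definition qpi (K : fieldType) (V : lmodType K) (S : V -> Prop) (v : V) :
  quot_span S := \pi_(quot_span S) v.

HB.lock Definition qscale (K : fieldType) (V : lmodType K) (S : V -> Prop)
  (c : K) (z : quot_span S) : quot_span S := qpi S (c *: repr z).

Section QuotientSpace.
Variables (K : fieldType) (V : lmodType K) (S : V -> Prop).
Local Notation quot_span := (quot_span S).
Local Notation qpi := (qpi S).

Lemma qpiP v w : reflect (span S (v - w)) (qpi v == qpi w).
Proof.
rewrite qpi.unlock; apply: (iffP eqP) => [/eqmodP|] h; last apply/eqmodP; move: h.
  by move=> /span_predP.
by move=> /span_predP.
Qed.

Lemma qpi_surj z : exists v, z = qpi v.
Proof. by exists (repr z); rewrite qpi.unlock reprK. Qed.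

Fact qpi_additive : zmod_morphism qpi.
Proof. by move=> v w; rewrite qpi.unlock raddfB. Qed.

Lemma qpi_repr z : qpi (repr z) = z.
Proof. by rewrite qpi.unlock reprK. Qed.

Lemma qscale_pi c v : qscale c (qpi v) = qpi (c *: v).
Proof.
rewrite qscale.unlock; apply/eqP/qpiP; rewrite -scalerBr; apply: spanZ.
by apply/qpiP/eqP; rewrite qpi_repr.
Qed.

HB.instance Definition _ := GRing.isZmodMorphism.Build V quot_span qpi qpi_additive.

Fact qscaleA a b (z : quot_span) : qscale a (qscale b z) = qscale (a * b) z.
Proof. by have [v ->] := qpi_surj z; rewrite !qscale_pi scalerA. Qed.
Fact qscale1 : left_id 1 (@qscale K V S).
Proof. by move=> z; have [v ->] := qpi_surj z; rewrite qscale_pi scale1r. Qed.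
Fact qscaleDr : right_distributive (@qscale K V S) +%R.
Proof.
move=> c y z; have [v ->] := qpi_surj y; have [w ->] := qpi_surj z.
by rewrite -raddfD !qscale_pi scalerDr raddfD.
Qed.
Fact qscaleDl (z : quot_span) : {morph (@qscale K V S)^~ z : a b / a + b}.
Proof. by move=> a b; have [v ->] := qpi_surj z; rewrite !qscale_pi scalerDl raddfD. Qed.
HB.instance Definition _ :=
  GRing.Zmodule_isLmodule.Build K quot_span qscaleA qscale1 qscaleDr qscaleDl.

Fact qpi_scalable : scalable qpi.
Proof. by move=> c v; apply/esym; exact: qscale_pi. Qed.
HB.instance Definition _ := GRing.isScalable.Build K V quot_span *:%R qpi qpi_scalable.

End QuotientSpace.

Section QuotientAlgebraDef.
Variables (K : fieldType) (A : algType K).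

(* The linear span of [two_sided S] is the two-sided ideal generated by S. *)
Definition two_sided (S : A -> Prop) (z : A) : Prop :=
  exists a s b, S s /\ z = a * s * b.

(* Properness is required because the algebra structures of MathComp are
   nontrivial; it is established below by means of the counit. *)
Record relations := Relations {
  rel_pred :> A -> Prop;
  rel_proper : ~ span (two_sided rel_pred) 1
}.

Definition quot_alg (S : relations) := quot_span (two_sided S).

Definition alg_pi (S : relations) (a : A) : quot_alg S := qpi (two_sided S) a.
End QuotientAlgebraDef.

HB.lock Definition qmul (K : fieldType) (A : algType K) (S : relations A)
  (y z : quot_alg S) : quot_alg S := alg_pi S (repr y * repr z).

Section QuotientAlgebra.
Variables (K : fieldType) (A : algType K) (S : relations A).
Local Notation Q := (quot_alg S).
HB.instance Definition _ := GRing.Lmodule.on Q.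

Lemma idealMl a z : span (two_sided S) z -> span (two_sided S) (a * z).
Proof.
elim=> [|c s v [b [s' [d [Ss ->]]]] _ IH]; first by rewrite mulr0; apply: span0.
rewrite mulrDr -scalerAr; apply: span_cons => //.
by exists (a * b), s', d; split=> //; rewrite !mulrA.
Qed.

Lemma idealMr a z : span (two_sided S) z -> span (two_sided S) (z * a).
Proof.
elim=> [|c s v [b [s' [d [Ss ->]]]] _ IH]; first by rewrite mul0r; apply: span0.
rewrite mulrDl -scalerAl; apply: span_cons => //.
by exists b, s', (d * a); split=> //; rewrite !mulrA.
Qed.

Lemma ideal_rel s : S s -> span (two_sided S) s.
Proof. by move=> Ss; apply: span_gen; exists 1, s, 1; rewrite mul1r mulr1. Qed.

Local Notation alg_pi := (alg_pi S).
Local Notation qmul := (@qmul K A S).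

Lemma alg_piP a b : reflect (span (two_sided S) (a - b)) (alg_pi a == alg_pi b).
Proof. exact: qpiP. Qed.

Lemma alg_pi_surj z : exists a, z = alg_pi a.
Proof. exact: qpi_surj. Qed.

Lemma qmul_pi a b : qmul (alg_pi a) (alg_pi b) = alg_pi (a * b).
Proof.
have e c : span (two_sided S) (repr (alg_pi c) - c).
  by apply/qpiP; rewrite qpi_repr.
rewrite qmul.unlock; apply/eqP/alg_piP.
rewrite -[_ - _](addrNK (repr (alg_pi a) * b)) -addrA; rewrite addrAC.
have -> : repr (alg_pi a) * repr (alg_pi b) + (- (repr (alg_pi a) * b)
   + repr (alg_pi a) * b) + - (a * b) =
   repr (alg_pi a) * (repr (alg_pi b) - b) + (repr (alg_pi a) - a) * b.
  by rewrite mulrBr mulrBl !addrA.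
by apply: spanD; [apply: idealMl | apply: idealMr].
Qed.

Fact qmulA : associative qmul.
Proof.
move=> x y z; have [a ->] := alg_pi_surj x; have [b ->] := alg_pi_surj y.
by have [c ->] := alg_pi_surj z; rewrite !qmul_pi mulrA.
Qed.
Fact qmul1l : left_id (alg_pi 1) qmul.
Proof. by move=> x; have [a ->] := alg_pi_surj x; rewrite qmul_pi mul1r. Qed.
Fact qmul1r : right_id (alg_pi 1) qmul.
Proof. by move=> x; have [a ->] := alg_pi_surj x; rewrite qmul_pi mulr1. Qed.

Fact alg_piB : zmod_morphism alg_pi.
Proof. exact: qpi_additive. Qed.
HB.instance Definition _ := GRing.isZmodMorphism.Build A Q alg_pi alg_piB.

Fact qmulDl : left_distributive qmul +%R.
Proof.
move=> x y z; have [a ->] := alg_pi_surj x; have [b ->] := alg_pi_surj y.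
by have [c ->] := alg_pi_surj z; rewrite -raddfD !qmul_pi mulrDl raddfD.
Qed.
Fact qmulDr : right_distributive qmul +%R.
Proof.
move=> x y z; have [a ->] := alg_pi_surj x; have [b ->] := alg_pi_surj y.
by have [c ->] := alg_pi_surj z; rewrite -raddfD !qmul_pi mulrDr raddfD.
Qed.
Fact qone_neq0 : alg_pi 1 != 0.
Proof.
rewrite -(raddf0 alg_pi); apply/negP => /alg_piP; rewrite subr0.
exact: rel_proper.
Qed.
HB.instance Definition _ := GRing.Zmodule_isNzRing.Build Q
  qmulA qmul1l qmul1r qmulDl qmulDr qone_neq0.

Fact alg_pi_monoid : monoid_morphism alg_pi.
Proof. by split=> // a b; apply/esym; exact: qmul_pi. Qed.
HB.instance Definition _ := GRing.isMonoidMorphism.Build A Q alg_pi alg_pi_monoid.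
Fact alg_pi_scalable : scalable alg_pi.
Proof. exact: qpi_scalable. Qed.
HB.instance Definition _ := GRing.isScalable.Build K A Q *:%R alg_pi alg_pi_scalable.

Fact qscalerAl (c : K) (x y : Q) : c *: (x * y) = c *: x * y.
Proof.
have [a ->] := alg_pi_surj x; have [b ->] := alg_pi_surj y.
by rewrite -rmorphM -!linearZ -rmorphM /= scalerAl.
Qed.
HB.instance Definition _ := GRing.Lmodule_isLalgebra.Build K Q qscalerAl.
Fact qscalerAr (c : K) (x y : Q) : c *: (x * y) = x * (c *: y).
Proof.
have [a ->] := alg_pi_surj x; have [b ->] := alg_pi_surj y.
by rewrite -rmorphM -!linearZ -rmorphM /= scalerAr.
Qed.
HB.instance Definition _ := GRing.Lalgebra_isAlgebra.Build K Q qscalerAr.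

Lemma alg_pi_rel s : S s -> alg_pi s = 0.
Proof.
by move=> Ss; apply/eqP; rewrite -(raddf0 alg_pi); apply/alg_piP; rewrite subr0; apply: ideal_rel.
Qed.

(* The classical two-sided inverse; as usual x^-1 = x when x is not a unit. *)
Definition qunit : pred Q := fun x => `[< exists y, y * x = 1 /\ x * y = 1 >].
Definition qinv (x : Q) : Q :=
  if pselect (exists y, y * x = 1 /\ x * y = 1) is left h then projT1 (cid h) else x.

Fact qmulVr : {in qunit, left_inverse 1 qinv *%R}.
Proof. by move=> x /asboolP h; rewrite /qinv; case: pselect => // h'; case: cid => y []. Qed.
Fact qmulrV : {in qunit, right_inverse 1 qinv *%R}.
Proof. by move=> x /asboolP h; rewrite /qinv; case: pselect => // h'; case: cid => y []. Qed.
Fact qunitP x y : y * x = 1 /\ x * y = 1 -> x \in qunit.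
Proof. by move=> h; apply/asboolP; exists y. Qed.
Fact qinv_out : {in [predC qunit], qinv =1 id}.
Proof.
move=> x; rewrite inE /= => /asboolPn h; rewrite /qinv; by case: pselect.
Qed.
HB.instance Definition _ :=
  GRing.NzRing_hasMulInverse.Build Q qmulVr qmulrV qunitP qinv_out.

Section Lift.
Variables (B : algType K) (f : {lrmorphism A -> B}).
Hypothesis fS : forall s, S s -> f s = 0.

Lemma ideal_ker z : span (two_sided S) z -> f z = 0.
Proof.
elim=> [|c s v [a [s' [b [Ss ->]]]] _ IH]; first exact: raddf0.
by rewrite linearP /= IH addr0 !rmorphM /= (fS Ss) mulr0 mul0r scaler0.
Qed.

Definition alg_lift_fun (x : Q) : B := f (repr x).

Lemma alg_lift_pi a : alg_lift_fun (alg_pi a) = f a.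
Proof.
apply/eqP; rewrite -subr_eq0 -raddfB; apply/eqP/ideal_ker.
by apply/qpiP; rewrite qpi_repr.
Qed.
Lemma alg_lift_exists : exists g : {lrmorphism Q -> B}, forall a, g (alg_pi a) = f a.
Proof.
have hB : zmod_morphism alg_lift_fun.
  move=> x y; have [a ->] := alg_pi_surj x; have [b ->] := alg_pi_surj y.
  by rewrite -raddfB !alg_lift_pi raddfB.
have hM : monoid_morphism alg_lift_fun.
  split=> [|x y]; first by rewrite -(rmorph1 alg_pi) alg_lift_pi rmorph1.
  have [a ->] := alg_pi_surj x; have [b ->] := alg_pi_surj y.
  by rewrite -rmorphM !alg_lift_pi rmorphM.
have hZ : scalable alg_lift_fun.
  move=> c x; have [a ->] := alg_pi_surj x.
  by rewrite -linearZ /= !alg_lift_pi linearZ.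
pose F1 := GRing.isZmodMorphism.Build Q B alg_lift_fun hB.
pose F2 := GRing.isMonoidMorphism.Build Q B alg_lift_fun hM.
pose F3 := GRing.isScalable.Build K Q B *:%R alg_lift_fun hZ.
pose g : {lrmorphism Q -> B} := HB.pack alg_lift_fun F1 F2 F3.
by exists g => a; exact: alg_lift_pi.
Qed.
End Lift.
End QuotientAlgebra.

Lemma proper_of_character (K : fieldType) (A : algType K) (S : A -> Prop)
    (f : {lrmorphism A -> K^o}) :
  (forall s, S s -> f s = 0) -> ~ span (two_sided S) 1.
Proof.
move=> fS h; suff : f 1 = 0 :> K.
  by rewrite rmorph1; apply/eqP; rewrite oner_eq0.
elim: h => [|c s v [a [s' [b [Ss ->]]]] _ IH]; first exact: raddf0.
by rewrite linearP /= IH addr0 !rmorphM /= (fS _ Ss) mulr0 mul0r scaler0.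
Qed.

Section FreeAlgebra.
Variables (K : fieldType) (G : choiceType).

(* Noncommutative polynomials: the algebra of the free monoid on G. *)
Definition free_alg := {malg K[{fmonom G}]}.
HB.instance Definition _ := GRing.Lalgebra.on free_alg.

Definition free_gen (g : G) : free_alg := << fmu g >>.

Fact malg_central (c : K) (g : free_alg) : g * malgC c = malgC c * g.
Proof.
rewrite [LHS]fgmulgU [RHS]fgmulUg; apply/eq_bigr => k _.
by rewrite mulrC mulm1 mul1m.
Qed.
Fact free_scalerAr (c : K) (x y : free_alg) : c *: (x * y) = x * (c *: y).
Proof. by rewrite -!mul_malgC [RHS]mulrA malg_central mulrA. Qed.
HB.instance Definition _ := GRing.Lalgebra_isAlgebra.Build K free_alg free_scalerAr.

Section Eval.
Variables (A : algType K) (f : G -> A).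

Definition meval (m : {fmonom G}) : A := \prod_(g <- m) f g.
Fact meval_mmorphism : mmorphism meval.
Proof.
split=> [m1 m2|]; rewrite /meval; first by rewrite fmM big_cat.
by rewrite fm1 big_nil.
Qed.
HB.instance Definition _ := isMultiplicative.Build {fmonom G} A meval meval_mmorphism.

Definition free_eval : free_alg -> A := mmap (in_alg A) meval.

HB.instance Definition _ := GRing.Additive.copy free_eval (mmap (in_alg A) meval).
Fact free_eval_monoid : monoid_morphism free_eval.
Proof.
have h : multiplicative free_eval.
  apply: commr_mmap_is_multiplicative => g m m'.
  by rewrite /GRing.comm /= -scalerAl mul1r -scalerAr mulr1.
by case: h => h1 h2; split.
Qed.
HB.instance Definition _ := GRing.isMonoidMorphism.Build free_alg A free_eval free_eval_monoid.
Fact free_eval_scalable : scalable free_eval.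
Proof. by move=> c x; rewrite /free_eval mmapZ /= -scalerAl mul1r. Qed.
HB.instance Definition _ := GRing.isScalable.Build K free_alg A *:%R free_eval free_eval_scalable.

Lemma free_eval_gen g : free_eval (free_gen g) = f g.
Proof. by rewrite /free_eval mmapU /= scale1r mul1r /meval fmU big_seq1. Qed.
End Eval.
End FreeAlgebra.

Section TensorProduct.
Variables (K : fieldType) (V W : lmodType K).

(* V ⊗ W is the vector space on V * W modulo bilinearity. *)
Definition tens_gen (v : V) (w : W) : {malg K[(V * W)%type]} := << (v, w) >>.

Inductive tens_rel : {malg K[(V * W)%type]} -> Prop :=
| tens_rell c v v' w :
    tens_rel (tens_gen (c *: v + v') w - (c *: tens_gen v w + tens_gen v' w))
| tens_relr c v w w' :
    tens_rel (tens_gen v (c *: w + w') - (c *: tens_gen v w + tens_gen v w')).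

Definition tensor := quot_span tens_rel.
HB.instance Definition _ := GRing.Lmodule.on tensor.

Definition tpure (v : V) (w : W) : tensor := qpi tens_rel (tens_gen v w).

Lemma tpureDZl c v v' w : tpure (c *: v + v') w = c *: tpure v w + tpure v' w.
Proof.
apply/eqP; rewrite /tpure -linearP; apply/qpiP.
by apply: span_gen; apply: tens_rell.
Qed.
Lemma tpureDZr c v w w' : tpure v (c *: w + w') = c *: tpure v w + tpure v w'.
Proof.
apply/eqP; rewrite /tpure -linearP; apply/qpiP.
by apply: span_gen; apply: tens_relr.
Qed.

Lemma tensor_ind (P : tensor -> Prop) :
  P 0 -> (forall c v w z, P z -> P (c *: tpure v w + z)) -> forall z, P z.
Proof.
move=> P0 PS z; have [g ->] := qpi_surj z.
rewrite [g]monalgE; elim: (X in \sum_(k <- X) _) => [|[v w] s IH].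
  by rewrite big_nil raddf0.
rewrite big_cons raddfD /=.
have -> : << g@_(v, w) *g (v, w) >> = g@_(v, w) *: tens_gen v w.
  by apply/malgP => k; rewrite mcoeffZ !mcoeffU mulrnAr mulr1.
by rewrite linearZ; apply: PS.
Qed.

End TensorProduct.

Notation "V ⊗ W" := (tensor V%type W%type) : type_scope.
Notation "v ⊗ w" := (tpure v w) : ring_scope.

(* The linear map v ⊗ w |-> f v w, meaningful when [f] is bilinear. *)
HB.lock Definition tlift (K : fieldType) (V W X : lmodType K) (f : V -> W -> X)
  (z : V ⊗ W) : X := \sum_(p <- msupp (repr z)) (repr z)@_p *: f p.1 p.2.

Section TensorLift.
Variables (K : fieldType) (V W X : lmodType K).

Definition bilinear_map (f : V -> W -> X) : Prop :=
  (forall w, linear (f^~ w)) /\ (forall v, linear (f v)).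

Variable f : V -> W -> X.
Hypothesis f_bil : bilinear_map f.

Let ext (g : {malg K[(V * W)%type]}) : X := \sum_(p <- msupp g) g@_p *: f p.1 p.2.

Let extEw (d : {fset V * W}) g : (msupp g `<=` d)%fset ->
  ext g = \sum_(p <- d) g@_p *: f p.1 p.2.
Proof.
move=> le; rewrite /ext (big_fset_incl _ le) //= => p _ /mcoeff_outdom ->.
by rewrite scale0r.
Qed.

Let extP c g h : ext (c *: g + h) = c *: ext g + ext h.
Proof.
set d := (msupp (c *: g + h) `|` msupp g `|` msupp h)%fset.
have lg : (msupp g `<=` d)%fset by apply/fsubsetP => x; rewrite !inE => ->; rewrite orbT.
have lh : (msupp h `<=` d)%fset by apply/fsubsetP => x; rewrite !inE => ->; rewrite orbT.
have l : (msupp (c *: g + h) `<=` d)%fset by apply/fsubsetP => x; rewrite !inE => ->.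
rewrite (extEw l) (extEw lg) (extEw lh) scaler_sumr -big_split /=.
by apply: eq_bigr => p _; rewrite mcoeffD mcoeffZ scalerDl scalerA.
Qed.

Let ext_gen v w : ext (tens_gen v w) = f v w.
Proof. by rewrite (extEw msuppU_le) big_seq_fset1 mcoeffUU scale1r. Qed.

Let ext0 g : span (@tens_rel K V W) g -> ext g = 0.
Proof.
have e0 : ext 0 = 0 by rewrite /ext msupp0 big_seq_fset0.
have eN x y : ext (x - y) = ext x - ext y.
  by rewrite [x - y]addrC -[- y]scaleN1r extP scaleN1r addrC.
have eD x y : ext (x + y) = ext x + ext y.
  by rewrite -[x in LHS]scale1r extP scale1r.
have eZ c x : ext (c *: x) = c *: ext x.
  by rewrite -[c *: x]addr0 extP e0 addr0.
elim=> // c s v rs _ IH; rewrite extP IH addr0.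
case: rs => [d a b w|d a w w']; rewrite eN eD eZ !ext_gen.
  by rewrite f_bil.1 subrr scaler0.
by rewrite f_bil.2 subrr scaler0.
Qed.


Let tlift_pi g : tlift f (qpi _ g) = ext g.
Proof.
have e : ext (- 1 *: g + repr (qpi (@tens_rel K V W) g)) = 0.
  by apply: ext0; rewrite scaleN1r addrC; apply/qpiP; rewrite qpi_repr.
by move: e; rewrite tlift.unlock extP scaleN1r addrC => /eqP; rewrite subr_eq0 => /eqP.
Qed.

Lemma tliftE v w : tlift f (v ⊗ w) = f v w.
Proof. by rewrite tlift_pi ext_gen. Qed.

Lemma tlift_linear : linear (tlift f).
Proof.
move=> c y z; have [g ->] := qpi_surj y; have [h ->] := qpi_surj z.
by rewrite -linearP !tlift_pi extP.
Qed.

Lemma tlift_unique (F : V ⊗ W -> X) :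
  linear F -> (forall v w, F (v ⊗ w) = f v w) -> F =1 tlift f.
Proof.
move=> Fl Fe z; pose F1 := GRing.isLinear.Build K _ _ *:%R F Fl.
pose FL : {linear _ -> _} := HB.pack F F1.
pose F2 := GRing.isLinear.Build K _ _ *:%R (tlift f) tlift_linear.
pose TL : {linear _ -> _} := HB.pack (tlift f) F2.
rewrite -[F z]/(FL z) -[RHS]/(TL z).
elim/tensor_ind: z => [|c v w z IH]; first by rewrite !raddf0.
by rewrite !linearP IH /= Fe tliftE.
Qed.
End TensorLift.

Section TensorMaps.
Variable K : fieldType.
Implicit Types (U V W X Y Z : lmodType K).

Definition tmap V W X Y (f : V -> X) (g : W -> Y) : V ⊗ W -> X ⊗ Y :=
  tlift (fun v w => f v ⊗ g w).

Definition tassoc U V W : (U ⊗ V) ⊗ W -> U ⊗ (V ⊗ W) :=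
  tlift (fun z w => tlift (fun u v => u ⊗ (v ⊗ w)) z).

(* The bilinear map (u ⊗ v, x ⊗ y) |-> f u x ⊗ g v y. *)
Definition tmap2 U V W X Y Z (f : U -> W -> Y) (g : V -> X -> Z)
    (s : U ⊗ V) (t : W ⊗ X) : Y ⊗ Z :=
  tlift (fun u v => tlift (fun x y => f u x ⊗ g v y) t) s.

Lemma tpure_bil V W : bilinear_map (@tpure K V W).
Proof. by split=> [w c v v'|v c w w']; [exact: tpureDZl | exact: tpureDZr]. Qed.

Lemma tmapE V W X Y (f : V -> X) (g : W -> Y) : linear f -> linear g ->
  forall v w, tmap f g (v ⊗ w) = f v ⊗ g w.
Proof.
move=> fl gl v w; apply: tliftE; split=> [b c a a'|a c b b'].
  by rewrite fl tpureDZl.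
by rewrite gl tpureDZr.
Qed.


Lemma tlift_fun V W X (f g : V -> W -> X) c z :
  tlift (fun v w => c *: f v w + g v w) z = c *: tlift f z + tlift g z.
Proof.
rewrite tlift.unlock scaler_sumr -big_split; apply/eq_bigr => p _ /=.
by rewrite scalerDr !scalerA mulrC.
Qed.

Lemma eq_tlift V W X (f g : V -> W -> X) z :
  (forall v w, f v w = g v w) -> tlift f z = tlift g z.
Proof. by move=> fg; rewrite tlift.unlock; apply/eq_bigr => p _; rewrite fg. Qed.

Lemma tassocE U V W (u : U) (v : V) (w : W) :
  tassoc ((u ⊗ v) ⊗ w) = u ⊗ (v ⊗ w).
Proof.
have b (w' : W) : bilinear_map (fun (u : U) (v : V) => u ⊗ (v ⊗ w')).
  by split=> [? ? ? ?|? ? ? ?]; rewrite ?tpureDZl ?tpureDZr.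
have bb : bilinear_map
    (fun (z : U ⊗ V) (w : W) => tlift (fun u v => u ⊗ (v ⊗ w)) z).
  split=> [w'|z c x y]; first exact: tlift_linear (b w').
  by rewrite -tlift_fun; apply: eq_tlift => u' v'; rewrite !tpureDZr.
by rewrite /tassoc (tliftE bb) (tliftE (b w)).
Qed.

Lemma tmap2_bil U V W X Y Z (f : U -> W -> Y) (g : V -> X -> Z) :
  bilinear_map f -> bilinear_map g -> bilinear_map (tmap2 f g).
Proof.
move=> fb gb.
have b u v : bilinear_map (fun (x : W) (y : X) => f u x ⊗ g v y).
  split=> [y c x x'|x c y y']; first by rewrite fb.2 tpureDZl.
  by rewrite gb.2 tpureDZr.
have bb t : bilinear_map (fun u v => tlift (fun x y => f u x ⊗ g v y) t).
  split=> [v c u u'|u c v v']; rewrite -tlift_fun; apply: eq_tlift => x y.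
    by rewrite fb.1 tpureDZl.
  by rewrite gb.1 tpureDZr.
split=> [t|s c t t']; first exact: tlift_linear (bb t).
rewrite /tmap2 -tlift_fun; apply: eq_tlift => u v.
exact: tlift_linear (b u v) _ _ _.
Qed.

Lemma tmap2E U V W X Y Z (f : U -> W -> Y) (g : V -> X -> Z) :
  bilinear_map f -> bilinear_map g ->
  forall u v w x, tmap2 f g (u ⊗ v) (w ⊗ x) = f u w ⊗ g v x.
Proof.
move=> fb gb u v w x.
have b u' v' : bilinear_map (fun (x : W) (y : X) => f u' x ⊗ g v' y).
  split=> [y c a a'|a c y y']; first by rewrite fb.2 tpureDZl.
  by rewrite gb.2 tpureDZr.
have bb : bilinear_map (fun u v => tlift (fun x y => f u x ⊗ g v y) (w ⊗ x)).
  split=> [v' c a a'|a c v' v'']; rewrite -tlift_fun; apply: eq_tlift => ? ?.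
    by rewrite fb.1 tpureDZl.
  by rewrite gb.1 tpureDZr.
by rewrite /tmap2 (tliftE bb) (tliftE (b u v)).
Qed.
End TensorMaps.

Section BilinearInd.
Variables (K : fieldType) (V W X : lmodType K).

Lemma linear_tensor_ext (f g : V ⊗ W -> X) : linear f -> linear g ->
  (forall v w, f (v ⊗ w) = g (v ⊗ w)) -> f =1 g.
Proof.
move=> fl gl fg.
have fb : bilinear_map (fun v w => g (v ⊗ w)).
  by split=> [w c a b|v c a b]; rewrite -gl ?tpureDZl ?tpureDZr.
by move=> z; rewrite (tlift_unique fb fl fg) -(tlift_unique fb gl).
Qed.
End BilinearInd.

Section TensorAlgebra.
Variables (K : fieldType) (A B : algType K).

Definition tmul : A ⊗ B -> A ⊗ B -> A ⊗ B := tmap2 ( *%R) ( *%R).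

Lemma mul_bil (C : algType K) : bilinear_map (@GRing.mul C).
Proof. by split=> [w c a b|v c a b]; rewrite /= ?mulrDl ?mulrDr -?scalerAl -?scalerAr. Qed.

Lemma tmul_bil : bilinear_map tmul.
Proof. by apply: tmap2_bil; apply: mul_bil. Qed.

Lemma tmulE a b c d : tmul (a ⊗ b) (c ⊗ d) = (a * c) ⊗ (b * d).
Proof. by apply: tmap2E; apply: mul_bil. Qed.

Fact tmulA : associative tmul.
Proof.
move=> x y z; move: x; apply: linear_tensor_ext => [c a b|c a b|a b].
- by rewrite tmul_bil.1.
- by rewrite !tmul_bil.1.
move: y; apply: linear_tensor_ext => [c a' b'|c a' b'|a' b'].
- by rewrite tmul_bil.1 tmul_bil.2.
- by rewrite tmul_bil.2 tmul_bil.1.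
move: z; apply: linear_tensor_ext => [c a'' b''|c a'' b''|a'' b''].
- by rewrite !tmul_bil.2.
- by rewrite tmul_bil.2.
by rewrite !tmulE !mulrA.
Qed.
Fact tmul1l : left_id (1 ⊗ 1) tmul.
Proof.
apply: linear_tensor_ext => // [c a b|a b]; first by rewrite tmul_bil.2.
by rewrite tmulE !mul1r.
Qed.
Fact tmul1r : right_id (1 ⊗ 1) tmul.
Proof.
apply: linear_tensor_ext => // [c a b|a b]; first by rewrite tmul_bil.1.
by rewrite tmulE !mulr1.
Qed.
Fact tmulDl : left_distributive tmul +%R.
Proof. by move=> x y z; rewrite -[x in LHS]scale1r tmul_bil.1 scale1r. Qed.
Fact tmulDr : right_distributive tmul +%R.
Proof. by move=> x y z; rewrite -[y in LHS]scale1r tmul_bil.2 scale1r. Qed.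
HB.instance Definition _ := GRing.Zmodule_isPzRing.Build (A ⊗ B)%type
  tmulA tmul1l tmul1r tmulDl tmulDr.

Lemma tensM (a c : A) (b d : B) : (a ⊗ b) * (c ⊗ d) = (a * c) ⊗ (b * d).
Proof. exact: tmulE. Qed.
End TensorAlgebra.

Section HopfAlgebra.
Variables (K : fieldType) (A : algType K).

Record hopf_algebra := HopfAlgebra {
  comul : {linear A -> (A ⊗ A)%type};
  counit : {lrmorphism A -> K^o};
  antipode : {linear A -> A};
  comul_monoid : monoid_morphism comul;
  comulA a : tassoc (tmap comul idfun (comul a)) = tmap idfun comul (comul a);
  counitl a : tlift (fun b c => (counit b : K) *: c) (comul a) = a;
  counitr a : tlift (fun b c => (counit c : K) *: b) (comul a) = a;
  antipodel a : tlift (fun b c => antipode b * c) (comul a) = (counit a : K)%:A;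
  antipoder a : tlift (fun b c => b * antipode c) (comul a) = (counit a : K)%:A
}.

Variable H : hopf_algebra.
Implicit Types (M : lmodType K).

(* The laws [coactlM] and [coactrM] are delta (a m b) = Delta a . delta m . Delta b
   for the actions of A ⊗ A on A ⊗ M and on M ⊗ A, which [tmap2] induces from
   the multiplication and the actions. *)
Record bicovariant_bimodule M := BicovariantBimodule {
  lact : A -> M -> M;
  ract : M -> A -> M;
  coactl : {linear M -> (A ⊗ M)%type};
  coactr : {linear M -> (M ⊗ A)%type};
  lact_bil : bilinear_map lact;
  lact1 m : lact 1 m = m;
  lactM a b m : lact (a * b) m = lact a (lact b m);
  ract_bil : bilinear_map ract;
  ract1 m : ract m 1 = m;
  ractM m a b : ract m (a * b) = ract (ract m a) b;
  lractA a m b : ract (lact a m) b = lact a (ract m b);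
  coactlA m :
    tassoc (tmap (comul H) idfun (coactl m)) = tmap idfun coactl (coactl m);
  coactl1 m : tlift (fun a n => (counit H a : K) *: n) (coactl m) = m;
  coactrA m :
    tassoc (tmap coactr idfun (coactr m)) = tmap idfun (comul H) (coactr m);
  coactr1 m : tlift (fun n a => (counit H a : K) *: n) (coactr m) = m;
  coactlM a m b : coactl (ract (lact a m) b) =
    tmap2 *%R ract (tmap2 *%R lact (comul H a) (coactl m)) (comul H b);
  coactrM a m b : coactr (ract (lact a m) b) =
    tmap2 ract *%R (tmap2 lact *%R (comul H a) (coactr m)) (comul H b);
  coactlr m :
    tmap idfun coactr (coactl m) = tassoc (tmap coactl idfun (coactr m))
}.

Definition bicovariant_morphism M M' (G : bicovariant_bimodule M)
    (G' : bicovariant_bimodule M') (f : M -> M') : Prop :=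
  [/\ linear f,
      forall a m, f (lact G a m) = lact G' a (f m),
      forall m a, f (ract G m a) = ract G' (f m) a,
      forall m, coactl G' (f m) = tmap idfun f (coactl G m) &
      forall m, coactr G' (f m) = tmap f idfun (coactr G m)].

(* Every m is a finite right A-linear combination of the family e, and the
   coefficients are unique. *)
Definition freely_generates M (act : M -> A -> M) (I : eqType) (e : I -> M) : Prop :=
  (forall m, exists (s : seq I) (b : I -> A), m = \sum_(i <- s) act (e i) (b i))
  /\ (forall (s : seq I) (b : I -> A), uniq s ->
        \sum_(i <- s) act (e i) (b i) = 0 -> forall i, i \in s -> b i = 0).
End HopfAlgebra.

Section QuantumGL.
Variables (K : fieldType) (n : nat) (r : K) (q : 'I_n -> 'I_n -> K).

(* The entry R^{AB}_{CD}; the last factor is theta^{AB}, equal to 1 iff B < A. *)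
Definition Rmx (A B C D : 'I_n) : K :=
  (A == C)%:R * (B == D)%:R * (r / q A B + (r - 1) * (A == B)%:R)
  + (r - r^-1) * (A == D)%:R * (B == C)%:R * (B < A)%N%:R.

(* [Some (A, B)] is the generator T^A_B and [None] is Xi. *)
Definition GLgen : choiceType := option ('I_n * 'I_n).

(* The noncommutative product runs in increasing order: T^0_{s 0} T^1_{s 1} ... *)
Definition qdet (X : algType K) (T : 'I_n -> 'I_n -> X) : X :=
  \sum_(s : 'S_n)
    (\prod_(p : 'I_n * 'I_n | (p.1 < p.2)%N && (s p.2 < s p.1)%N)
       (- (r ^+ 2 / q (s p.2) (s p.1))))
    *: \prod_(A < n) T A (s A).

Definition preT (A B : 'I_n) : free_alg K GLgen := free_gen K (Some (A, B)).
Definition preXi : free_alg K GLgen := free_gen K None.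

Definition counit_gen (g : GLgen) : K^o :=
  if g is Some (A, B) then (A == B)%:R else 1.

Lemma counit_qdet : qdet (fun A B => (A == B)%:R : K^o) = 1.
Proof.
rewrite /qdet (bigD1 1%g) //= [X in _ + X]big1 => [|s s1]; last first.
  have [A sA] : exists A, A != s A.
    apply/existsP; rewrite -negb_forall; apply: contra s1 => /forallP h.
    by apply/eqP/permP => A; rewrite perm1; apply/esym/eqP.
  by rewrite (bigD1 A) //= (negbTE sA) mul0r scaler0.
rewrite addr0 [X in _ *: X]big1 => [|A _]; last by rewrite perm1 eqxx.
rewrite big_pred0 ?scale1r // => -[A B] /=.
by apply/negP; rewrite !perm1 => /andP[/ltn_trans h /h]; rewrite ltnn.
Qed.

(* The difference of the two sides of R^{AB}_{EF} T^E_C T^F_D = T^B_F T^A_E R^{EF}_{CD}. *)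
Definition RTT (X : algType K) (T : 'I_n -> 'I_n -> X) (A B C D : 'I_n) : X :=
  \sum_E \sum_F Rmx A B E F *: (T E C * T F D)
  - \sum_E \sum_F Rmx E F C D *: (T B F * T A E).

Section Images.
Variables (X Y : algType K) (f : {lrmorphism X -> Y}) (T : 'I_n -> 'I_n -> X).

Lemma map_qdet : f (qdet T) = qdet (fun A B => f (T A B)).
Proof.
rewrite /qdet raddf_sum; apply/eq_bigr => s _ /=.
by rewrite linearZ /= rmorph_prod.
Qed.

Lemma map_RTT A B C D : f (RTT T A B C D) = RTT (fun A B => f (T A B)) A B C D.
Proof.
rewrite /RTT raddfB /=; congr (_ - _); rewrite raddf_sum.
  apply/eq_bigr => E _; rewrite raddf_sum; apply/eq_bigr => F _ /=.
  by rewrite linearZ /= rmorphM.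
apply/eq_bigr => E _; rewrite raddf_sum; apply/eq_bigr => F _ /=.
by rewrite linearZ /= rmorphM.
Qed.
End Images.

Lemma RTT_delta (X : algType K) A B C D :
  RTT (fun A B => (A == B)%:R : X) A B C D = 0.
Proof.
apply/eqP; rewrite subr_eq0; apply/eqP.
transitivity (Rmx A B C D *: (1 : X)).
  rewrite (bigD1 C) //= (bigD1 D) //= !eqxx mulr1 big1 => [|F /negbTE FD]; last first.
    by rewrite FD mulr0 scaler0.
  rewrite addr0 big1 ?addr0 // => E /negbTE EC.
  by rewrite big1 // => F _; rewrite EC mul0r scaler0.
rewrite (bigD1 A) //= (bigD1 B) //= !eqxx mulr1 big1 => [|F /negbTE FB]; last first.
  by rewrite eq_sym FB mul0r scaler0.
rewrite addr0 big1 ?addr0 // => E /negbTE EA.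
by rewrite big1 // => F _; rewrite [A == E]eq_sym EA mulr0 scaler0.
Qed.

Inductive GL_rel : free_alg K GLgen -> Prop :=
| rel_RTT A B C D : GL_rel (RTT preT A B C D)
| rel_detXi : GL_rel (qdet preT * preXi - 1)
| rel_Xidet : GL_rel (preXi * qdet preT - 1).

Definition counit_pre : {lrmorphism free_alg K GLgen -> K^o} :=
  free_eval counit_gen.

Lemma counit_preT A B : counit_pre (preT A B) = (A == B)%:R.
Proof. exact: free_eval_gen. Qed.
Lemma counit_preXi : counit_pre (preXi) = 1.
Proof. exact: free_eval_gen. Qed.

Lemma counit_pre_rel s : GL_rel s -> counit_pre s = 0.
Proof.
have e : (fun A B => counit_pre (preT A B)) = (fun A B => (A == B)%:R).
  by apply/funext => A; apply/funext => B; exact: counit_preT.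
have d : counit_pre (qdet preT) = 1.
  by rewrite map_qdet e counit_qdet.
case=> [A B C D||].
- by rewrite map_RTT e RTT_delta.
- by rewrite raddfB /= rmorphM /= rmorph1 d counit_preXi mulr1 subrr.
- by rewrite raddfB /= rmorphM /= rmorph1 d counit_preXi mulr1 subrr.
Qed.

Fact GL_rel_proper : ~ span (two_sided GL_rel) 1.
Proof. exact: (proper_of_character counit_pre_rel). Qed.

Definition GL := quot_alg (Relations GL_rel_proper).
HB.instance Definition _ := GRing.UnitAlgebra.on GL.

Definition GL_pi : {lrmorphism free_alg K GLgen -> GL} :=
  alg_pi (Relations GL_rel_proper).
Definition GLT (A B : 'I_n) : GL := GL_pi (preT A B).
Definition GLXi : GL := GL_pi preXi.

Lemma GL_pi_surj z : exists a, z = GL_pi a.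
Proof. exact: alg_pi_surj. Qed.

Lemma GL_pi_rel s : GL_rel s -> GL_pi s = 0.
Proof. exact: (@alg_pi_rel _ _ (Relations GL_rel_proper)). Qed.

Lemma GL_lift (B : algType K) (f : {lrmorphism free_alg K GLgen -> B}) :
  (forall s, GL_rel s -> f s = 0) ->
  exists g : {lrmorphism GL -> B}, forall a, g (GL_pi a) = f a.
Proof. exact: (@alg_lift_exists _ _ (Relations GL_rel_proper)). Qed.

Lemma GLT_RTT A B C D : RTT GLT A B C D = 0.
Proof. by rewrite /GLT -(map_RTT GL_pi); apply: GL_pi_rel; exact: rel_RTT. Qed.

Lemma GL_detXi : qdet GLT * GLXi = 1 /\ GLXi * qdet GLT = 1.
Proof.
rewrite /GLT /GLXi -(map_qdet GL_pi) -!(rmorphM GL_pi) -(rmorph1 GL_pi).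
split; apply/eqP; rewrite -subr_eq0 -(raddfB GL_pi); apply/eqP.
  by apply: GL_pi_rel; exact: rel_detXi.
by apply: GL_pi_rel; exact: rel_Xidet.
Qed.

Lemma GL_counit_exists :
  exists e : {lrmorphism GL -> K^o}, forall A B, e (GLT A B) = (A == B)%:R.
Proof.
have [e eE] := GL_lift counit_pre_rel.
by exists e => A B; rewrite -counit_preT -eE.
Qed.

(* [H] is the Hopf structure of GL_{q,r}(n): the values on the generators
   determine the coproduct and the counit, and the antipode axioms determine
   the antipode. *)
Definition GL_hopf (H : hopf_algebra GL) : Prop :=
  [/\ forall A B, comul H (GLT A B) = \sum_C GLT A C ⊗ GLT C B,
      comul H GLXi = GLXi ⊗ GLXi,
      forall A B, counit H (GLT A B) = (A == B)%:R,
      forall A B, \sum_C antipode H (GLT A C) * GLT C B = (A == B)%:R &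
      forall A B, \sum_C GLT A C * antipode H (GLT C B) = (A == B)%:R].
End QuantumGL.

Section QuantumIGL.
Variables (K : fieldType) (N : nat) (r : K) (q : 'I_N.+1 -> 'I_N.+1 -> K).

(* The index a in {1, ..., N} is [lift ord0 a] for a : 'I_N. *)
Definition qlow (a b : 'I_N) : K := q (lift ord0 a) (lift ord0 b).

(* IGL_{q,r}(N) is a quotient of GL_{q,r}(N+1); the two-sided ideal generated
   by the T^0_a is a Hopf ideal, since the coproduct of T^0_a is
   T^0_0 ⊗ T^0_a + T^0_b ⊗ T^b_a and its antipode is again in the ideal. *)
Inductive IGL_rel : GL r q -> Prop :=
| rel_T0 (a : 'I_N) : IGL_rel (GLT r q ord0 (lift ord0 a)).

Fact IGL_rel_proper : ~ span (two_sided IGL_rel) 1.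
Proof.
have [e eE] := GL_counit_exists r q.
by apply: (@proper_of_character _ _ _ e) => s [a]; rewrite eE (negbTE (neq_lift _ _)).
Qed.

Definition IGL := quot_alg (Relations IGL_rel_proper).
HB.instance Definition _ := GRing.UnitAlgebra.on IGL.

Definition IGL_pi : {lrmorphism GL r q -> IGL} :=
  alg_pi (Relations IGL_rel_proper).
Definition IGLx (a : 'I_N) : IGL := IGL_pi (GLT r q (lift ord0 a) ord0).
Definition IGLu : IGL := IGL_pi (GLT r q ord0 ord0).
Definition IGLT (a b : 'I_N) : IGL := IGL_pi (GLT r q (lift ord0 a) (lift ord0 b)).

Lemma IGL_pi_surj z : exists a, z = IGL_pi a.
Proof. exact: alg_pi_surj. Qed.

Lemma IGL_pi_rel s : IGL_rel s -> IGL_pi s = 0.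
Proof. exact: (@alg_pi_rel _ _ (Relations IGL_rel_proper)). Qed.

Lemma IGL_lift (B : algType K) (f : {lrmorphism GL r q -> B}) :
  (forall a, f (GLT r q ord0 (lift ord0 a)) = 0) ->
  exists g : {lrmorphism IGL -> B}, forall a, g (IGL_pi a) = f a.
Proof.
move=> f0; apply: (@alg_lift_exists _ _ (Relations IGL_rel_proper)).
by move=> s [a]; exact: f0.
Qed.

Lemma IGL_RTT A B C D : RTT r q (fun A B => IGL_pi (GLT r q A B)) A B C D = 0.
Proof. by rewrite -(map_RTT r q IGL_pi) GLT_RTT (rmorph0 IGL_pi). Qed.

Lemma IGL_T0 a : IGL_pi (GLT r q ord0 (lift ord0 a)) = 0.
Proof. by apply: IGL_pi_rel; exact: rel_T0. Qed.

Lemma IGL_detXi (d := qdet r q (fun A B => IGL_pi (GLT r q A B))) :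
  d * IGL_pi (GLXi r q) = 1 /\ IGL_pi (GLXi r q) * d = 1.
Proof.
rewrite /d -(map_qdet r q IGL_pi) -!(rmorphM IGL_pi).
by have [-> ->] := GL_detXi r q; rewrite (rmorph1 IGL_pi).
Qed.

(* The index i = (i_0, (i_1, ..., i_N)) of the ordered monomial zeta^i. *)
Definition zidx : eqType := (int * {ffun 'I_N -> nat})%type.
Definition zdeg (i : zidx) : int * nat := (i.1, \sum_(a < N) i.2 a)%N.
Definition zeta (i : zidx) : IGL := IGLu ^ i.1 * \prod_(a < N) IGLx a ^+ i.2 a.

(* [iota] stands for the inclusion of GL_{q,r}(N) in IGL_{q,r}(N). *)
Section Gamma.
Variables (iota : {lrmorphism GL r qlow -> IGL}) (h : int) (k : nat).

Definition in_Gamma (z : IGL) : Prop :=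
  exists b : k.-tuple 'I_N -> GL r qlow,
    z = \sum_(t : k.-tuple 'I_N) IGLu ^ h * (\prod_(a <- t) IGLx a) * iota (b t).

Definition Gamma_pred : {pred IGL} := fun z => `[< in_Gamma z >].

Fact Gamma_submod_closed : submod_closed Gamma_pred.
Proof.
split=> [|c x y /asboolP[b ->] /asboolP[b' ->]].
  apply/asboolP; exists (fun=> 0); rewrite big1 // => t _.
  by rewrite raddf0 mulr0.
apply/asboolP; exists (fun t => c *: b t + b' t).
rewrite scaler_sumr -big_split; apply: eq_bigr => t _ /=.
by rewrite linearP mulrDr -scalerAr.
Qed.
HB.instance Definition _ := GRing.isSubmodClosed.Build K IGL Gamma_pred Gamma_submod_closed.

Record Gamma := MkGamma { gval : IGL; _ : gval \in Gamma_pred }.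
HB.instance Definition _ := [isSub for gval].
HB.instance Definition _ := [Choice of Gamma by <:].
HB.instance Definition _ := [SubChoice_isSubLmodule of Gamma by <:].
End Gamma.
End QuantumIGL.

(* u commutes with det (T^a_b) and is invertible in IGL_{q,r}(N), hence its
   integer powers are the genuine ones. *)
Section InvertibilityOfU.
Variables (K : fieldType) (N : nat) (r : K) (q : 'I_N.+1 -> 'I_N.+1 -> K).
Hypothesis q0 : forall A B, q A B != 0.
Hypothesis r0 : r != 0.
Variables (X : algType K) (t : 'I_N.+1 -> 'I_N.+1 -> X).
Hypothesis tR : forall A B C D, RTT r q t A B C D = 0.
Hypothesis t0 : forall a, t ord0 (lift ord0 a) = 0.
Lemma T_u_commute b d : t (lift ord0 b) (lift ord0 d) * t ord0 ord0 =
  (q (lift ord0 b) ord0 / q (lift ord0 d) ord0) *: (t ord0 ord0 * t (lift ord0 b) (lift ord0 d)).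
Proof.
have /eqP := tR (lift ord0 b) ord0 (lift ord0 d) ord0.
rewrite /RTT subr_eq0 => /eqP.
have nl a : (ord0 == lift ord0 a :> 'I_N.+1) = false by rewrite (negbTE (neq_lift _ _)).
have ln a : (lift ord0 a == ord0 :> 'I_N.+1) = false by rewrite eq_sym nl.
rewrite (bigD1 (lift ord0 b)) //= (bigD1 ord0) //= {1}/Rmx !eqxx ln nl !Monoid.simpm /=.
rewrite [X in _ + X + _]big1 => [|F /negbTE F0]; last first.
  by rewrite /Rmx eqxx [ord0 == F]eq_sym F0 ln !Monoid.simpm ?mul0r ?scale0r.
rewrite [X in _ + X = _]big1 => [|E /negbTE Eb]; last first.
  apply: big1 => F _; rewrite /Rmx [_ == E]eq_sym Eb !Monoid.simpm /=.
  case: (ord0 =P E) => [<-|_]; last by rewrite !Monoid.simpm ?mul0r scale0r.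
  by rewrite t0 mul0r scaler0.
rewrite (bigD1 (lift ord0 d)) //= (bigD1 ord0) //= {1}/Rmx !eqxx ln !Monoid.simpm /=.
rewrite [X in _ = _ + X + _]big1 => [|F /negbTE F0]; last first.
  by rewrite /Rmx eqxx F0 ln !Monoid.simpm ?mul0r scale0r.
rewrite [X in _ = _ + X]big1 => [|E /negbTE Eb]; last first.
  apply: big1 => F _; rewrite /Rmx Eb !Monoid.simpm /=.
  case: (E =P ord0) => [->|_]; last by rewrite !Monoid.simpm ?mul0r scale0r.
  by rewrite ltn0 !Monoid.simpm scale0r.
rewrite !addr0 ?mulr0 ?addr0 => e.
have {e} := congr1 (fun z => (q (lift ord0 b) ord0 / r) *: z) e.
by rewrite !scalerA !mulrA !divfK ?divff ?scale1r.
Qed.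

Lemma prodT_u_commute (s : 'S_N.+1) : s ord0 = ord0 ->
  (\prod_(b < N) t (lift ord0 b) (s (lift ord0 b))) * t ord0 ord0 =
  t ord0 ord0 * \prod_(b < N) t (lift ord0 b) (s (lift ord0 b)).
Proof.
move=> s0.
have sl b : exists d, s (lift ord0 b) = lift ord0 d.
  have : ord0 != s (lift ord0 b).
    by rewrite -[X in X != _]s0 (inj_eq perm_inj) neq_lift.
  by case/unlift_some => d -> _; exists d.
pose c (b : 'I_N) := q (lift ord0 b) ord0 / q (s (lift ord0 b)) ord0.
have cE : \prod_(b < N) c b = 1.
  have : \prod_(A < N.+1) (q A ord0 / q (s A) ord0) = 1.
    rewrite prodf_div [X in _ / X](_ : _ = \prod_A q A ord0) ?divff //.
      by apply/prodf_neq0 => A _; exact: q0.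
    by rewrite [RHS](reindex_inj (@perm_inj _ s)).
  by rewrite big_ord_recl s0 divff // mul1r.
suff h (l : seq 'I_N) :
    (\prod_(b <- l) t (lift ord0 b) (s (lift ord0 b))) * t ord0 ord0 =
    (\prod_(b <- l) c b) *:
      (t ord0 ord0 * \prod_(b <- l) t (lift ord0 b) (s (lift ord0 b))).
  by rewrite h cE scale1r.
elim: l => [|b l IH]; first by rewrite !big_nil mul1r mulr1 scale1r.
have [d sd] := sl b.
rewrite !big_cons -mulrA IH -scalerAr !mulrA {1}sd T_u_commute.
by rewrite -scalerAl scalerA -sd [c b * _]mulrC !mulrA.
Qed.

Lemma qdet_u_factor : exists D : X,
  qdet r q t = t ord0 ord0 * D /\ D * t ord0 ord0 = t ord0 ord0 * D.
Proof.
pose co (s : 'S_N.+1) := \prod_(p : 'I_N.+1 * 'I_N.+1 | (p.1 < p.2)%N && (s p.2 < s p.1)%N)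
       - (r ^+ 2 / q (s p.2) (s p.1)).
exists (\sum_(s : 'S_N.+1 | s ord0 == ord0)
  co s *: \prod_(b < N) t (lift ord0 b) (s (lift ord0 b))); split.
  rewrite mulr_sumr /qdet [RHS]big_mkcond; apply: eq_bigr => s _.
  rewrite big_ord_recl -/(co s); case: eqP => [->|/eqP]; first by rewrite scalerAr.
  by rewrite eq_sym => /unlift_some[d -> _]; rewrite t0 mul0r scaler0.
rewrite mulr_sumr mulr_suml; apply: eq_bigr => s /eqP s0.
by rewrite -scalerAl -scalerAr prodT_u_commute.
Qed.
End InvertibilityOfU.


Lemma IGLu_unit (K : fieldType) N (r : K) (q : 'I_N.+1 -> 'I_N.+1 -> K) :
  r != 0 -> (forall A B, q A B != 0) -> IGLu r q \is a GRing.unit.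
Proof.
move=> r0 q0; have [D [dE Du]] := qdet_u_factor q0 r0 (@IGL_RTT K N r q) (@IGL_T0 K N r q).
have [] := IGL_detXi r q; rewrite dE -/(IGLu r q) => h1 h2.
rewrite -/(IGLu r q) in Du.
move: (IGLu r q) (IGL_pi _ _ _) h1 h2 Du => u Xi h1 h2 Du.
have a : Xi * D * u = 1 by rewrite -mulrA Du.
have b : u * (D * Xi) = 1 by rewrite mulrA.
apply/unitrP; exists (D * Xi); split=> //.
by rewrite -[D * Xi]mul1r -a -[_ * (D * Xi)]mulrA b mulr1.
Qed.

(* Main.v *)
(* Write B for IGL(N) and A for GL(N). As [q a 0] is constant, [u] commutes with the
   T^a_b and the RTT relations of B become those of A together with q-commutation
   rules for [u] and [x]. Hence diag(1, T) solves the RTT relations in A, and both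
   coactions are obtained by multiplying the matrix of B by it on one side.
     B acts on the space F spanned by the indices of the ordered monomials: [u] and
   [x] by left multiplication, T by a triangular matrix of q-oscillators, so that an
   element c of A sends the vacuum to counit(c) times the vacuum. Through the right
   coaction B acts on F ⊗ A, and the map F ⊗ A -> B, i ⊗ c |-> zeta^i c, is B-linear.
   Since z |-> z . (vacuum ⊗ 1) sends zeta^i c back to i ⊗ c, it is the inverse map;
   this gives at once the generation and the freeness of B over A and the injectivity
   of A -> B. The projection of F onto a degree commutes with the action of A, so that
   the homogeneous components are retracts of B stable under all the structure maps. *)

From HB Require Import structures.
From mathcomp Require Import all_boot all_order all_algebra fingroup perm.
From mathcomp Require Import finmap monalg ring.
From mathcomp Require Import boolp functions reals complex.
Require Import Defs.

Set Implicit Arguments.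
Unset Strict Implicit.
Unset Printing Implicit Defensive.

Import GRing.Theory Num.Theory.
Local Open Scope ring_scope.

(** The presentation of B yields spanning statements only. Independence and the injectivity of A ->
    B need a large enough module, although no basis of A is at hand. In F ⊗ A the algebra A enters
    as a module over itself, so that only the small space F has to be constructed. F is an explicit
    form of the induced module B ⊗_A K, where A acts on K by the counit. Pushing T^b_d through the
    x^a until it meets the vacuum gives operators that vanish for b < d, whence the triangular
    shape; it also makes the determinant a product of diagonal operators, visibly invertible. The
    commutation rules used to push T through an ordered monomial hold in B and in the operators on F
    alike, which is what makes F ⊗ A -> B equivariant. Constancy of q_{a0} is what permits u = 1 in
    diag(1, T): in general T^b_d u = (q_{b0} / q_{d0}) u T^b_d. Since r may be a root of unity, the
    lowering operators can kill more than the vacuum. The ordered monomials are therefore reached by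
    u, its inverse and the x^a only, whose coefficients never vanish. *)

Local Notation fidx N := (int * {ffun 'I_N -> nat})%type.

(** * Tensor products *)

Section TensorLinear.
Variable K : fieldType.
Implicit Types (U V W X Y Z : lmodType K).

Lemma linear0_fun V W (f : V -> W) : linear f -> f 0 = 0.
Proof. by move=> fl; have := fl (-1) 0 0; rewrite scaler0 addr0 scaleN1r addNr. Qed.

Lemma linearZ_fun V W (f : V -> W) : linear f -> forall c v, f (c *: v) = c *: f v.
Proof. by move=> fl c v; have := fl c v 0; rewrite !addr0 (linear0_fun fl) addr0. Qed.

Lemma linearD_fun V W (f : V -> W) : linear f -> {morph f : v w / v + w}.
Proof. by move=> fl v w; have := fl 1 v w; rewrite !scale1r. Qed.

Lemma linear_sum_fun V W (f : V -> W) (I : Type) (s : seq I) P (F : I -> V) :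
  linear f -> f (\sum_(i <- s | P i) F i) = \sum_(i <- s | P i) f (F i).
Proof. by move=> fl; apply: big_morph; [exact: linearD_fun|exact: linear0_fun]. Qed.

Lemma linear_comp V W X (g : W -> X) (f : V -> W) :
  linear g -> linear f -> linear (g \o f).
Proof. by move=> gl fl c v w; rewrite /= fl gl. Qed.

Lemma linear_idfun V : linear (@idfun V). Proof. by []. Qed.

Lemma linear_pureE V W X Y (f : V -> X) (g : W -> Y) :
  linear f -> linear g -> bilinear_map (fun v w => f v ⊗ g w).
Proof.
move=> fl gl; split=> [b c a a'|a c b b']; first by rewrite fl tpureDZl.
by rewrite gl tpureDZr.
Qed.

Lemma tmap_linear V W X Y (f : V -> X) (g : W -> Y) :
  linear f -> linear g -> linear (tmap f g).
Proof. by move=> fl gl; apply: tlift_linear; exact: linear_pureE. Qed.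

Lemma tpure_sumr V W (I : Type) (s : seq I) P (v : V) (F : I -> W) :
  v ⊗ (\sum_(i <- s | P i) F i) = \sum_(i <- s | P i) v ⊗ F i.
Proof. by apply: linear_sum_fun; apply: (tpure_bil V W).2. Qed.

Lemma tpure_suml V W (I : Type) (s : seq I) P (F : I -> V) (w : W) :
  (\sum_(i <- s | P i) F i) ⊗ w = \sum_(i <- s | P i) F i ⊗ w.
Proof. by apply: (linear_sum_fun (f := (fun v => v ⊗ w))); apply: (tpure_bil V W).1. Qed.

Lemma tpure0r V W (v : V) : v ⊗ (0 : W) = 0.
Proof. exact: linear0_fun ((tpure_bil V W).2 v). Qed.

Lemma tpure0l V W (w : W) : (0 : V) ⊗ w = 0.
Proof. exact: (linear0_fun (f := (fun v => v ⊗ w)) ((tpure_bil V W).1 w)). Qed.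

Lemma tpureZl V W c (v : V) (w : W) : (c *: v) ⊗ w = c *: (v ⊗ w).
Proof. exact: (linearZ_fun (f := (fun v => v ⊗ w)) ((tpure_bil V W).1 w)). Qed.

Lemma tpureZr V W c (v : V) (w : W) : v ⊗ (c *: w) = c *: (v ⊗ w).
Proof. exact: linearZ_fun ((tpure_bil V W).2 v) _ _. Qed.

Lemma tassoc_bil U V W :
  bilinear_map (fun (z : U ⊗ V) (w : W) => tlift (fun u v => u ⊗ (v ⊗ w)) z).
Proof.
have b (w' : W) : bilinear_map (fun (u : U) (v : V) => u ⊗ (v ⊗ w')).
  by split=> [? ? ? ?|? ? ? ?]; rewrite ?tpureDZl ?tpureDZr.
split=> [w'|z c x y]; first exact: tlift_linear (b w').
by rewrite -tlift_fun; apply: eq_tlift => u' v'; rewrite !tpureDZr.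
Qed.

Lemma tassoc_linear U V W : linear (@tassoc K U V W).
Proof. by apply: tlift_linear; exact: tassoc_bil. Qed.

Lemma linear_tensor_ext3 U V W X (f g : (U ⊗ V) ⊗ W -> X) : linear f -> linear g ->
  (forall u v w, f ((u ⊗ v) ⊗ w) = g ((u ⊗ v) ⊗ w)) -> f =1 g.
Proof.
move=> fl gl fg; apply: linear_tensor_ext => // z w; move: z.
by apply: linear_tensor_ext => [c a b|c a b|u v]; rewrite ?tpureDZl ?fl ?gl.
Qed.

Lemma tmap_comp V W V' W' V'' W'' (f : V -> V') (g : W -> W') (f' : V' -> V'')
    (g' : W' -> W'') : linear f -> linear g -> linear f' -> linear g' ->
  tmap f' g' \o tmap f g =1 tmap (f' \o f) (g' \o g).
Proof.
move=> fl gl fl' gl'; apply: linear_tensor_ext => [||v w /=].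
- by apply: linear_comp; apply: tmap_linear.
- by apply: tmap_linear; apply: linear_comp.
by rewrite !tmapE //; apply: linear_comp.
Qed.

Lemma eq_tmap V W X Y (f f' : V -> X) (g g' : W -> Y) :
  f =1 f' -> g =1 g' -> tmap f g =1 tmap f' g'.
Proof. by move=> ff gg z; apply: eq_tlift => v w; rewrite ff gg. Qed.

Lemma tmap_id V W : tmap (@idfun V) (@idfun W) =1 id.
Proof. by apply: linear_tensor_ext => // [|v w]; [exact: tmap_linear|rewrite tmapE]. Qed.

Lemma tassoc_tmap U V W U' V' W' (f : U -> U') (g : V -> V') (h : W -> W') :
  linear f -> linear g -> linear h ->
  @tassoc K _ _ _ \o tmap (tmap f g) h =1 tmap f (tmap g h) \o @tassoc K _ _ _.
Proof.
move=> fl gl hl; have fgl := tmap_linear fl gl; have ghl := tmap_linear gl hl.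
apply: linear_tensor_ext3 => [||u v w /=].
- by apply: linear_comp; [exact: tassoc_linear|exact: tmap_linear].
- by apply: linear_comp; [exact: tmap_linear|exact: tassoc_linear].
by rewrite tassocE !tmapE // tassocE.
Qed.

(** Naturality of [tmap2]. It gives the multiplicativity of [tmap f g], the passage from induced
    actions to products in a tensor algebra, and the transport of the covariance laws to a
    homogeneous component. *)
Lemma tmap_tmap2 U V W X Y Z U' V' W' X' Y' Z' (m : U -> W -> Y) (n : V -> X -> Z)
    (m' : U' -> W' -> Y') (n' : V' -> X' -> Z') (f : U -> U') (g : V -> V')
    (h : W -> W') (k : X -> X') (a : Y -> Y') (b : Z -> Z') :
  linear f -> linear g -> linear h -> linear k -> linear a -> linear b ->
  bilinear_map m -> bilinear_map n -> bilinear_map m' -> bilinear_map n' ->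
  (forall u w, a (m u w) = m' (f u) (h w)) ->
  (forall v x, b (n v x) = n' (g v) (k x)) ->
  forall s t, tmap a b (tmap2 m n s t) = tmap2 m' n' (tmap f g s) (tmap h k t).
Proof.
move=> fl gl hl kl al bl mb nb mb' nb' am bn s t; move: s.
have B := tmap2_bil mb nb; have B' := tmap2_bil mb' nb'.
apply: linear_tensor_ext => [||u v].
- exact: (linear_comp (tmap_linear al bl) (B.1 t)).
- exact: (linear_comp (B'.1 _) (tmap_linear fl gl)).
move: t; apply: linear_tensor_ext => [||w x].
- exact: (linear_comp (tmap_linear al bl) (B.2 _)).
- exact: (linear_comp (B'.2 _) (tmap_linear hl kl)).
by rewrite tmap2E // !tmapE // tmap2E // am bn.
Qed.

Lemma tassoc_tmap2 U V W U' V' W' X Y Z (m : U -> U' -> X) (n : V -> V' -> Y)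
    (p : W -> W' -> Z) : bilinear_map m -> bilinear_map n -> bilinear_map p ->
  forall s t, tassoc (tmap2 (tmap2 m n) p s t) =
    tmap2 m (tmap2 n p) (tassoc s) (tassoc t).
Proof.
move=> mb nb pb s t; have mnb := tmap2_bil mb nb; have npb := tmap2_bil nb pb.
have lb := tmap2_bil mnb pb; have rb := tmap2_bil mb npb.
move: s; apply: linear_tensor_ext3 => [||u v w].
- exact: (linear_comp (@tassoc_linear _ _ _) (lb.1 t)).
- exact: (linear_comp (rb.1 _) (@tassoc_linear _ _ _)).
move: t; apply: linear_tensor_ext3 => [||u' v' w'].
- exact: (linear_comp (@tassoc_linear _ _ _) (lb.2 _)).
- exact: (linear_comp (rb.2 _) (@tassoc_linear _ _ _)).
by rewrite (tmap2E mnb pb) (tmap2E mb nb) !tassocE (tmap2E mb npb) (tmap2E nb pb).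
Qed.

End TensorLinear.

Section TensorMul.
Variable K : fieldType.
Implicit Types (A B C : algType K).

Lemma tens1 A B : (1 : (A ⊗ B)%type) = 1 ⊗ 1. Proof. by []. Qed.

Lemma tmap_mul A B A' B' (f : A -> A') (g : B -> B') :
  linear f -> linear g -> monoid_morphism f -> monoid_morphism g ->
  monoid_morphism (tmap f g).
Proof.
move=> fl gl [f1 fM] [g1 gM]; split; first by rewrite !tens1 tmapE // f1 g1.
by apply: tmap_tmap2 => //; exact: mul_bil.
Qed.

Lemma tscalerAl A B (c : K) (x y : (A ⊗ B)%type) : c *: (x * y) = c *: x * y.
Proof. exact/esym/(linearZ_fun ((tmul_bil A B).1 y)). Qed.

Lemma tscalerAr A B (c : K) (x y : (A ⊗ B)%type) : c *: (x * y) = x * (c *: y).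
Proof. exact/esym/(linearZ_fun ((tmul_bil A B).2 x)). Qed.

(* [tensor A B] is a ring that may a priori be zero, whereas algebras are nontrivial. *)
Definition talg A B (h : (1 : A) ⊗ (1 : B) != 0) : Type := (A ⊗ B)%type.

Section Instances.
Variables (A B : algType K) (h : (1 : A) ⊗ (1 : B) != 0).
HB.instance Definition _ := GRing.Lmodule.on (talg h).
HB.instance Definition _ := GRing.PzRing.on (talg h).
Fact talg_one_neq0 : (1 : talg h) != 0. Proof. exact: h. Qed.
HB.instance Definition _ := GRing.PzSemiRing_isNonZero.Build (talg h) talg_one_neq0.
HB.instance Definition _ := GRing.Lmodule_isLalgebra.Build K (talg h) (@tscalerAl A B).
HB.instance Definition _ := GRing.Lalgebra_isAlgebra.Build K (talg h) (@tscalerAr A B).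
End Instances.

(** The functional induced by f and g takes the value 1 on [1 ⊗ 1]. The counits thus provide the
    witness that [talg] asks for. *)
Lemma tens1_neq0 A B (f : {lrmorphism A -> K^o}) (g : {lrmorphism B -> K^o}) :
  (1 : A) ⊗ (1 : B) != 0.
Proof.
have b : bilinear_map (fun (a : A) (b : B) => (f a * g b : K^o)).
  by split=> [y c v w|y c v w] /=; rewrite linearP ?mulrDl ?mulrDr /= -?scalerAl -?scalerAr.
apply/negP => /eqP /(congr1 (tlift (fun a b => (f a * g b : K^o)))).
rewrite tliftE // !rmorph1 mulr1 (linear0_fun (tlift_linear b)).
by apply/eqP; rewrite oner_eq0.
Qed.

(** [talg] keeps the operations of the tensor product; it only lets a tensor product serve again as
    a factor in a tensor product of algebras. *)
Lemma tassoc_mul A B C (h : (1 : A) ⊗ (1 : B) != 0) (k : (1 : B) ⊗ (1 : C) != 0) :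
  monoid_morphism (@tassoc K A B C : (talg h ⊗ C)%type -> (A ⊗ talg k)%type).
Proof.
split=> [|X Y]; first exact: tassocE.
by apply: (tassoc_tmap2 (@mul_bil K A) (@mul_bil K B) (@mul_bil K C)).
Qed.

End TensorMul.

(** * Endomorphisms, free modules and spans *)

Section EndomorphismAlgebra.
Variables (K : fieldType) (V : lmodType K) (v0 : V) (v0_neq0 : v0 != 0).

Definition linear_pred : {pred V -> V} := fun f => `[< linear f >].

Fact linear_pred_submod : submod_closed linear_pred.
Proof.
split=> [|c f g /asboolP fl /asboolP gl]; apply/asboolP => d v w.
  by rewrite scaler0 addr0.
rewrite /= !fctE /= fl gl !scalerDr !scalerA [d * c]mulrC -!addrA; congr (_ + _).
by rewrite addrCA.
Qed.
HB.instance Definition _ :=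
  GRing.isSubmodClosed.Build K (V -> V) linear_pred linear_pred_submod.

Record lend := Lend { lapp :> V -> V; _ : lapp \in linear_pred }.
HB.instance Definition _ := [isSub for lapp].
HB.instance Definition _ := [Choice of lend by <:].
HB.instance Definition _ := [SubChoice_isSubLmodule of lend by <:].

Lemma lapp_linear (f : lend) : linear f.
Proof. by case: f => f /= /asboolP. Qed.

Lemma lapp_scale (f : lend) c v : f (c *: v) = c *: f v.
Proof. exact: (linearZ_fun (lapp_linear f)). Qed.

Lemma lendP (f g : lend) : f =1 g -> f = g.
Proof. by move=> fg; apply/val_inj/funext. Qed.

Fact lend_key (f : V -> V) : linear f -> f \in linear_pred.
Proof. by move=> fl; apply/asboolP. Qed.

Definition mk_lend f (fl : linear f) : lend := Lend (lend_key fl).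

Fact lend_compl (f g : lend) : linear (f \o g).
Proof. by apply: linear_comp; exact: lapp_linear. Qed.

Definition lend_mul (f g : lend) : lend := mk_lend (lend_compl f g).
Definition lend_one : lend := mk_lend (@linear_idfun K V).

Lemma lappD (f g : lend) v : (f + g) v = f v + g v. Proof. by []. Qed.
Lemma lapp0 v : (0 : lend) v = 0. Proof. by []. Qed.
Lemma lappZ c (f : lend) v : (c *: f) v = c *: f v. Proof. by []. Qed.

Fact lend_mulA : associative lend_mul. Proof. by move=> f g h; apply: lendP. Qed.
Fact lend_mul1l : left_id lend_one lend_mul. Proof. by move=> f; apply: lendP. Qed.
Fact lend_mul1r : right_id lend_one lend_mul. Proof. by move=> f; apply: lendP. Qed.
Fact lend_mulDl : left_distributive lend_mul +%R.
Proof. by move=> f g h; apply: lendP. Qed.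
Fact lend_mulDr : right_distributive lend_mul +%R.
Proof.
by move=> f g h; apply: lendP => v; exact: (linearD_fun (lapp_linear f)).
Qed.
Fact lend_one_neq0 : lend_one != 0.
Proof. by apply: contra_neq v0_neq0 => /(congr1 (fun f : lend => f v0)). Qed.

(* The algebra of endomorphisms of a nonzero space; its type carries the witness of [V != 0]. *)
Definition lend_alg of v0 != 0 := lend.
Local Notation E := (lend_alg v0_neq0).
HB.instance Definition _ := GRing.Lmodule.on E.
HB.instance Definition _ := GRing.Zmodule_isNzRing.Build E
  lend_mulA lend_mul1l lend_mul1r lend_mulDl lend_mulDr lend_one_neq0.
Fact lend_scalerAl (c : K) (f g : E) : c *: (f * g) = c *: f * g.
Proof. by apply: lendP. Qed.
HB.instance Definition _ := GRing.Lmodule_isLalgebra.Build K E lend_scalerAl.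
Fact lend_scalerAr (c : K) (f g : E) : c *: (f * g) = f * (c *: g).
Proof. by apply: lendP => v; exact/esym/(linearZ_fun (lapp_linear f)). Qed.
HB.instance Definition _ := GRing.Lalgebra_isAlgebra.Build K E lend_scalerAr.

Lemma lappM (f g : E) v : (f * g : E) v = f (g v). Proof. by []. Qed.
Lemma lapp1 v : (1 : E) v = v. Proof. by []. Qed.
End EndomorphismAlgebra.

(* Locked to keep unification from unfolding the carrier of the free module. *)
HB.lock Definition basis (K : fieldType) (I : choiceType) (i : I) : {malg K[I]} := << i >>.

Section FreeModule.
Variables (K : fieldType) (I : choiceType).
Local Notation F := {malg K[I]}.
Local Notation basis := (@basis K I).

Lemma malgU_basis c i : << c *g i >> = c *: basis i.
Proof. by rewrite basis.unlock; apply/malgP => k; rewrite mcoeffZ !mcoeffU mulrnAr mulr1. Qed.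

Lemma malg_basisE (f : F) : f = \sum_(k <- msupp f) f@_k *: basis k.
Proof. by rewrite {1}[f]monalgE; apply: eq_bigr => k _; rewrite malgU_basis. Qed.

Lemma basis_neq0 i : basis i != 0.
Proof. by rewrite basis.unlock monalgU_eq0 oner_eq0. Qed.

Section Extension.
Variables (V : lmodType K) (h : I -> V).

Definition linext (f : F) : V := \sum_(k <- msupp f) f@_k *: h k.

Lemma linextEw (d : {fset I}) f : (msupp f `<=` d)%fset ->
  linext f = \sum_(k <- d) f@_k *: h k.
Proof.
move=> le; rewrite /linext (big_fset_incl _ le) //= => k _ /mcoeff_outdom ->.
by rewrite scale0r.
Qed.

Lemma linext_linear : linear linext.
Proof.
move=> c f g; set d := (msupp (c *: f + g) `|` msupp f `|` msupp g)%fset.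
have lf : (msupp f `<=` d)%fset by apply/fsubsetP => x; rewrite !inE => ->; rewrite orbT.
have lg : (msupp g `<=` d)%fset by apply/fsubsetP => x; rewrite !inE => ->; rewrite orbT.
have l : (msupp (c *: f + g) `<=` d)%fset by apply/fsubsetP => x; rewrite !inE => ->.
rewrite (linextEw lf) (linextEw lg) (linextEw l) scaler_sumr -big_split /=.
by apply: eq_bigr => k _; rewrite mcoeffD mcoeffZ scalerDl scalerA.
Qed.

Lemma linext_basis i : linext (basis i) = h i.
Proof. by rewrite basis.unlock (linextEw msuppU_le) big_seq_fset1 mcoeffUU scale1r. Qed.
End Extension.

Lemma linear_basis_ext (V : lmodType K) (f g : F -> V) :
  linear f -> linear g -> (forall i, f (basis i) = g (basis i)) -> f =1 g.
Proof.
move=> fl gl fg x; rewrite [x]malg_basisE !linear_sum_fun //.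
by apply: eq_bigr => k _; rewrite !linearZ_fun // fg.
Qed.

Lemma mcoeff_basis i j : (basis i)@_j = (i == j)%:R :> K.
Proof. by rewrite basis.unlock mcoeffU. Qed.

Lemma linear_tensor_basis_ext (W V : lmodType K) (f g : F ⊗ W -> V) :
  linear f -> linear g -> (forall i w, f (basis i ⊗ w) = g (basis i ⊗ w)) -> f =1 g.
Proof.
move=> fl gl fg; apply: linear_tensor_ext => // v w; move: v.
by apply: linear_basis_ext => // [c v v'|c v v']; rewrite tpureDZl ?fl ?gl.
Qed.

(** F ⊗ W is a direct sum of copies of W indexed by the basis of F; the projection to one copy reads
    off a coefficient in the proof of freeness. *)
Definition tcoeff (W : lmodType K) (i : I) : F ⊗ W -> W :=
  tlift (fun (f : F) w => f@_i *: w).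

Lemma tcoeff_bil (W : lmodType K) i :
  bilinear_map (fun (f : F) (w : W) => f@_i *: w).
Proof.
split=> [w c f g|f c w w'] /=; first by rewrite mcoeffD mcoeffZ scalerDl scalerA.
by rewrite scalerDr !scalerA mulrC.
Qed.

Lemma tcoeff_linear (W : lmodType K) i : linear (@tcoeff W i).
Proof. by apply: tlift_linear; exact: tcoeff_bil. Qed.

Lemma tcoeff_basis (W : lmodType K) i j (w : W) :
  tcoeff j (basis i ⊗ w) = if i == j then w else 0.
Proof.
rewrite /tcoeff tliftE; last exact: tcoeff_bil.
by rewrite mcoeff_basis; case: eqP; rewrite ?scale1r ?scale0r.
Qed.
End FreeModule.


Section Span.
Variables (K : fieldType) (V : lmodType K).

Lemma span_sub (S S' : V -> Prop) : (forall v, S v -> span S' v) ->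
  forall v, span S v -> span S' v.
Proof.
move=> SS v; elim=> [|c s {}v Ss _ IH]; first exact: span0.
by apply: spanD => //; apply: spanZ; apply: SS.
Qed.

Lemma span_image (W : lmodType K) (f : V -> W) (S : V -> Prop) (S' : W -> Prop) :
  linear f -> (forall v, S v -> span S' (f v)) -> forall v, span S v -> span S' (f v).
Proof.
move=> fl SS v; elim=> [|c s {}v Ss _ IH]; first by rewrite linear0_fun //; exact: span0.
by rewrite fl; apply: spanD => //; apply: spanZ; apply: SS.
Qed.

Lemma span_sum (S : V -> Prop) (I : Type) (s : seq I) (P : pred I) (F : I -> V) :
  (forall i, P i -> span S (F i)) -> span S (\sum_(i <- s | P i) F i).
Proof.
by move=> SF; elim/big_rec: _ => [|i v Pi Sv]; [exact: span0|apply: spanD => //; exact: SF].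
Qed.

Lemma span_ext (W : lmodType K) (f g : V -> W) (S : V -> Prop) :
  linear f -> linear g -> (forall v, S v -> f v = g v) -> forall v, span S v -> f v = g v.
Proof.
move=> fl gl fg v; elim=> [|c s {}v Ss _ IH]; first by rewrite !linear0_fun.
by rewrite fl gl IH fg.
Qed.

Lemma span_combination (A : lmodType K) (I : eqType) (act : V -> A -> V) (e : I -> V) v :
  (forall m, linear (act m)) -> span (fun w => exists i a, w = act (e i) a) v ->
  exists (s : seq I) (b : I -> A), v = \sum_(i <- s) act (e i) (b i).
Proof.
move=> al Sv; suff [s [b [_ [_ vE]]]] : exists (s : seq I) (b : I -> A),
    uniq s /\ (forall i, i \notin s -> b i = 0) /\ v = \sum_(i <- s) act (e i) (b i).
  by exists s, b.
have a0 m : act m 0 = 0 := linear0_fun (al m).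
elim: Sv => [|c _ {}v [i [a ->]] _ [s [b [us [b0 ->]]]]].
  by exists [::], (fun=> 0); rewrite big_nil.
pose b' j := b j + (if j == i then c *: a else 0).
exists (if i \in s then s else i :: s), b'; split; first by case: ifP => //= ->.
split=> [j|].
  rewrite /b'; case: ifP => [si js|si].
    by rewrite b0 // add0r; case: eqP js => // ->; rewrite si.
  by rewrite inE negb_or => /andP[/negbTE-> /b0->]; rewrite addr0.
have E (t : seq I) : uniq t -> i \in t ->
    \sum_(j <- t) act (e j) (b' j) = \sum_(j <- t) act (e j) (b j) + c *: act (e i) a.
  move=> ut ti; rewrite -(linearZ_fun (al _)).
  rewrite (bigD1_seq i) //= [X in _ = X + _](bigD1_seq i) //= /b' eqxx (linearD_fun (al _)).
  rewrite -!addrA; congr (_ + _); rewrite addrC; congr (_ + _).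
  by apply: eq_bigr => j /negbTE->; rewrite addr0.
rewrite addrC; case: ifP => [si|/negbT si]; first by rewrite E.
by rewrite E /= ?mem_head ?si // big_cons b0 // a0 add0r.
Qed.
End Span.

(** * The RTT relations *)

Section RTTRelations.
Variables (K : fieldType) (n : nat) (r : K) (q : 'I_n -> 'I_n -> K).

(** The entry R^{AB}_{AB}, while [lam] is the entry R^{AB}_{BA} for A > B. All other entries of the
    R-matrix vanish. *)
Definition rho (A B : 'I_n) : K := r / q A B + (r - 1) * (A == B)%:R.
Definition lam : K := r - r^-1.

Lemma sum_pred1 (X : lmodType K) (F : 'I_n -> X) (A : 'I_n) (c : 'I_n -> K) :
  \sum_B ((A == B)%:R * c B) *: F B = c A *: F A.
Proof.
rewrite (bigD1 A) //= eqxx mul1r big1 ?addr0 // => B /negbTE BA.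
by rewrite eq_sym BA mul0r scale0r.
Qed.

(** Each row and each column of the R-matrix has at most two nonzero entries, so the two double sums
    leave four terms. *)
Lemma RTTE (X : algType K) (t : 'I_n -> 'I_n -> X) A B C D :
  RTT r q t A B C D =
    rho A B *: (t A C * t B D) + (lam * (B < A)%N%:R) *: (t B C * t A D)
    - (rho C D *: (t B D * t A C) + (lam * (C < D)%N%:R) *: (t B C * t A D)).
Proof.
rewrite /RTT; congr (_ - _).
  (* The closed form is expanded into double sums against Kronecker symbols, and coefficients are
     compared one by one. *)
  rewrite -[X in X + _](sum_pred1 (fun E => t E C * t B D) A (fun=> rho A B)).
  rewrite -[X in _ + X](sum_pred1 (fun E => t E C * t A D) B (fun=> lam * (B < A)%N%:R)).
  rewrite -big_split; apply: eq_bigr => E _ /=.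
  rewrite -[X in _ *: X + _]scale1r -[X in _ + _ *: X]scale1r.
  rewrite -(sum_pred1 (fun F => t E C * t F D) B (fun=> 1)).
  rewrite -[X in _ + _ *: X](sum_pred1 (fun F => t E C * t F D) A (fun=> 1)).
  rewrite !scaler_sumr -big_split; apply: eq_bigr => F _ /=.
  rewrite !scalerA -scalerDl; congr (_ *: _).
  by rewrite /Rmx /rho /lam; case: (A == E); case: (A == F); case: (B == E);
    case: (B == F) => /=; ring.
rewrite -[X in X + _](sum_pred1 (fun E => t B D * t A E) C (fun=> rho C D)).
rewrite -[X in _ + X](sum_pred1 (fun E => t B C * t A E) D (fun=> lam * (C < D)%N%:R)).
rewrite -big_split; apply: eq_bigr => E _ /=.
rewrite -[X in _ *: X + _]scale1r -[X in _ + _ *: X]scale1r.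
rewrite -(sum_pred1 (fun F => t B F * t A E) D (fun=> 1)).
rewrite -[X in _ + _ *: X](sum_pred1 (fun F => t B F * t A E) C (fun=> 1)).
rewrite !scaler_sumr -big_split; apply: eq_bigr => F _ /=.
rewrite !scalerA -scalerDl; congr (_ *: _).
rewrite /Rmx /rho /lam [C == E]eq_sym [D == F]eq_sym [D == E]eq_sym [C == F]eq_sym.
congr (_ + _).
  by case: (E =P C) => [->|_]; case: (F =P D) => [->|_] /=; ring.
by case: (E =P D) => [->|_]; case: (F =P C) => [->|_] /=; ring.
Qed.

Hypothesis r_neq0 : r != 0.
Hypothesis q_neq0 : forall A B, q A B != 0.
Hypothesis qV : forall A B, q A B = r ^+ 2 / q B A.
Hypothesis q_diag : forall A, q A A = r.

Lemma rho_diag A : rho A A = r.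
Proof. by rewrite /rho eqxx q_diag divff // mulr1 addrC subrK. Qed.

Lemma rho_neq A B : A != B -> rho A B = r / q A B.
Proof. by move=> /negbTE AB; rewrite /rho AB mulr0 addr0. Qed.

Lemma rhoV A B : A != B -> rho B A = (rho A B)^-1.
Proof.
move=> AB; rewrite !rho_neq // 1?eq_sym // [in RHS]qV.
by field; rewrite r_neq0 q_neq0.
Qed.

Lemma rho_neq0 A B : rho A B != 0.
Proof.
have [->|AB] := eqVneq A B; first by rewrite rho_diag.
by rewrite rho_neq // mulf_neq0 ?invr_neq0.
Qed.

(* The triangular matrix with diagonal [k] and entries [x A * E C] below it solves
   the RTT relations: a q-oscillator realisation, with [E] playing the derivatives. *)
Section Oscillator.
Variables (X : algType K) (s : K) (x E k : 'I_n -> X).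
Hypothesis s_neq0 : s != 0.
Hypothesis xx : forall a b : 'I_n, (b < a)%N -> x a * x b = (rho b a / r) *: (x b * x a).
Hypothesis kx : forall a b, k b * x a = (s / rho b a) *: (x a * k b).
Hypothesis Ex_lt : forall a d : 'I_n, (a < d)%N -> E d * x a = (s * r) *: (x a * E d).
Hypothesis Ex_gt : forall a d : 'I_n, (d < a)%N -> E d * x a = (s / r) *: (x a * E d).
Hypothesis Ex_eq : forall d, E d * x d = (s * r) *: (x d * E d) - (s * lam) *: k d.
Hypothesis EE : forall c d : 'I_n, (c < d)%N -> E c * E d = (r * rho c d) *: (E d * E c).
Hypothesis kE : forall b d, k b * E d = (rho b d / s) *: (E d * k b).
Hypothesis kk : forall a b, k a * k b = k b * k a.

Local Ltac field_neq0 := field; rewrite ?oner_eq0 ?s_neq0 ?r_neq0 ?rho_neq0.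

Definition osc (A C : 'I_n) : X :=
  if (C < A)%N then x A * E C else if A == C then k A else 0.

Lemma oscE (A C : 'I_n) : (C < A)%N -> osc A C = x A * E C.
Proof. by rewrite /osc => ->. Qed.
Lemma osck A : osc A A = k A.
Proof. by rewrite /osc ltnn eqxx. Qed.
Lemma osc0 (A C : 'I_n) : (A < C)%N -> osc A C = 0.
Proof. by rewrite /osc => AC; rewrite ltnNge ltnW //= -val_eqE /= ltn_eqF. Qed.

(** Products of two entries below the diagonal are brought to the normal order, x to the left of E;
    the three cases are those of the relations between E and x. *)
Lemma xExE_lt (A B C D : 'I_n) : (C < B)%N ->
  x A * E C * (x B * E D) = (s / r) *: (x A * x B * (E C * E D)).
Proof.
move=> CB; rewrite !mulrA -[x A * E C * x B]mulrA Ex_gt //.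
by rewrite -scalerAr -!scalerAl !mulrA.
Qed.

Lemma xExE_gt (A B C D : 'I_n) : (B < C)%N ->
  x A * E C * (x B * E D) = (s * r) *: (x A * x B * (E C * E D)).
Proof.
move=> CB; rewrite !mulrA -[x A * E C * x B]mulrA Ex_lt //.
by rewrite -scalerAr -!scalerAl !mulrA.
Qed.

Lemma xExE_eq A B D :
  x A * E B * (x B * E D) =
  (s * r) *: (x A * x B * (E B * E D)) - (lam * rho B D) *: (x A * E D * k B).
Proof.
rewrite !mulrA -[x A * E B * x B]mulrA Ex_eq.
rewrite mulrBr mulrBl -!scalerAr -!scalerAl !mulrA -[x A * k B * E D]mulrA kE.
by rewrite -scalerAr scalerA !mulrA; congr (_ - _ *: _); field_neq0.
Qed.

Lemma kxE A B D : k A * (x B * E D) = (rho A D / rho A B) *: (x B * E D * k A).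
Proof.
rewrite mulrA kx -scalerAl -[x B * k A * E D]mulrA kE -scalerAr scalerA.
rewrite [x B * (E D * k A)]mulrA; congr (_ *: _).
by field_neq0.
Qed.

Lemma EE_gt (c d : 'I_n) : (c < d)%N -> E d * E c = (r * rho c d)^-1 *: (E c * E d).
Proof. by move=> cd; rewrite (EE cd) scalerA mulVf ?scale1r // mulf_neq0 ?rho_neq0. Qed.

Lemma ord_neq (a b : 'I_n) : (a < b)%N -> a != b.
Proof. by move=> ab; rewrite -val_eqE /= neq_ltn ab. Qed.

(** The RTT relations fall into four types, according to whether the two entries lie in one row, in
    one column, in antidiagonal or in diagonal position. Each type is proved for one order of the
    indices. *)
Lemma osc_row (A C D : 'I_n) : (C < D)%N ->
  r^-1 *: (osc A C * osc A D) = rho C D *: (osc A D * osc A C).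
Proof.
move=> CD; have [AD|DA|/val_inj e] := ltngtP A D.
- by rewrite [osc A D]osc0 // mul0r mulr0 !scaler0.
- have CA := ltn_trans CD DA.
  rewrite !oscE // !xExE_lt // (EE CD) -scalerAr !scalerA; congr (_ *: _).
  by field_neq0.
rewrite {}e {A} in CD *; rewrite osck oscE // kxE scalerA; congr (_ *: _).
by rewrite rho_diag (rhoV (ord_neq CD)); field_neq0.
Qed.

Lemma osc_col (A B C : 'I_n) : (A < B)%N ->
  rho A B *: (osc A C * osc B C) = r *: (osc B C * osc A C).
Proof.
move=> AB; have [AC|CA|/val_inj e] := ltngtP A C.
- by rewrite [osc A C]osc0 // mul0r mulr0 !scaler0.
- have CB := ltn_trans CA AB.
  rewrite !oscE // !xExE_lt // (xx AB) -scalerAl !scalerA; congr (_ *: _).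
  by field_neq0.
rewrite -{}e {C}; rewrite osck oscE // kxE scalerA; congr (_ *: _).
by rewrite rho_diag; field_neq0.
Qed.

Lemma osc_anti (A B C D : 'I_n) : (A < B)%N -> (D < C)%N ->
  rho A B *: (osc A C * osc B D) = rho C D *: (osc B D * osc A C).
Proof.
move=> AB DC; have [AC|CA|/val_inj e] := ltngtP A C.
- by rewrite [osc A C]osc0 // mul0r mulr0 !scaler0.
- have CB := ltn_trans CA AB; have DA := ltn_trans DC CA; have DB := ltn_trans DA AB.
  rewrite !oscE // !xExE_lt // (xx AB) (EE DC) -!scalerAl -!scalerAr !scalerA; congr (_ *: _).
  by rewrite (rhoV (ord_neq DC)); field_neq0.
rewrite -{}e {C} in DC *; have DB := ltn_trans DC AB.
rewrite osck oscE // kxE scalerA; congr (_ *: _).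
by field_neq0.
Qed.

(** The only type with three terms. If A <= C, A < D or B <= D the entry osc A D or osc A C makes
    the lam term vanish; if D < A it completes r^-1 to r; if A = D it is cancelled by the k term of
    [Ex_eq]. *)
Lemma osc_main (A B C D : 'I_n) : (A < B)%N -> (C < D)%N ->
  rho A B *: (osc A C * osc B D) =
  rho C D *: (osc B D * osc A C) + lam *: (osc B C * osc A D).
Proof.
move=> AB CD; have [AC|CA|/val_inj e] := ltngtP A C.
- have AD := ltn_trans AC CD.
  by rewrite (osc0 AC) (osc0 AD) mul0r !mulr0 !scaler0 addr0.
- have CB := ltn_trans CA AB.
  have [BD|DB|/val_inj e] := ltngtP B D.
  + have AD := ltn_trans AB BD.
    by rewrite (osc0 BD) (osc0 AD) mul0r !mulr0 !scaler0 addr0.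
  + have [AD|DA|/val_inj e] := ltngtP A D.
    * rewrite (osc0 AD) mulr0 scaler0 addr0 !oscE // xExE_lt // xExE_gt //.
      rewrite (xx AB) (EE_gt CD) -!scalerAl -!scalerAr !scalerA; congr (_ *: _).
      by field_neq0.
    * rewrite !oscE // !xExE_lt //.
      rewrite (xx AB) (EE_gt CD) -!scalerAl -!scalerAr !scalerA -scalerDl; congr (_ *: _).
      by rewrite /lam; field_neq0.
    rewrite -{}e {D} in DB CD *; rewrite osck !oscE // xExE_lt // xExE_eq.
    rewrite scalerBr (xx AB) (EE_gt CD) -!scalerAl -!scalerAr !scalerA.
    have -> : rho C A * (lam * rho A C) = lam by rewrite (rhoV (ord_neq CA)); field_neq0.
    rewrite subrK.
    by congr (_ *: _); field_neq0.
  rewrite -{}e {D} in CD *; rewrite (osc0 AB) mulr0 scaler0 addr0 osck oscE //.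
  rewrite kxE scalerA; congr (_ *: _).
  by rewrite (rhoV (ord_neq AB)) (rhoV (ord_neq CB)); field_neq0.
rewrite -{}e {C} in CD *; rewrite (osc0 CD) mulr0 scaler0 addr0 osck.
have [BD|DB|/val_inj <-] := ltngtP B D.
- by rewrite (osc0 BD) mul0r mulr0 !scaler0.
- rewrite oscE // kxE scalerA; congr (_ *: _).
  by field_neq0.
by rewrite osck kk.
Qed.

Lemma osc_anti_sym (A B C D : 'I_n) : (A < B)%N -> (D < C)%N ->
  osc B D * osc A C = (rho A B * rho D C) *: (osc A C * osc B D).
Proof.
move=> AB DC; rewrite [_ * rho D C]mulrC -scalerA osc_anti // scalerA.
by rewrite (rhoV (ord_neq DC)) divff ?rho_neq0 ?scale1r.
Qed.

(** The nine relative orders of (A, B) and (C, D) reduce to the four types, factors being inverted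
    by [rhoV]. The constant lam stays as in [osc_main], cancels between the two sides, or turns r^-1
    into r. *)
Lemma osc_RTT A B C D : RTT r q osc A B C D = 0.
Proof.
rewrite RTTE; apply/eqP; rewrite subr_eq0; apply/eqP.
have lamE : r^-1 + lam = r by rewrite /lam addrCA subrr addr0.
have [BA|AB|/val_inj->] := ltngtP B A; have [CD|DC|/val_inj->] := ltngtP C D;
  rewrite ?mulr1 ?mulr0 ?scale0r ?addr0.
- rewrite addrC -[RHS]addrC; congr (_ + _).
  rewrite (osc_anti_sym BA CD) scalerA; congr (_ *: _).
  by rewrite (rhoV (ord_neq BA)); field_neq0.
- have e := osc_main BA DC; have e' := congr1 (fun z => (rho A B * rho C D) *: z) e.
  move: e' => /=; rewrite scalerDr (osc_anti_sym BA DC) !scalerA.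
  rewrite (rhoV (ord_neq BA)) (rhoV (ord_neq DC)).
  rewrite [X in X *: _ = _](_ : _ = (rho D C)^-1); last by field_neq0.
  rewrite [X in _ = X *: _ + _](_ : _ = (rho B A)^-1); last by field_neq0.
  rewrite [X in _ = _ + X *: _](_ : _ = lam) //; last by field_neq0.
- have e := congr1 (fun z => (rho A B / r) *: z) (osc_col D BA).
  move: e => /=; rewrite !scalerA (rhoV (ord_neq BA)) divfK // => <-.
  by rewrite rho_diag -scalerDl -[in X in _ = X *: _]lamE; congr ((_ + _) *: _); field_neq0.
- exact: osc_main.
- exact: osc_anti.
- by rewrite osc_col ?rho_diag.
- by rewrite rho_diag -osc_row // -scalerDl lamE.
- rewrite rho_diag; have e := congr1 (fun z => (r * rho C D) *: z) (osc_row A DC).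
  move: e => /=; rewrite !scalerA (rhoV (ord_neq DC)).
  rewrite [X in X *: _ = _](_ : _ = (rho D C)^-1); last by field_neq0.
  by rewrite [X in _ = X *: _](_ : _ = r) //; field_neq0.
by rewrite !rho_diag.
Qed.
End Oscillator.
End RTTRelations.

(** * Products of solutions of the RTT relations *)

Section RTTProduct.
Variables (K : fieldType) (n : nat) (r : K) (q : 'I_n -> 'I_n -> K) (X : algType K).
Local Notation R := (Rmx r q).

Lemma RTT_pairP (t : 'I_n -> 'I_n -> X) A B C D :
  RTT r q t A B C D = 0 <->
  \sum_(p : 'I_n * 'I_n) R A B p.1 p.2 *: (t p.1 C * t p.2 D) =
  \sum_(p : 'I_n * 'I_n) R p.1 p.2 C D *: (t B p.2 * t A p.1).
Proof.
rewrite -(pair_bigA _ (fun E F => R A B E F *: (t E C * t F D))).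
rewrite -(pair_bigA _ (fun E F => R E F C D *: (t B F * t A E))) /=.
by rewrite /RTT; split=> [/eqP|->]; rewrite ?subrr // subr_eq0 => /eqP.
Qed.

Definition mxprod (t t' : 'I_n -> 'I_n -> X) A B := \sum_C t A C * t' C B.

(** As the entries of the two matrices commute, a product of two entries of t t' separates into two
    entries of t followed by two entries of t'; R is moved through the first pair and then through
    the second. This is what makes the coactions well defined. *)
Lemma RTT_mxprod (t t' : 'I_n -> 'I_n -> X) :
  (forall A B C D, t A B * t' C D = t' C D * t A B) ->
  (forall A B C D, RTT r q t A B C D = 0) ->
  (forall A B C D, RTT r q t' A B C D = 0) ->
  forall A B C D, RTT r q (mxprod t t') A B C D = 0.
Proof.
move=> cm tR tR' A B C D; apply/RTT_pairP.
have e A' B' C' D' : mxprod t t' A' C' * mxprod t t' B' D' =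
    \sum_(p : 'I_n * 'I_n) (t A' p.1 * t B' p.2) * (t' p.1 C' * t' p.2 D').
  rewrite /mxprod mulr_suml -(pair_bigA _ (fun G H => (t A' G * t B' H) * (t' G C' * t' H D'))).
  apply: eq_bigr => G _; rewrite mulr_sumr; apply: eq_bigr => H _ /=.
  by rewrite -!mulrA; congr (_ * _); rewrite !mulrA cm.
under eq_bigr => p _ do rewrite e scaler_sumr.
rewrite exchange_big /=.
transitivity (\sum_(p' : 'I_n * 'I_n) \sum_(p : 'I_n * 'I_n)
    R p.1 p.2 p'.1 p'.2 *: (t B p.2 * t A p.1 * (t' p'.1 C * t' p'.2 D))).
  apply: eq_bigr => p' _.
  under eq_bigr => p _ do rewrite scalerAl.
  under [RHS]eq_bigr => p _ do rewrite scalerAl.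
  by rewrite -!mulr_suml; congr (_ * _); apply/RTT_pairP/tR.
rewrite exchange_big /=.
under [RHS]eq_bigr => p _ do rewrite e scaler_sumr.
(* The right-hand side of the RTT relations lists its factors in reverse order, whence the exchange
   of the two summation indices. *)
rewrite [RHS]exchange_big /= [RHS](reindex_inj (h := fun p => (p.2, p.1))) /=; last first.
  by case=> [? ?] [? ?] [-> ->].
apply: eq_bigr => p _.
under eq_bigr => p' _ do rewrite scalerAr.
under [RHS]eq_bigr => p' _ do rewrite scalerAr.
by rewrite -!mulr_sumr; congr (_ * _); apply/RTT_pairP/tR'.
Qed.
End RTTProduct.

(** * Solutions of size N+1 with T^0_a = 0 *)

Section Triangular.
Variables (K : fieldType) (N : nat) (r q0 : K) (q : 'I_N.+1 -> 'I_N.+1 -> K).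
Hypothesis r_neq0 : r != 0.
Hypothesis q_neq0 : forall A B, q A B != 0.
Hypothesis qV : forall A B, q A B = r ^+ 2 / q B A.
Hypothesis q_diag : forall A, q A A = r.
Hypothesis q_const : forall a : 'I_N, q (lift ord0 a) ord0 = q0.

Local Notation l := (lift ord0).
Local Notation rl := (rho r (qlow q)).
Local Notation lam := (lam r).
(* All the R-matrix entries R^{a0}_{a0} coincide because q_{a0} is constant. *)
Definition mixed_coef : K := r / q0.
Local Notation s := mixed_coef.

Lemma qlow_neq0 a b : qlow q a b != 0. Proof. exact: q_neq0. Qed.
Lemma qlowV a b : qlow q a b = r ^+ 2 / qlow q b a. Proof. exact: qV. Qed.
Lemma qlow_diag a : qlow q a a = r. Proof. exact: q_diag. Qed.

Lemma lift0_eq (a b : 'I_N) : (l a == l b) = (a == b).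
Proof. exact: (inj_eq lift_inj). Qed.

Lemma lift0_lt (a b : 'I_N) : (l a < l b)%N = (a < b)%N.
Proof. by []. Qed.

Lemma rho_low a b : rho r q (l a) (l b) = rl a b.
Proof. by rewrite /rho lift0_eq. Qed.

Lemma rho_col0 a : rho r q (l a) ord0 = s.
Proof. by rewrite rho_neq // q_const. Qed.

Lemma rho_row0 a : rho r q ord0 (l a) = s^-1.
Proof. by rewrite -(rho_col0 a); apply: rhoV. Qed.

(** For N = 0 the constant [q0] is subject to no condition and may be zero, so that the statement
    has to be given an index. *)
Lemma mixed_coef_neq0 : 'I_N -> s != 0.
Proof. by move=> a; rewrite -(rho_col0 a) rho_neq0. Qed.

Variables (X : algType K) (t : 'I_N.+1 -> 'I_N.+1 -> X).
Hypothesis t0 : forall a, t ord0 (l a) = 0.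
Local Notation u := (t ord0 ord0).
Local Notation x a := (t (l a) ord0).
Local Notation L a b := (t (l a) (l b)).

Lemma RTT_low a b c d :
  RTT r (qlow q) (fun a b => L a b) a b c d = RTT r q t (l a) (l b) (l c) (l d).
Proof. by rewrite !RTTE !rho_low. Qed.

Section Build.
Hypothesis LR : forall a b c d, RTT r (qlow q) (fun a b => L a b) a b c d = 0.
Hypothesis Lx : forall a b d,
  L b d * x a = s *: (rl a b *: (x a * L b d) + (lam * ((b < a)%N%:R - 1)) *: (x b * L a d)).
Hypothesis xx : forall a b : 'I_N, (b < a)%N -> x a * x b = (rl b a / r) *: (x b * x a).
Hypothesis Lu : forall a b, L a b * u = u * L a b.
Hypothesis xu : forall a, x a * u = (r * s)^-1 *: (u * x a).

(** Sorting the four indices into zero and nonzero ones gives sixteen cases. Seven survive the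
    vanishing entries and [LR]: they are two instances of each of [Lx], [Lu], [xu] and one of [xx].
    Both diag(1, T) and the Fock matrix are shown to satisfy RTT in this way. *)
Lemma RTT_build A B C D : RTT r q t A B C D = 0.
Proof.
have lamE : r - lam = r^-1 by rewrite /lam opprB addrC subrK.
have Rn := rho_neq0 r_neq0 (qlow_neq0) qlow_diag.
have RV := rhoV r_neq0 (qlow_neq0) qlowV.
have RD := rho_diag r_neq0 qlow_diag.
case: (unliftP ord0 A) => [a ->|->]; case: (unliftP ord0 B) => [b ->|->];
  case: (unliftP ord0 C) => [c ->|->]; case: (unliftP ord0 D) => [d ->|->];
  rewrite -?RTT_low ?LR // RTTE ?t0 ?ltn0 /= ?mulr0 ?mul0r ?mulr1 ?scale0r ?scaler0
    ?addr0 ?add0r ?rho_col0 ?rho_row0 ?rho_low ?(rho_diag r_neq0 q_diag) ?subrr ?oppr0 //.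
- have s0 := mixed_coef_neq0 a; rewrite !lift0_lt [L a c * x b]Lx [L b c * x a]Lx.
  have [ba|ab|/val_inj<-] := ltngtP b a; rewrite ?mulr0 ?subrr ?subr0 ?mulr1.
  + rewrite ?mulr0 scale0r addr0 sub0r mulrN1 scaleNr !scalerBr !scalerA (RV _ _ (ord_neq ba)).
    rewrite [lam * s / _](_ : _ = (rl b a)^-1 * s * lam); last by field; rewrite Rn.
    rewrite subrK -scalerBl.
    by rewrite [X in X *: _](_ : _ = 0) ?scale0r //; field; rewrite Rn.
  + rewrite ?mulr0 !scale0r !addr0 !scalerA -scalerBl (RV _ _ (ord_neq ab)).
    by rewrite [X in X *: _](_ : _ = 0) ?scale0r //; field; rewrite Rn.
  rewrite ?mulr0 scale0r addr0 RD sub0r mulrN1 -scalerDl !scalerA -scalerBl.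
  by rewrite [X in X *: _](_ : _ = 0) ?scale0r // lamE; field.
- have s0 := mixed_coef_neq0 a; rewrite lift0_lt Lx scalerA mulVf // scale1r mulrBr mulr1 scalerBl.
  by rewrite addrA subrK subrr.
- rewrite lift0_lt; have [ba|ab|/val_inj<-] := ltngtP b a; rewrite ?mulr0 ?scale0r ?addr0 ?mulr1.
  + rewrite (xx ba) scalerA -scalerDl -scalerBl.
    rewrite (RV _ _ (ord_neq ba)) mulrA mulVf ?Rn // div1r.
    rewrite [_ + lam]addrC -{1}lamE addrC subrK subrr.
    by rewrite scale0r.
  + by rewrite (xx ab) scalerA [r * _]mulrC divfK // subrr.
  by rewrite RD subrr.
- by rewrite Lu subrr.
- have s0 := mixed_coef_neq0 a; rewrite xu scalerA -scalerDl -scalerBl.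
  rewrite [X in X *: _](_ : _ = 0) ?scale0r //.
  by rewrite -[X in _ + _ - X](subrK lam) lamE; field; rewrite r_neq0.
- by rewrite Lu subrr.
have s0 := mixed_coef_neq0 b; rewrite xu scalerA -scalerBl.
by rewrite [X in X *: _](_ : _ = 0) ?scale0r //; field; rewrite r_neq0 s0.
Qed.

End Build.

Section Extract.
Hypothesis tR : forall A B C D, RTT r q t A B C D = 0.

Lemma RTT_Lx a b d :
  L b d * x a = s *: (rl a b *: (x a * L b d) + (lam * ((b < a)%N%:R - 1)) *: (x b * L a d)).
Proof.
have := tR (l a) (l b) ord0 (l d).
rewrite RTTE rho_low rho_row0 lift0_lt mulr1 => e.
rewrite mulrBr mulr1 scalerBl addrA.
have {e} <- : s^-1 *: (L b d * x a) = rl a b *: (x a * L b d) +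
    (lam * (b < a)%N%:R) *: (x b * L a d) - lam *: (x b * L a d).
  by apply/eqP; rewrite eq_sym -subr_eq0 -addrA -opprD [lam *: _ + _]addrC; apply/eqP.
by rewrite scalerA divff ?scale1r ?mixed_coef_neq0.
Qed.

Lemma RTT_xx (a b : 'I_N) : (b < a)%N -> x a * x b = (rl b a / r) *: (x b * x a).
Proof.
move=> ba; have := tR (l a) (l b) ord0 ord0.
rewrite RTTE rho_low (rho_diag r_neq0 q_diag) lift0_lt ba ltnn mulr1 mulr0 scale0r addr0.
rewrite -addrA -scalerBl => e.
have RV := rhoV r_neq0 qlow_neq0 qlowV (ord_neq ba).
have Rn := rho_neq0 r_neq0 qlow_neq0 qlow_diag.
apply: (scalerI (Rn a b)); rewrite scalerA RV mulrA mulVf ?Rn //.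
apply/eqP; rewrite -subr_eq0 -scaleNr; apply/eqP; rewrite -[RHS]e RV.
by congr (_ + _ *: _); rewrite /lam; field.
Qed.

Lemma RTT_Lu a b : L a b * u = u * L a b.
Proof.
have := tR ord0 (l a) ord0 (l b).
rewrite RTTE !rho_row0 t0 ltn0 !mulr0 scale0r scaler0 !addr0 -scalerBr => /eqP.
rewrite scaler_eq0 invr_eq0 (negbTE (mixed_coef_neq0 a)) subr_eq0 => /eqP e.
by rewrite e.
Qed.

Lemma qdet_low_comm (D := qdet r (qlow q) (fun a b => L a b)) : D * u = u * D.
Proof.
rewrite mulr_suml mulr_sumr; apply: eq_bigr => w _.
rewrite -scalerAl -scalerAr; congr (_ *: _).
elim/big_rec: _ => [|a z _ IH]; first by rewrite mul1r mulr1.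
by rewrite -mulrA IH !mulrA RTT_Lu.
Qed.

Lemma RTT_xu a : x a * u = (r * s)^-1 *: (u * x a).
Proof.
have s0 := mixed_coef_neq0 a; have := tR ord0 (l a) ord0 ord0.
rewrite RTTE rho_row0 (rho_diag r_neq0 q_diag) ltn0 !mulr0 !scale0r !addr0 => /eqP.
rewrite subr_eq0 => /eqP e; apply: (scalerI r_neq0).
by rewrite -e scalerA; congr (_ *: _); field; rewrite r_neq0 s0.
Qed.
End Extract.

(** Since T^0_a = 0, only the permutations that fix 0 contribute, and these are the lifts of the
    permutations of the other indices. *)
Lemma qdet_lift :
  qdet r q t = u * qdet r (qlow q) (fun a b => L a b).
Proof.
rewrite /qdet mulr_sumr (bigID (fun s : 'S_N.+1 => s ord0 == ord0)) /=.
rewrite [X in _ + X]big1 ?addr0 => [|s]; last first.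
  by rewrite eq_sym => /unlift_some[d dE _]; rewrite big_ord_recl dE t0 mul0r scaler0.
have lift_inj0 : injective (lift_perm (ord0 : 'I_N.+1) ord0).
  move=> w w' /permP e; apply/permP => k; have := e (l k).
  by rewrite !lift_perm_lift => /lift_inj.
have lift_onto (w : 'S_N.+1) : w ord0 = ord0 -> exists v, lift_perm ord0 ord0 v = w.
  move=> w0; have wl k : {j | w (l k) = l j}.
    have : ord0 != w (l k) by rewrite -[X in X != _]w0 (inj_eq perm_inj) neq_lift.
    by case/unlift_some => j wk _; exists j.
  have wE k : l (sval (wl k)) = w (l k) := esym (svalP (wl k)).
  have w_inj : injective (fun k => sval (wl k)).
    by move=> a b /(congr1 l); rewrite !wE => /perm_inj/lift_inj.
  exists (perm w_inj); apply/permP => k; case: (unliftP ord0 k) => [j|] ->.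
    by rewrite lift_perm_lift permE wE.
  by rewrite lift_perm_id w0.
rewrite (reindex (lift_perm ord0 ord0)); last first.
  exists (fun w => odflt 1%g [pick v | lift_perm ord0 ord0 v == w]) => [w _|w /eqP/lift_onto[v <-]].
    by case: pickP => [v /eqP/lift_inj0|/(_ w)]; rewrite ?eqxx.
  by case: pickP => [v' /eqP|/(_ v)]; rewrite ?eqxx.
apply: eq_big => [s|s _]; first by rewrite lift_perm_id eqxx.
rewrite big_ord_recl lift_perm_id -scalerAr; congr (_ *: (_ * _)); last first.
  by apply: eq_bigr => a _; rewrite lift_perm_lift.
(* No inversion of a lifted permutation involves the index 0, so the coefficients agree too. *)
rewrite [LHS]big_mkcond [RHS]big_mkcond.
rewrite -(pair_bigA _ (fun A B : 'I_N.+1 =>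
  if (A < B)%N && (lift_perm ord0 ord0 s B < lift_perm ord0 ord0 s A)%N
  then - (r ^+ 2 / q (lift_perm ord0 ord0 s B) (lift_perm ord0 ord0 s A)) else 1)) /=.
rewrite -(pair_bigA _ (fun a b : 'I_N => if (a < b)%N && (s b < s a)%N then
  - (r ^+ 2 / qlow q (s b) (s a)) else 1)) /=.
rewrite big_ord_recl [X in X * _]big1 => [|B _]; last by rewrite lift_perm_id ltn0 andbF.
rewrite mul1r; apply: eq_bigr => a _; rewrite big_ord_recl ltn0 /= mul1r.
by apply: eq_bigr => b _; rewrite !lift_perm_lift.
Qed.
End Triangular.

(** A permutation other than the identity has an index a with a < s a, and the vanishing factor
    [t a (s a)] kills its product. *)
Lemma qdet_triangular (K : fieldType) n (r : K) (q : 'I_n -> 'I_n -> K) (X : algType K)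
    (t : 'I_n -> 'I_n -> X) :
  (forall a b : 'I_n, (a < b)%N -> t a b = 0) -> qdet r q t = \prod_a t a a.
Proof.
move=> t0; rewrite /qdet (bigD1 1%g) //= [X in _ + X]big1 => [|s s1]; last first.
  have [a sa] : exists a : 'I_n, (a < s a)%N.
    apply/existsP; apply: contraR s1; rewrite negb_exists => /forallP h.
    (* If no index moves up, all are fixed, by induction from below: an image s b < b would itself
       be fixed, so that s (s b) = s b and s b = b by injectivity. *)
    suff fix_s k (b : 'I_n) : (b < k)%N -> s b = b.
      by apply/eqP/permP => b; rewrite perm1 (fix_s b.+1).
    elim: k b => // k IH b bk; apply/val_inj/eqP => /=.
    have := h b; rewrite -leqNgt leq_eqVlt => /orP[//|sb].
    have /(congr1 val) := IH (s b) (leq_trans sb bk).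
    by move/val_inj/perm_inj => e; rewrite e.
  rewrite (_ : \prod_A _ = 0) ?scaler0 //.
  elim: (index_enum _) (mem_index_enum a) => // b w IH; rewrite inE big_cons.
  by case: eqP => [<- _|_ /IH->]; rewrite ?mulr0 // (t0 _ _ sa) mul0r.
rewrite addr0 [X in _ *: X](eq_bigr (fun a => t a a)) => [|a _]; last by rewrite perm1.
rewrite big_pred0 ?scale1r // => -[A B] /=.
by apply/negP; rewrite !perm1 => /andP[/ltn_trans h /h]; rewrite ltnn.
Qed.

(** * Universal properties and generation *)

Section Generation.
Variable K : fieldType.

(* Closure under inverses replaces a separate treatment of the generator Xi, which
   is the inverse of a polynomial in the entries of T. *)
Definition alg_closed (A : algType K) (P : A -> Prop) : Prop :=
  [/\ P 1, forall c x y, P x -> P y -> P (c *: x + y),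
      forall x y, P x -> P y -> P (x * y) &
      forall x y, P x -> x * y = 1 -> y * x = 1 -> P y].

(** Two multiplicative maps that agree at x agree at its inverse, since inverses are unique. The
    codomain is just a space with an associative product, because a bare tensor product of algebras
    is not an [algType]. *)
Lemma alg_closed_eq (A : algType K) (V : lmodType K) (mu : V -> V -> V) (e : V)
    (f g : A -> V) :
  associative mu -> left_id e mu -> right_id e mu -> linear f -> linear g ->
  f 1 = e -> g 1 = e -> (forall x y, f (x * y) = mu (f x) (f y)) ->
  (forall x y, g (x * y) = mu (g x) (g y)) -> alg_closed (fun x => f x = g x).
Proof.
move=> mA m1l m1r fl gl f1 g1 fM gM; split=> [|c x y fx fy|x y fx fy|x y fx xy yx].
- by rewrite f1.
- by rewrite fl gl fx fy.
- by rewrite fM gM fx fy.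
by rewrite -[f y]m1r -g1 -xy gM mA -fx -fM yx f1 m1l.
Qed.

Lemma free_alg_ind (G : choiceType) (P : free_alg K G -> Prop) :
  P 1 -> (forall c x y, P x -> P y -> P (c *: x + y)) ->
  (forall x y, P x -> P y -> P (x * y)) -> (forall g, P (free_gen K g)) ->
  forall z, P z.
Proof.
move=> P1 PL PM PG.
have P0 : P 0 by have := PL (-1) 1 1 P1 P1; rewrite scaleN1r addNr.
have Pm (k : {fmonom G}) : P << k >>.
  case: k; elim=> [|g s IH]; first by rewrite -fmoneE.
  have -> : FMonom (g :: s) = mmul (fmu g) (FMonom s).
    by apply/val_inj; rewrite /= fmM fmU.
  have -> : << mmul (fmu g) (FMonom s) >> = free_gen K g * << FMonom s >> :> free_alg K G.
    by rewrite [RHS]fgmulUU mulr1.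
  exact: PM.
move=> z; rewrite [z]malg_basisE; elim: (X in \sum_(k <- X) _) => [|k s IH].
  by rewrite big_nil.
rewrite big_cons; apply: PL => //; rewrite basis.unlock; exact: Pm.
Qed.
End Generation.

Section UniversalGL.
Variables (K : fieldType) (n : nat) (r : K) (q : 'I_n -> 'I_n -> K).

Lemma GL_ind (P : GL r q -> Prop) :
  alg_closed P -> (forall A B, P (GLT r q A B)) -> forall z, P z.
Proof.
case=> P1 PL PM PV PT z; have [a ->] := GL_pi_surj z; move: a.
apply: free_alg_ind => [|c x y Px Py|x y Px Py|].
- by rewrite rmorph1.
- by rewrite linearP; exact: PL.
- by rewrite rmorphM; exact: PM.
case=> [[A B]|]; first exact: PT.
have [h1 h2] := GL_detXi r q; apply: PV h1 h2.
have P0 : P 0 by have := PL (-1) 1 1 P1 P1; rewrite scaleN1r addNr.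
rewrite /qdet; elim: (index_enum _) => [|s w IH]; first by rewrite big_nil.
rewrite big_cons; apply: PL => //.
by elim/big_ind: _ => // A _; exact: PT.
Qed.

Lemma GL_univ (B : algType K) (t : 'I_n -> 'I_n -> B) (xi : B) :
  (forall A B C D, RTT r q t A B C D = 0) ->
  qdet r q t * xi = 1 -> xi * qdet r q t = 1 ->
  exists g : {lrmorphism GL r q -> B},
    (forall A B, g (GLT r q A B) = t A B) /\ g (GLXi r q) = xi.
Proof.
move=> tR h1 h2.
pose v (g : GLgen n) : B := if g is Some (A, B) then t A B else xi.
pose f : {lrmorphism free_alg K (GLgen n) -> B} := free_eval v.
have fT A B' : f (preT K A B') = t A B' by exact: free_eval_gen.
have fTE : (fun A B' => f (preT K A B')) = t by apply/funext => A; apply/funext => B'.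
have fXi : f (preXi K n) = xi by exact: free_eval_gen.
have f0 s : GL_rel r q s -> f s = 0.
  case=> [A B' C D||].
  - by rewrite map_RTT fTE.
  - by rewrite raddfB /= rmorphM /= rmorph1 map_qdet fTE fXi h1 subrr.
  - by rewrite raddfB /= rmorphM /= rmorph1 map_qdet fTE fXi h2 subrr.
have [g gE] := GL_lift f0.
by exists g; split=> [A B'|]; rewrite gE.
Qed.
End UniversalGL.

Section UniversalIGL.
Variables (K : fieldType) (N : nat) (r : K) (q : 'I_N.+1 -> 'I_N.+1 -> K).

Definition IGLmx A B : IGL r q := IGL_pi r q (GLT r q A B).

Lemma IGL_ind (P : IGL r q -> Prop) :
  alg_closed P -> (forall A B, P (IGLmx A B)) -> forall z, P z.
Proof.
case=> P1 PL PM PV PT z; have [a ->] := IGL_pi_surj z; move: a.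
apply: GL_ind => //; split=> [|c x y Px Py|x y Px Py|x y Px xy yx].
- by rewrite rmorph1.
- by rewrite linearP; exact: PL.
- by rewrite rmorphM; exact: PM.
by apply: PV Px _ _; rewrite -rmorphM ?xy ?yx rmorph1.
Qed.

Lemma IGL_univ (B : algType K) (t : 'I_N.+1 -> 'I_N.+1 -> B) (xi : B) :
  (forall A B C D, RTT r q t A B C D = 0) -> (forall a, t ord0 (lift ord0 a) = 0) ->
  qdet r q t * xi = 1 -> xi * qdet r q t = 1 ->
  exists g : {lrmorphism IGL r q -> B}, forall A B, g (IGLmx A B) = t A B.
Proof.
move=> tR t0 h1 h2; have [f [fT _]] := GL_univ tR h1 h2.
have [|g gE] := @IGL_lift K N r q B f; first by move=> a; rewrite fT.
by exists g => A B'; rewrite -fT -gE.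
Qed.
End UniversalIGL.

Section TensorInjections.
Variables (K : fieldType) (A B : algType K) (h : (1 : A) ⊗ (1 : B) != 0).

Definition tinl (a : A) : talg h := a ⊗ (1 : B).
Definition tinr (b : B) : talg h := (1 : A) ⊗ b.

Fact tinl_linear : linear tinl. Proof. exact: (tpure_bil A B).1. Qed.
Fact tinr_linear : linear tinr. Proof. exact: (tpure_bil A B).2. Qed.
Fact tinl_monoid : monoid_morphism tinl.
Proof. by split=> // a b; rewrite /tinl [RHS](tensM (A := A) (B := B)) mulr1. Qed.
Fact tinr_monoid : monoid_morphism tinr.
Proof. by split=> // a b; rewrite /tinr [RHS](tensM (A := A) (B := B)) mulr1. Qed.

HB.instance Definition _ := GRing.isLinear.Build K A (talg h) *:%R tinl tinl_linear.
HB.instance Definition _ := GRing.isMonoidMorphism.Build A (talg h) tinl tinl_monoid.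
HB.instance Definition _ := GRing.isLinear.Build K B (talg h) *:%R tinr tinr_linear.
HB.instance Definition _ := GRing.isMonoidMorphism.Build B (talg h) tinr tinr_monoid.

Lemma tinlr a b : tinl a * tinr b = a ⊗ b.
Proof. by rewrite [LHS](tensM (A := A) (B := B)) mulr1 mul1r. Qed.

Lemma tinrl a b : tinl a * tinr b = tinr b * tinl a.
Proof. by rewrite tinlr [RHS](tensM (A := A) (B := B)) mulr1 mul1r. Qed.
End TensorInjections.

Section LrmorphismOfFunction.
Variables (K : fieldType) (A B : algType K) (f : A -> B).
Hypotheses (fl : linear f) (fm : monoid_morphism f).

Lemma lrmorphism_of_fun : exists g : {lrmorphism A -> B}, g =1 f.
Proof.
pose F1 := GRing.isLinear.Build K A B *:%R f fl.
pose F2 := GRing.isMonoidMorphism.Build A B f fm.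
pose g : {lrmorphism A -> B} := HB.pack f F1 F2.
by exists g.
Qed.
End LrmorphismOfFunction.

(** * Coactions and bicovariant bimodules *)

Section MatrixBimodule.
Variables (K : fieldType) (A B : algType K) (H : hopf_algebra A).
Variable iota : {lrmorphism A -> B}.
Variables (I : finType) (p : I -> I -> A) (T : I -> I -> B).
Hypothesis B_ind : forall P : B -> Prop,
  alg_closed P -> (forall a b, P (T a b)) -> forall z, P z.
Hypothesis comul_p : forall a b, comul H (p a b) = \sum_c p a c ⊗ p c b.
Hypothesis counit_p : forall a b, counit H (p a b) = (a == b)%:R.
Variable eB : {lrmorphism B -> K^o}.
Variables (dL : {linear B -> (A ⊗ B)%type}) (dR : {linear B -> (B ⊗ A)%type}).
Hypotheses (dL_monoid : monoid_morphism dL) (dR_monoid : monoid_morphism dR).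
Hypothesis dLT : forall a b, dL (T a b) = \sum_c p a c ⊗ T c b.
Hypothesis dRT : forall a b, dR (T a b) = \sum_c T a c ⊗ p c b.
Hypothesis dL_iota : forall c, dL (iota c) = tmap idfun iota (comul H c).
Hypothesis dR_iota : forall c, dR (iota c) = tmap iota idfun (comul H c).

Let hAA : (1 : A) ⊗ (1 : A) != 0 := tens1_neq0 (counit H) (counit H).
Let hAB : (1 : A) ⊗ (1 : B) != 0 := tens1_neq0 (counit H) eB.
Let hBA : (1 : B) ⊗ (1 : A) != 0 := tens1_neq0 eB (counit H).

Let comul_lin : linear (comul H). Proof. exact: linearP. Qed.
Let dL_lin : linear dL. Proof. exact: linearP. Qed.
Let dR_lin : linear dR. Proof. exact: linearP. Qed.
Let id_lin (V : lmodType K) : linear (@idfun V). Proof. by []. Qed.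
Let id_monoid (V : algType K) : monoid_morphism (@idfun V). Proof. by []. Qed.

Lemma monoid_comp (X Y Z : pzRingType) (f : Y -> Z) (g : X -> Y) :
  monoid_morphism f -> monoid_morphism g -> monoid_morphism (f \o g).
Proof.
by move=> [f1 fM] [g1 gM]; split=> [|x y] /=; rewrite ?g1 ?f1 ?gM ?fM.
Qed.

(** The coassociativity laws and the commutation of the two coactions equate algebra morphisms on B,
    hence are checked on the matrix T. There they express the associativity of a product of three
    matrices. *)
Lemma tensor_map_ext (C D : algType K) (f g : B -> (C ⊗ D)%type) :
  linear f -> linear g -> monoid_morphism f -> monoid_morphism g ->
  (forall a b, f (T a b) = g (T a b)) -> f =1 g.
Proof.
move=> fl gl [f1 fM] [g1 gM] fg z; move: z; apply: B_ind => //.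
by apply: alg_closed_eq fl gl f1 g1 fM gM; [exact: tmulA|exact: tmul1l|exact: tmul1r].
Qed.

Lemma dL_coassoc m :
  tassoc (tmap (comul H) idfun (dL m)) = tmap idfun dL (dL m).
Proof.
move: m; apply: (@tensor_map_ext A (talg hAB)) => [||||a b].
- exact: (linear_comp (@tassoc_linear K A A B)
    (linear_comp (tmap_linear comul_lin (@id_lin B)) dL_lin)).
- exact: (linear_comp (tmap_linear (@id_lin A) dL_lin) dL_lin).
- exact: (monoid_comp (tassoc_mul hAA hAB) (monoid_comp
    (@tmap_mul K A B (talg hAA) B _ _ comul_lin (@id_lin B)
      (comul_monoid H) (@id_monoid B)) dL_monoid)).
- exact: (monoid_comp
    (@tmap_mul K A B A (talg hAB) _ _ (@id_lin A) dL_lin (@id_monoid A) dL_monoid) dL_monoid).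
rewrite dLT.
rewrite (linear_sum_fun _ _ _ (tmap_linear comul_lin (@id_lin B))).
rewrite (linear_sum_fun _ _ _ (@tassoc_linear K A A B)).
rewrite (linear_sum_fun _ _ _ (tmap_linear (@id_lin A) dL_lin)).
under eq_bigr => c _.
  rewrite (tmapE comul_lin (@id_lin B)) comul_p tpure_suml.
  rewrite (linear_sum_fun _ _ _ (@tassoc_linear K A A B)).
  under eq_bigr => d _ do rewrite tassocE.
  over.
rewrite exchange_big; apply: eq_bigr => d _ /=.
by rewrite (tmapE (@id_lin A) dL_lin) dLT tpure_sumr.
Qed.

Lemma dR_coassoc m :
  tassoc (tmap dR idfun (dR m)) = tmap idfun (comul H) (dR m).
Proof.
move: m; apply: (@tensor_map_ext B (talg hAA)) => [||||a b].
- exact: (linear_comp (@tassoc_linear K B A A)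
    (linear_comp (tmap_linear dR_lin (@id_lin A)) dR_lin)).
- exact: (linear_comp (tmap_linear (@id_lin B) comul_lin) dR_lin).
- exact: (monoid_comp (tassoc_mul hBA hAA) (monoid_comp
    (@tmap_mul K B A (talg hBA) A _ _ dR_lin (@id_lin A) dR_monoid (@id_monoid A)) dR_monoid)).
- exact: (monoid_comp
    (@tmap_mul K B A B (talg hAA) _ _ (@id_lin B) comul_lin
      (@id_monoid B) (comul_monoid H)) dR_monoid).
rewrite dRT.
rewrite (linear_sum_fun _ _ _ (tmap_linear dR_lin (@id_lin A))).
rewrite (linear_sum_fun _ _ _ (@tassoc_linear K B A A)).
rewrite (linear_sum_fun _ _ _ (tmap_linear (@id_lin B) comul_lin)).
under eq_bigr => c _.
  rewrite (tmapE dR_lin (@id_lin A)) dRT tpure_suml.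
  rewrite (linear_sum_fun _ _ _ (@tassoc_linear K B A A)).
  under eq_bigr => d _ do rewrite tassocE.
  over.
rewrite exchange_big; apply: eq_bigr => d _ /=.
by rewrite (tmapE (@id_lin B) comul_lin) comul_p tpure_sumr.
Qed.

Lemma dL_dR m : tmap idfun dR (dL m) = tassoc (tmap dL idfun (dR m)).
Proof.
apply/esym; move: m; apply: (@tensor_map_ext A (talg hBA)) => [||||a b].
- exact: (linear_comp (@tassoc_linear K A B A)
    (linear_comp (tmap_linear dL_lin (@id_lin A)) dR_lin)).
- exact: (linear_comp (tmap_linear (@id_lin A) dR_lin) dL_lin).
- exact: (monoid_comp (tassoc_mul hAB hBA) (monoid_comp
    (@tmap_mul K B A (talg hAB) A _ _ dL_lin (@id_lin A) dL_monoid (@id_monoid A)) dR_monoid)).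
- exact: (monoid_comp
    (@tmap_mul K A B A (talg hBA) _ _ (@id_lin A) dR_lin (@id_monoid A) dR_monoid) dL_monoid).
rewrite dLT dRT.
rewrite (linear_sum_fun _ _ _ (tmap_linear dL_lin (@id_lin A))).
rewrite (linear_sum_fun _ _ _ (@tassoc_linear K A B A)).
rewrite (linear_sum_fun _ _ _ (tmap_linear (@id_lin A) dR_lin)).
under eq_bigr => c _.
  rewrite (tmapE dL_lin (@id_lin A)) dLT tpure_suml.
  rewrite (linear_sum_fun _ _ _ (@tassoc_linear K A B A)).
  under eq_bigr => d _ do rewrite tassocE.
  over.
rewrite exchange_big; apply: eq_bigr => d _ /=.
by rewrite (tmapE (@id_lin A) dR_lin) dRT tpure_sumr.
Qed.

Let counit_smul_bil : bilinear_map (fun (a : A) (m : B) => (counit H a : K) *: m).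
Proof.
split=> [m c a b|a c m n] /=; first by rewrite linearP scalerDl scalerA.
by rewrite scalerDr !scalerA mulrC.
Qed.

Let counit_smulr_bil : bilinear_map (fun (m : B) (a : A) => (counit H a : K) *: m).
Proof. by have [h1 h2] := counit_smul_bil; split. Qed.

(** Contraction with the counit is multiplicative because the counit is a character; this is seen on
    pure tensors, after which the generators decide. *)
Lemma dL_counit m : tlift (fun a n => (counit H a : K) *: n) (dL m) = m.
Proof.
have el := tlift_linear counit_smul_bil.
move: m; apply: B_ind => [|a b]; last first.
  rewrite dLT (linear_sum_fun _ _ _ el) (bigD1 a) //= (tliftE counit_smul_bil) counit_p.
  rewrite eqxx scale1r big1 ?addr0 // => c /negbTE ca.
  by rewrite (tliftE counit_smul_bil) counit_p eq_sym ca scale0r.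
apply: (alg_closed_eq (@mulrA B) (@mul1r B) (@mulr1 B) (linear_comp el dL_lin)
  (@id_lin B)) => //=; first by rewrite dL_monoid.1 (tliftE counit_smul_bil) rmorph1 scale1r.
move=> x y; rewrite dL_monoid.2; move: (dL x) (dL y) => X Y.
move: X; apply: linear_tensor_ext => [||a m].
- exact: (linear_comp el ((tmul_bil A B).1 Y)).
- exact: (linear_comp ((mul_bil B).1 _) el).
move: Y; apply: linear_tensor_ext => [||b n].
- exact: (linear_comp el ((tmul_bil A B).2 _)).
- exact: (linear_comp ((mul_bil B).2 _) el).
rewrite tensM !(tliftE counit_smul_bil) rmorphM /= -scalerAl -scalerAr scalerA //.
Qed.

Lemma dR_counit m : tlift (fun n a => (counit H a : K) *: n) (dR m) = m.
Proof.
have el := tlift_linear counit_smulr_bil.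
move: m; apply: B_ind => [|a b]; last first.
  rewrite dRT (linear_sum_fun _ _ _ el) (bigD1 b) //= (tliftE counit_smulr_bil) counit_p.
  rewrite eqxx scale1r big1 ?addr0 // => c /negbTE ca.
  by rewrite (tliftE counit_smulr_bil) counit_p ca scale0r.
apply: (alg_closed_eq (@mulrA B) (@mul1r B) (@mulr1 B) (linear_comp el dR_lin)
  (@id_lin B)) => //=; first by rewrite dR_monoid.1 (tliftE counit_smulr_bil) rmorph1 scale1r.
move=> x y; rewrite dR_monoid.2; move: (dR x) (dR y) => X Y.
move: X; apply: linear_tensor_ext => [||m a].
- exact: (linear_comp el ((tmul_bil B A).1 Y)).
- exact: (linear_comp ((mul_bil B).1 _) el).
move: Y; apply: linear_tensor_ext => [||n b].
- exact: (linear_comp el ((tmul_bil B A).2 _)).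
- exact: (linear_comp ((mul_bil B).2 _) el).
rewrite tensM !(tliftE counit_smulr_bil) rmorphM /= -scalerAl -scalerAr scalerA //.
Qed.

Definition mlact (c : A) (m : B) : B := iota c * m.
Definition mract (m : B) (c : A) : B := m * iota c.

Let iota_lin : linear iota. Proof. exact: linearP. Qed.

Lemma mlact_bil : bilinear_map mlact.
Proof.
by split=> [m c a b|a c m n]; rewrite /mlact
  ?linearP ?mulrDl ?mulrDr -?scalerAl -?scalerAr.
Qed.

Lemma mract_bil : bilinear_map mract.
Proof.
by split=> [c d a b|a c m n]; rewrite /mract
  ?linearP ?mulrDl ?mulrDr -?scalerAl -?scalerAr.
Qed.

(** The induced action of A ⊗ A on A ⊗ B is multiplication by the image in A ⊗ B. The covariance
    laws of the bimodule thereby become the multiplicativity of the coactions. *)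
Lemma tmap2_mlact (X : (A ⊗ A)%type) (Y : (A ⊗ B)%type) :
  tmap2 ( *%R) mlact X Y = tmap idfun iota X * Y.
Proof.
rewrite -[LHS]tmap_id -[in RHS](tmap_id Y).
by apply: tmap_tmap2 => //; [exact: mul_bil|exact: mlact_bil|exact: mul_bil|exact: mul_bil].
Qed.

Lemma tmap2_mract (X : (A ⊗ B)%type) (Y : (A ⊗ A)%type) :
  tmap2 ( *%R) mract X Y = X * tmap idfun iota Y.
Proof.
rewrite -[LHS]tmap_id -[in RHS](tmap_id X).
by apply: tmap_tmap2 => //; [exact: mul_bil|exact: mract_bil|exact: mul_bil|exact: mul_bil].
Qed.

Lemma tmap2_mlactl (X : (A ⊗ A)%type) (Y : (B ⊗ A)%type) :
  tmap2 mlact *%R X Y = tmap iota idfun X * Y.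
Proof.
rewrite -[LHS]tmap_id -[in RHS](tmap_id Y).
by apply: tmap_tmap2 => //; [exact: mlact_bil|exact: mul_bil|exact: mul_bil|exact: mul_bil].
Qed.

Lemma tmap2_mractl (X : (B ⊗ A)%type) (Y : (A ⊗ A)%type) :
  tmap2 mract *%R X Y = X * tmap iota idfun Y.
Proof.
rewrite -[LHS]tmap_id -[in RHS](tmap_id X).
by apply: tmap_tmap2 => //; [exact: mract_bil|exact: mul_bil|exact: mul_bil|exact: mul_bil].
Qed.

Lemma dL_act a m b : dL (mract (mlact a m) b) =
  tmap2 *%R mract (tmap2 *%R mlact (comul H a) (dL m)) (comul H b).
Proof. by rewrite tmap2_mract tmap2_mlact -!dL_iota -!dL_monoid.2. Qed.

Lemma dR_act a m b : dR (mract (mlact a m) b) =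
  tmap2 mract *%R (tmap2 mlact *%R (comul H a) (dR m)) (comul H b).
Proof. by rewrite tmap2_mractl tmap2_mlactl -!dR_iota -!dR_monoid.2. Qed.

Lemma mlact1 m : mlact 1 m = m. Proof. by rewrite /mlact rmorph1 mul1r. Qed.
Lemma mlactM a b m : mlact (a * b) m = mlact a (mlact b m).
Proof. by rewrite /mlact rmorphM mulrA. Qed.
Lemma mract1 m : mract m 1 = m. Proof. by rewrite /mract rmorph1 mulr1. Qed.
Lemma mractM m a b : mract m (a * b) = mract (mract m a) b.
Proof. by rewrite /mract rmorphM mulrA. Qed.
Lemma mlractA a m b : mract (mlact a m) b = mlact a (mract m b).
Proof. by rewrite /mract /mlact mulrA. Qed.

Definition matrix_bimodule : bicovariant_bimodule H B :=
  @BicovariantBimodule K A H B mlact mract dL dR mlact_bil mlact1 mlactM mract_bil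
    mract1 mractM mlractA dL_coassoc dL_counit dR_coassoc dR_counit dL_act dR_act dL_dR.
End MatrixBimodule.

(** Y D is a left inverse of u and D Y a right inverse, so they coincide, and Y u is a two-sided
    inverse of D. It is applied to u, the determinant D of the block and the inverse Y of the full
    determinant. *)
Lemma inverse_factor (X : pzRingType) (u D Y : X) :
  D * u = u * D -> u * D * Y = 1 -> Y * (u * D) = 1 ->
  D * (Y * u) = 1 /\ Y * u * D = 1.
Proof.
move=> Du h1 h2; have e1 : Y * D * u = 1 by rewrite -mulrA Du.
have e2 : u * (D * Y) = 1 by rewrite mulrA.
have e3 : D * Y = Y * D by rewrite -[D * Y]mul1r -e1 -[X in X = _]mulrA e2 mulr1.
by split; [rewrite mulrA e3|rewrite -mulrA].
Qed.

Section DiagBlock.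
Variables (K : fieldType) (N : nat) (A : algType K) (TA : 'I_N -> 'I_N -> A).
Local Notation l := (lift ord0).

Definition diag_block (a b : 'I_N.+1) : A :=
  match unlift ord0 a, unlift ord0 b with
  | Some a', Some b' => TA a' b'
  | None, None => 1
  | _, _ => 0
  end.
Local Notation p := diag_block.

Lemma diag_block_low a b : p (l a) (l b) = TA a b.
Proof. by rewrite /p !liftK. Qed.
Lemma diag_block00 : p ord0 ord0 = 1.
Proof. by rewrite /p unlift_none. Qed.
Lemma diag_block0l b : p ord0 (l b) = 0.
Proof. by rewrite /p unlift_none liftK. Qed.
Lemma diag_blockl0 a : p (l a) ord0 = 0.
Proof. by rewrite /p unlift_none liftK. Qed.
Definition diag_blockE :=
  (diag_block_low, diag_block00, diag_block0l, diag_blockl0).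
End DiagBlock.

Section Coactions.
Variables (K : fieldType) (N : nat) (r q0 : K) (q : 'I_N.+1 -> 'I_N.+1 -> K).
Hypothesis r_neq0 : r != 0.
Hypothesis q_neq0 : forall A B, q A B != 0.
Hypothesis qV : forall A B, q A B = r ^+ 2 / q B A.
Hypothesis q_diag : forall A, q A A = r.
Hypothesis q_const : forall a : 'I_N, q (lift ord0 a) ord0 = q0.

Local Notation l := (lift ord0).
Variables (A B : algType K) (TA : 'I_N -> 'I_N -> A) (XA : A).
Hypothesis TA_RTT : forall a b c d, RTT r (qlow q) TA a b c d = 0.
Hypotheses (TA_det : qdet r (qlow q) TA * XA = 1) (TA_det' : XA * qdet r (qlow q) TA = 1).
Hypothesis A_ind : forall P : A -> Prop,
  alg_closed P -> (forall a b, P (TA a b)) -> forall z, P z.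
Variable T : 'I_N.+1 -> 'I_N.+1 -> B.
Hypothesis T_RTT : forall a b c d, RTT r q T a b c d = 0.
Hypothesis T0 : forall a, T ord0 (l a) = 0.
Variable uV : B.
Hypotheses (TuV : T ord0 ord0 * uV = 1) (TVu : uV * T ord0 ord0 = 1).
Hypothesis B_univ : forall (C : algType K) (t : 'I_N.+1 -> 'I_N.+1 -> C) (xi : C),
  (forall a b c d, RTT r q t a b c d = 0) -> (forall a, t ord0 (l a) = 0) ->
  qdet r q t * xi = 1 -> xi * qdet r q t = 1 ->
  exists g : {lrmorphism B -> C}, forall a b, g (T a b) = t a b.

Local Notation p := (diag_block TA).

(** Here u = 1 and x = 0, so that among the rules of [RTT_build] only the relations of the block
    have content. *)
Lemma diag_block_RTT a b c d : RTT r q p a b c d = 0.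
Proof.
apply: (RTT_build r_neq0 q_neq0 qV q_diag q_const) => [a'|a' b' c' d'|a' b' d'|a' b' _|a' b'|a'];
  rewrite ?diag_blockE ?mulr0 ?mul0r ?scaler0 ?addr0 ?mulr1 ?mul1r ?scaler0 //.
rewrite -[RHS](TA_RTT a' b' c' d').
by congr RTT; apply/funext => x; apply/funext => y; rewrite diag_blockE.
Qed.

Variable H : hopf_algebra A.
Hypothesis comul_TA : forall a b, comul H (TA a b) = \sum_c TA a c ⊗ TA c b.
Hypothesis counit_TA : forall a b, counit H (TA a b) = (a == b)%:R.

Lemma comul_diag_block a b : comul H (p a b) = \sum_c p a c ⊗ p c b.
Proof.
rewrite big_ord_recl; case: (unliftP ord0 a) => [a' ->|->]; case: (unliftP ord0 b) => [b' ->|->];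
  rewrite !diag_blockE ?tpure0l ?tpure0r ?add0r ?raddf0.
- by rewrite comul_TA; apply: eq_bigr => c _; rewrite !diag_blockE.
- by rewrite big1 // => c _; rewrite !diag_blockE tpure0r.
- by rewrite big1 // => c _; rewrite !diag_blockE tpure0l.
rewrite (comul_monoid H).1 big1 ?addr0 // => c _; by rewrite !diag_blockE tpure0l.
Qed.

Lemma counit_diag_block a b : counit H (p a b) = (a == b)%:R.
Proof.
case: (unliftP ord0 a) => [a' ->|->]; case: (unliftP ord0 b) => [b' ->|->];
  by rewrite !diag_blockE ?raddf0 ?rmorph1 // counit_TA (inj_eq lift_inj).
Qed.

Variable iota : {lrmorphism A -> B}.
Hypothesis iotaT : forall a b, iota (TA a b) = T (l a) (l b).

Let comul_lin : linear (comul H). Proof. exact: linearP. Qed.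
Let iota_lin : linear iota. Proof. exact: linearP. Qed.
Let id_lin (V : lmodType K) : linear (@idfun V). Proof. by []. Qed.
Let iota_monoid : monoid_morphism iota.
Proof. by split=> [|x y]; rewrite ?rmorph1 ?rmorphM. Qed.
Let id_monoid (V : algType K) : monoid_morphism (@idfun V). Proof. by []. Qed.

(* Both coactions are multiplicative extensions of a matrix [t] whose corner is
   [u] up to embedding and whose lower block is the coproduct of GL(N). *)
Lemma coaction_lift (C : algType K) (t : 'I_N.+1 -> 'I_N.+1 -> C)
    (F : {lrmorphism A -> C}) (j : {lrmorphism B -> C}) :
  (forall a b c d, RTT r q t a b c d = 0) -> (forall a, t ord0 (l a) = 0) ->
  t ord0 ord0 = j (T ord0 ord0) -> (forall a b, t (l a) (l b) = F (TA a b)) ->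
  exists g : {lrmorphism B -> C},
    (forall a b, g (T a b) = t a b) /\ forall c, g (iota c) = F c.
Proof.
move=> tR t0 t00 tF.
(* The determinant of t is a product of images of two invertible elements, as the universal property
   of B requires. *)
have dE : qdet r q t = j (T ord0 ord0) * F (qdet r (qlow q) TA).
  rewrite (qdet_lift r q t0) t00 map_qdet; congr (_ * _).
  by congr qdet; apply/funext => a; apply/funext => b; rewrite tF.
have h1 : qdet r q t * (F XA * j uV) = 1.
  by rewrite dE mulrA -[X in X * _]mulrA -rmorphM TA_det rmorph1 mulr1 -rmorphM TuV rmorph1.
have h2 : F XA * j uV * qdet r q t = 1.
  by rewrite dE mulrA -[X in X * _]mulrA -rmorphM TVu rmorph1 mulr1 -rmorphM TA_det' rmorph1.
have [g gT] := B_univ tR t0 h1 h2; exists g; split=> // c; move: c.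
apply: A_ind => [|a b]; last by rewrite iotaT gT tF.
apply: (alg_closed_eq (@mulrA C) (@mul1r C) (@mulr1 C)) => [||||x y|x y].
- exact: (linear_comp (linearP g) iota_lin).
- exact: linearP.
- by rewrite !rmorph1.
- by rewrite rmorph1.
- by rewrite !rmorphM.
- by rewrite rmorphM.
Qed.

Lemma right_coaction_exists (h : (1 : B) ⊗ (1 : A) != 0) :
  exists d : {linear B -> (B ⊗ A)%type},
  [/\ monoid_morphism d, forall a b, d (T a b) = \sum_c T a c ⊗ p c b &
      forall c, d (iota c) = tmap iota idfun (comul H c)].
Proof.
(* The matrix product of T and diag(1, T), with the factors embedded in different legs of the tensor
   product, where they commute. *)
pose t := mxprod (fun a b => tinl h (T a b)) (fun a b => tinr h (p a b)).
have tE a b : t a b = \sum_c T a c ⊗ p c b by apply: eq_bigr => c _; rewrite tinlr.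
have tR a b c d : RTT r q t a b c d = 0.
  apply: RTT_mxprod => [*|*|*]; first exact: tinrl.
    by rewrite -map_RTT T_RTT raddf0.
  by rewrite -map_RTT diag_block_RTT raddf0.
have il := tmap_linear iota_lin (@id_lin A).
have Fl : linear (tmap iota idfun \o comul H : A -> talg h) := linear_comp il comul_lin.
have Fm : monoid_morphism (tmap iota idfun \o comul H : A -> talg h).
  exact: (@monoid_comp A (A ⊗ A)%type (talg h) _ _
    (@tmap_mul K A A B A _ _ iota_lin (@id_lin A) iota_monoid (@id_monoid A)) (comul_monoid H)).
have [F FE] := lrmorphism_of_fun Fl Fm.
have t0 a : t ord0 (l a) = 0.
  rewrite tE big_ord_recl diag_blockE tpure0r add0r big1 // => c _.
  by rewrite T0 tpure0l.
have tF a b : t (l a) (l b) = F (TA a b).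
  rewrite tE big_ord_recl diag_blockE tpure0r add0r FE /= comul_TA.
  rewrite (linear_sum_fun _ _ _ il).
  by apply: eq_bigr => c _; rewrite (tmapE iota_lin (@id_lin A)) iotaT diag_blockE.
have t00 : t ord0 ord0 = tinl h (T ord0 ord0).
  rewrite tE big_ord_recl diag_blockE big1 ?addr0 // => c _.
  by rewrite T0 tpure0l.
have [g [gT gi]] := coaction_lift tR t0 t00 tF.
(* The morphism into [talg h] is repackaged as a linear map into the bare tensor product, the type
   that a coaction has to have. *)
have gl : linear (g : B -> (B ⊗ A)%type) by exact: linearP.
pose F1 := GRing.isLinear.Build K B (B ⊗ A)%type *:%R (g : B -> (B ⊗ A)%type) gl.
pose d : {linear B -> (B ⊗ A)%type} := HB.pack (g : B -> (B ⊗ A)%type) F1.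
exists d; split=> [|a b|c].
- by split=> [|x y]; [exact: (rmorph1 g)|exact: (rmorphM g)].
- by rewrite -tE -gT.
by rewrite -[RHS]FE -gi.
Qed.

Lemma left_coaction_exists (h : (1 : A) ⊗ (1 : B) != 0) :
  exists d : {linear B -> (A ⊗ B)%type},
  [/\ monoid_morphism d, forall a b, d (T a b) = \sum_c p a c ⊗ T c b &
      forall c, d (iota c) = tmap idfun iota (comul H c)].
Proof.
pose t := mxprod (fun a b => tinl h (p a b)) (fun a b => tinr h (T a b)).
have tE a b : t a b = \sum_c p a c ⊗ T c b by apply: eq_bigr => c _; rewrite tinlr.
have tR a b c d : RTT r q t a b c d = 0.
  apply: RTT_mxprod => [*|*|*]; first exact: tinrl.
    by rewrite -map_RTT diag_block_RTT raddf0.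
  by rewrite -map_RTT T_RTT raddf0.
have il := tmap_linear (@id_lin A) iota_lin.
have Fl : linear (tmap idfun iota \o comul H : A -> talg h) := linear_comp il comul_lin.
have Fm : monoid_morphism (tmap idfun iota \o comul H : A -> talg h).
  exact: (@monoid_comp A (A ⊗ A)%type (talg h) _ _
    (@tmap_mul K A A A B _ _ (@id_lin A) iota_lin (@id_monoid A) iota_monoid) (comul_monoid H)).
have [F FE] := lrmorphism_of_fun Fl Fm.
have t0 a : t ord0 (l a) = 0.
  rewrite tE big_ord_recl T0 tpure0r add0r big1 // => c _.
  by rewrite diag_blockE tpure0l.
have tF a b : t (l a) (l b) = F (TA a b).
  rewrite tE big_ord_recl diag_blockE tpure0l add0r FE /= comul_TA.
  rewrite (linear_sum_fun _ _ _ il).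
  by apply: eq_bigr => c _; rewrite (tmapE (@id_lin A) iota_lin) iotaT diag_blockE.
have t00 : t ord0 ord0 = tinr h (T ord0 ord0).
  rewrite tE big_ord_recl diag_blockE big1 ?addr0 // => c _.
  by rewrite diag_blockE tpure0l.
have [g [gT gi]] := coaction_lift tR t0 t00 tF.
have gl : linear (g : B -> (A ⊗ B)%type) by exact: linearP.
pose F1 := GRing.isLinear.Build K B (A ⊗ B)%type *:%R (g : B -> (A ⊗ B)%type) gl.
pose d : {linear B -> (A ⊗ B)%type} := HB.pack (g : B -> (A ⊗ B)%type) F1.
exists d; split=> [|a b|c].
- by split=> [|x y]; [exact: (rmorph1 g)|exact: (rmorphM g)].
- by rewrite -tE -gT.
by rewrite -[RHS]FE -gi.
Qed.
End Coactions.

(** * The Fock representation *)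

Section OscillatorMatrix.
Variables (K : fieldType) (N : nat) (r q0 : K) (q : 'I_N.+1 -> 'I_N.+1 -> K).
Hypothesis r_neq0 : r != 0.
Hypothesis q_neq0 : forall A B, q A B != 0.
Hypothesis qV : forall A B, q A B = r ^+ 2 / q B A.
Hypothesis q_diag : forall A, q A A = r.
Hypothesis q_const : forall a : 'I_N, q (lift ord0 a) ord0 = q0.
Local Notation l := (lift ord0).
Local Notation rho := (rho r (qlow q)).
Local Notation lam := (lam r).
Local Notation s := (mixed_coef r q0).

Let Rn a b : rho a b != 0.
Proof. exact: rho_neq0 r_neq0 (qlow_neq0 q_neq0) (qlow_diag q_diag) a b. Qed.
Let RV (a b : 'I_N) : (a < b)%N -> rho b a = (rho a b)^-1.
Proof. by move=> ab; exact: (rhoV r_neq0 (qlow_neq0 q_neq0) (qlowV qV) (ord_neq ab)). Qed.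
Let RD a : rho a a = r. Proof. exact: rho_diag r_neq0 (qlow_diag q_diag) a. Qed.
Let s0 (a : 'I_N) : s != 0. Proof. exact: (mixed_coef_neq0 r_neq0 q_neq0 q_diag q_const a). Qed.

Variables (X : algType K) (x E k : 'I_N -> X) (u : X).
Hypothesis xx : forall a b : 'I_N, (b < a)%N -> x a * x b = (rho b a / r) *: (x b * x a).
Hypothesis kx : forall a b, k b * x a = (s / rho b a) *: (x a * k b).
Hypothesis Ex_lt : forall a d : 'I_N, (a < d)%N -> E d * x a = (s * r) *: (x a * E d).
Hypothesis Ex_gt : forall a d : 'I_N, (d < a)%N -> E d * x a = (s / r) *: (x a * E d).
Hypothesis Ex_eq : forall d, E d * x d = (s * r) *: (x d * E d) - (s * lam) *: k d.
Hypothesis EE : forall c d : 'I_N, (c < d)%N -> E c * E d = (r * rho c d) *: (E d * E c).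
Hypothesis kE : forall b d, k b * E d = (rho b d / s) *: (E d * k b).
Hypothesis kk : forall a b, k a * k b = k b * k a.
Hypothesis xu : forall a, x a * u = (r * s)^-1 *: (u * x a).
Hypothesis Eu : forall a, E a * u = (r * s) *: (u * E a).
Hypothesis ku : forall a, k a * u = u * k a.

Definition osc_full (A B : 'I_N.+1) : X :=
  match unlift ord0 A, unlift ord0 B with
  | Some a, Some b => osc x E k a b
  | Some a, None => x a
  | None, None => u
  | None, Some _ => 0
  end.

Lemma osc_full_low a b : osc_full (l a) (l b) = osc x E k a b.
Proof. by rewrite /osc_full !liftK. Qed.
Lemma osc_full00 : osc_full ord0 ord0 = u.
Proof. by rewrite /osc_full unlift_none. Qed.
Lemma osc_full0l b : osc_full ord0 (l b) = 0.
Proof. by rewrite /osc_full unlift_none liftK. Qed.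
Lemma osc_fulll0 a : osc_full (l a) ord0 = x a.
Proof. by rewrite /osc_full unlift_none liftK. Qed.
Definition osc_fullE := (osc_full_low, osc_full00, osc_full0l, osc_fulll0).

(** This rule ties the block to the column x. For d < b it is governed by the relation between E_d
    and x^a; when a = d, the k term of [Ex_eq] supplies the diagonal entry L^a_d on the right. *)
Lemma osc_Lx a b d : osc x E k b d * x a =
  s *: (rho a b *: (x a * osc x E k b d)
        + (lam * ((b < a)%N%:R - 1)) *: (x b * osc x E k a d)).
Proof.
have s_neq0 := s0 a.
have lamE : r - lam = r^-1 by rewrite /lam opprB addrC subrK.
have xx' (a' b' : 'I_N) (Y : X) :
    (b' < a')%N -> x a' * (x b' * Y) = (rho b' a' / r) *: (x b' * (x a' * Y)).
  by move=> ba; rewrite mulrA xx // -scalerAl mulrA.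
have [bd|db|/val_inj<-] := ltngtP b d.
- rewrite (osc0 x E k bd) mul0r mulr0 scaler0 add0r.
  have [ba|ab] := ltnP b a; first by rewrite subrr mulr0 scale0r scaler0.
  by rewrite (osc0 x E k (leq_ltn_trans ab bd)) mulr0 !scaler0.
- rewrite (oscE x E k db) -mulrA.
  have [ad|da|/val_inj ad] := ltngtP a d.
  + have ab := ltn_trans ad db.
    rewrite Ex_lt // (osc0 x E k ad) mulr0 scaler0 addr0 -scalerAr (xx' _ _ _ ab) !scalerA.
    by congr (_ *: _); field; rewrite r_neq0.
  + rewrite Ex_gt // (oscE x E k da) -scalerAr.
    have [ba|ab|/val_inj<-] := ltngtP b a.
    * rewrite subrr mulr0 scale0r addr0 (xx' _ _ _ ba) !scalerA (RV ba); congr (_ *: _).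
      by field; rewrite r_neq0 Rn.
    * rewrite sub0r mulrN1 (xx' _ _ _ ab) !scalerA -scalerDl !scalerA; congr (_ *: _).
      by rewrite /lam; field; rewrite r_neq0.
    by rewrite sub0r mulrN1 RD -scalerDl lamE scalerA.
  rewrite {a}ad in s_neq0 *; rewrite Ex_eq osck ltnNge (ltnW db) sub0r mulrN1.
  rewrite mulrBr -!scalerAr (xx' _ _ _ db) scalerDr !scalerA mulrN scaleNr; congr (_ *: _ - _).
  by field; rewrite r_neq0.
rewrite osck kx.
have [ba|ab|/val_inj<-] := ltngtP b a.
- by rewrite subrr mulr0 scale0r addr0 scalerA (RV ba).
- by rewrite (osc0 x E k ab) mulr0 scaler0 addr0 scalerA (RV ab) invrK.
by rewrite osck sub0r mulrN1 RD -scalerDl lamE scalerA.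
Qed.

Lemma osc_full_RTT A B C D : RTT r q osc_full A B C D = 0.
Proof.
apply: (RTT_build r_neq0 q_neq0 qV q_diag q_const) => [a|a b c d|a b d|a b ba|a b|a];
  rewrite ?osc_fullE //; last first.
- have [ab|ba|/val_inj<-] := ltngtP a b; last by rewrite osck.
    by rewrite (osc0 x E k ab) mul0r mulr0.
  rewrite (oscE x E k ba) -mulrA Eu -scalerAr [x a * (u * E b)]mulrA [u * (x a * _)]mulrA.
  rewrite xu -scalerAl scalerA divff ?scale1r //.
  by rewrite mulf_neq0 ?r_neq0 ?(s0 a).
- exact: xx.
- exact: osc_Lx.
rewrite -[RHS](osc_RTT r_neq0 (qlow_neq0 q_neq0) (qlowV qV) (qlow_diag q_diag) (s0 a)
  xx kx Ex_lt Ex_gt Ex_eq EE kE kk a b c d).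
by congr RTT; apply/funext => y; apply/funext => z; rewrite osc_fullE.
Qed.

Lemma osc_full_det : qdet r q osc_full = u * \prod_a k a.
Proof.
rewrite (qdet_lift r q (t := osc_full)); last by move=> a; rewrite osc_fullE.
rewrite osc_fullE (@qdet_triangular K N r (qlow q) X (fun a b => osc_full (l a) (l b))).
  by congr (_ * _); apply: eq_bigr => a _; rewrite osc_fullE osck.
by move=> a b ab; rewrite osc_fullE osc0.
Qed.
End OscillatorMatrix.

Section BasisProjection.
Variables (K : fieldType) (I : choiceType) (D : I -> bool).
Local Notation F := {malg K[I]}.

Definition proj_vec : F -> F := linext (fun i => if D i then basis K i else 0).

Lemma proj_vec_linear : linear proj_vec. Proof. exact: linext_linear. Qed.

Lemma proj_vec_basis i : proj_vec (basis K i) = if D i then basis K i else 0.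
Proof. exact: linext_basis. Qed.
End BasisProjection.

(** * The isomorphism between F ⊗ A and B *)

Section FockIsomorphism.
Variables (K : fieldType) (A B : algType K) (H : hopf_algebra A) (iota : {lrmorphism A -> B}).
Variables (I : choiceType) (i0 : I).
Local Notation F := {malg K[I]}.
Local Notation delta := (basis K).
Local Notation E := (lend_alg (basis_neq0 K i0)).
Variables (J : finType) (T : J -> J -> B) (p : J -> J -> A).
Hypothesis B_ind : forall P : B -> Prop,
  alg_closed P -> (forall a b, P (T a b)) -> forall z, P z.
Variables (dR : {linear B -> (B ⊗ A)%type}) (fock : {lrmorphism B -> E}).
Hypothesis dR_monoid : monoid_morphism dR.
Hypothesis dRT : forall a b, dR (T a b) = \sum_c T a c ⊗ p c b.
Hypothesis dR_iota : forall c, dR (iota c) = tmap iota idfun (comul H c).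
Hypothesis fock_vac : forall c, fock (iota c) (delta i0) = (counit H c : K) *: delta i0.
Variable zeta : I -> B.

Definition vec_map : F -> B := linext zeta.
Hypothesis exchange : forall a b i,
  T a b * zeta i = \sum_c vec_map (fock (T a c) (delta i)) * iota (p c b).

Definition fock_app (z : B) (f : F) : F := fock z f.

Lemma fock_app_bil : bilinear_map fock_app.
Proof.
split=> [f c z w|z]; last exact: lapp_linear.
by rewrite /fock_app linearP.
Qed.

Definition fock_act (z : B) (y : F ⊗ A) : F ⊗ A := tmap2 fock_app ( *%R) (dR z) y.

Let act2_bil := tmap2_bil fock_app_bil (@mul_bil K A).

Lemma fock_act_bil : bilinear_map fock_act.
Proof.
split=> [y c z w|z]; last exact: act2_bil.2.
by rewrite /fock_act linearP act2_bil.1.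
Qed.

Lemma fock_act1 y : fock_act 1 y = y.
Proof.
rewrite /fock_act dR_monoid.1; move: y; apply: linear_tensor_ext => [||f c] //.
  exact: act2_bil.2.
by rewrite (tmap2E fock_app_bil (@mul_bil K A)) mul1r /fock_app rmorph1.
Qed.

Lemma tmap2_fock_mul (X Y : (B ⊗ A)%type) y :
  tmap2 fock_app ( *%R) (X * Y) y = tmap2 fock_app ( *%R) X (tmap2 fock_app ( *%R) Y y).
Proof.
have E2 := tmap2E fock_app_bil (@mul_bil K A).
move: X; apply: linear_tensor_ext => [c X X'|c X X'|b a].
- by rewrite mulrDl -tscalerAl act2_bil.1.
- by rewrite act2_bil.1.
move: Y; apply: linear_tensor_ext => [c X X'|c X X'|b' a'].
- by rewrite mulrDr -tscalerAr act2_bil.1.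
- by rewrite act2_bil.1 act2_bil.2.
move: y; apply: linear_tensor_ext => [c X X'|c X X'|f a''].
- by rewrite act2_bil.2.
- by rewrite !act2_bil.2.
by rewrite tensM !E2 mulrA /fock_app rmorphM.
Qed.

Lemma fock_actM z w y : fock_act (z * w) y = fock_act z (fock_act w y).
Proof. by rewrite /fock_act dR_monoid.2 tmap2_fock_mul. Qed.

Let vec_lin : linear vec_map. Proof. exact: linext_linear. Qed.

Lemma vec_map_mul_bil : bilinear_map (fun f c => vec_map f * iota c).
Proof.
split=> [c d f g|f c a b] /=; first by rewrite vec_lin mulrDl -scalerAl.
by rewrite linearP mulrDr -scalerAr.
Qed.

Definition mul_map : F ⊗ A -> B := tlift (fun f c => vec_map f * iota c).

Lemma mul_map_linear : linear mul_map.
Proof. exact: tlift_linear vec_map_mul_bil. Qed.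

Lemma mul_mapE f c : mul_map (f ⊗ c) = vec_map f * iota c.
Proof. exact: tliftE vec_map_mul_bil _ _. Qed.

Lemma vec_map_basis i : vec_map (delta i) = zeta i.
Proof. exact: linext_basis. Qed.

(** On the generators this is [exchange]. Quantifying over all y lets the property pass to an
    inverse w of z: multiply the case of z, taken at the vector [fock_act w y], by w. *)
Lemma mul_map_act z y : mul_map (fock_act z y) = z * mul_map y.
Proof.
move: z y; apply: B_ind => [|a b].
  split=> [y|c z w zP wP y|z w zP wP y|z w zP zw wz y].
  - by rewrite fock_act1 mul1r.
  - by rewrite fock_act_bil.1 mul_map_linear zP wP mulrDl -scalerAl.
  - by rewrite fock_actM zP wP mulrA.
  rewrite -[LHS]mul1r -wz -mulrA -zP -fock_actM zw fock_act1.
  by [].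
apply: linear_tensor_basis_ext => [||i c].
- exact: (linear_comp mul_map_linear (fock_act_bil.2 _)).
- exact: (linear_comp ((mul_bil B).2 _) mul_map_linear).
rewrite /fock_act dRT.
rewrite (linear_sum_fun (f := fun X => tmap2 fock_app ( *%R) X _) _ _ _ (act2_bil.1 _)).
rewrite (linear_sum_fun _ _ _ mul_map_linear) mul_mapE vec_map_basis mulrA exchange mulr_suml.
apply: eq_bigr => d _; rewrite (tmap2E fock_app_bil (@mul_bil K A)) mul_mapE.
by rewrite rmorphM mulrA.
Qed.

Definition vac_map (z : B) : F ⊗ A := fock_act z (delta i0 ⊗ 1).

Lemma vac_map_linear : linear vac_map.
Proof. exact: fock_act_bil.1. Qed.

Hypothesis zeta0 : zeta i0 = 1.

Lemma vac_mapK : cancel vac_map mul_map.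
Proof. by move=> z; rewrite mul_map_act mul_mapE vec_map_basis zeta0 rmorph1 !mulr1. Qed.

Lemma fock_act_iota c y :
  fock_act (iota c) y = tmap2 (fun a => fock_app (iota a)) ( *%R) (comul H c) y.
Proof.
rewrite /fock_act dR_iota; move: (comul H c) => X.
rewrite -[RHS]tmap_id; apply/esym; rewrite -[in RHS](tmap_id y).
have iapp_bil : bilinear_map (fun a => fock_app (iota a)).
  by split=> [f d a b|a]; [rewrite /= linearP fock_app_bil.1|exact: fock_app_bil.2].
by apply: tmap_tmap2 => //; [exact: linearP|exact: mul_bil|exact: fock_app_bil|exact: mul_bil].
Qed.

(** A acts on the vacuum by the counit, so the counit axiom collapses the coproduct of c to c in the
    second leg. *)
Lemma vac_map_iota c : vac_map (iota c) = delta i0 ⊗ c.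
Proof.
rewrite /vac_map fock_act_iota -[in RHS](counitl H c).
have iapp_bil : bilinear_map (fun a => fock_app (iota a)).
  by split=> [f d a b|a]; [rewrite /= linearP fock_app_bil.1|exact: fock_app_bil.2].
have cb : bilinear_map (fun (b c : A) => (counit H b : K) *: c).
  split=> [m d a b|a d m n] /=; first by rewrite linearP scalerDl scalerA.
  by rewrite scalerDr !scalerA mulrC.
move: (comul H c); apply: linear_tensor_ext => [||a b].
- exact: (tmap2_bil iapp_bil (@mul_bil K A)).1.
- exact: (linear_comp ((tpure_bil F A).2 _) (tlift_linear cb)).
rewrite (tmap2E iapp_bil (@mul_bil K A)) (tliftE cb) mulr1 /fock_app fock_vac.
by rewrite tpureZl tpureZr.
Qed.

Hypothesis zeta_act : forall i c, fock_act (zeta i) (delta i0 ⊗ c) = delta i ⊗ c.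

Lemma vac_map_zeta i c : vac_map (zeta i * iota c) = delta i ⊗ c.
Proof. by rewrite /vac_map fock_actM -/(vac_map (iota c)) vac_map_iota zeta_act. Qed.

Definition zeta_span (D : I -> bool) : B -> Prop :=
  span (fun z => exists i c, D i /\ z = zeta i * iota c).

Lemma zeta_span_gen (D : I -> bool) i c : D i -> zeta_span D (zeta i * iota c).
Proof. by move=> Di; apply: span_gen; exists i, c. Qed.

Lemma zeta_independent (s : seq I) (b : I -> A) : uniq s ->
  \sum_(i <- s) zeta i * iota (b i) = 0 -> forall i, i \in s -> b i = 0.
Proof.
move=> us /(congr1 vac_map); rewrite (linear_sum_fun _ _ _ vac_map_linear).
rewrite (linear0_fun vac_map_linear) => e i si.
have := congr1 (@tcoeff K I A i) e.
rewrite (linear_sum_fun _ _ _ (@tcoeff_linear K I A i)).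
rewrite (linear0_fun (@tcoeff_linear K I A i)) (bigD1_seq i) //=.
rewrite vac_map_zeta tcoeff_basis eqxx big1 ?addr0 // => j /negbTE ji.
by rewrite vac_map_zeta tcoeff_basis ji.
Qed.

(** Independence of the single monomial 1. *)
Lemma iota_injective : injective iota.
Proof.
move=> a b ab; apply/eqP; rewrite -subr_eq0; apply/eqP.
apply: (@zeta_independent [:: i0] (fun=> a - b)) (mem_head _ _) => //.
by rewrite big_seq1 raddfB /= ab subrr mulr0.
Qed.

Section Projection.
Variable D : I -> bool.
Local Notation proj_vec := (@proj_vec K I D).
Local Notation proj_vec_linear := (@proj_vec_linear K I D).

Definition proj_tensor : F ⊗ A -> F ⊗ A := tmap proj_vec idfun.

Lemma proj_tensor_linear : linear proj_tensor.
Proof. by apply: tmap_linear => //; exact: proj_vec_linear. Qed.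

Lemma proj_tensorE f c : proj_tensor (f ⊗ c) = proj_vec f ⊗ c.
Proof. exact: (tmapE proj_vec_linear (@linear_idfun K A)). Qed.

Definition degree_proj (z : B) : B := mul_map (proj_tensor (vac_map z)).

Lemma degree_proj_linear : linear degree_proj.
Proof.
exact: (linear_comp mul_map_linear (linear_comp proj_tensor_linear vac_map_linear)).
Qed.

Lemma degree_proj_zeta i c :
  degree_proj (zeta i * iota c) = if D i then zeta i * iota c else 0.
Proof.
rewrite /degree_proj vac_map_zeta proj_tensorE proj_vec_basis.
case: ifP => _; first by rewrite mul_mapE vec_map_basis.
by rewrite tpure0l (linear0_fun mul_map_linear).
Qed.

Lemma zeta_span_all z : zeta_span xpredT z.
Proof.
rewrite -(vac_mapK z); elim/tensor_ind: (vac_map z) => [|d f c y IH].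
  by rewrite (linear0_fun mul_map_linear); exact: span0.
rewrite mul_map_linear; apply: spanD => //; apply: spanZ.
rewrite mul_mapE [f]malg_basisE (linear_sum_fun _ _ _ vec_lin) mulr_suml.
apply: span_sum => i _; rewrite (linearZ_fun vec_lin) vec_map_basis -scalerAl.
by apply: spanZ; exact: zeta_span_gen.
Qed.

Lemma degree_proj_span z : zeta_span D (degree_proj z).
Proof.
apply: (span_image degree_proj_linear) (zeta_span_all z) => {}z [i [c [_ ->]]].
rewrite degree_proj_zeta; case: ifP => Di; last exact: span0.
exact: zeta_span_gen.
Qed.

Lemma degree_proj_id z : zeta_span D z -> degree_proj z = z.
Proof.
apply: (span_ext degree_proj_linear (@linear_idfun K B)) => {}z [i [c [Di ->]]].
by rewrite degree_proj_zeta Di.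
Qed.

Lemma zeta_span_mulr c z : zeta_span D z -> zeta_span D (z * iota c).
Proof.
apply: (span_image (f := fun z => z * iota c) ((mul_bil B).1 (iota c))).
by move=> {}z [i [d [Di ->]]]; rewrite -mulrA -rmorphM; exact: zeta_span_gen.
Qed.

(* Commuting with the projection, unlike preserving its range, passes to inverses. *)
Hypothesis fock_proj : forall c f,
  fock (iota c) (proj_vec f) = proj_vec (fock (iota c) f).

Lemma proj_tensor_act c y :
  proj_tensor (fock_act (iota c) y) = fock_act (iota c) (proj_tensor y).
Proof.
rewrite !fock_act_iota -[in RHS](tmap_id (comul H c)).
have iapp_bil : bilinear_map (fun a => fock_app (iota a)).
  by split=> [f d a b|a]; [rewrite /= linearP fock_app_bil.1|exact: fock_app_bil.2].
have pl := proj_vec_linear.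
apply: tmap_tmap2 => //; [exact: mul_bil|exact: mul_bil|].
by move=> a f; rewrite /fock_app fock_proj.
Qed.

(** Left multiplication by A on B corresponds to its action on F ⊗ A, which commutes with the
    projection; the projection therefore fixes [iota c * z] as soon as it fixes z. *)
Lemma zeta_span_mull c z : zeta_span D z -> zeta_span D (iota c * z).
Proof.
move=> Dz; suff <- : degree_proj (iota c * z) = iota c * z by exact: degree_proj_span.
rewrite -[in RHS](degree_proj_id Dz) -mul_map_act -proj_tensor_act.
by rewrite -fock_actM.
Qed.
End Projection.
End FockIsomorphism.

Lemma ltn_ord_neq n (a b : 'I_n) : (a < b)%N -> (a == b = false) * (b == a = false).
Proof. by move=> ab; rewrite -!val_eqE /= ltn_eqF // gtn_eqF. Qed.

(** * Indices and weights of the ordered monomials *)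

Section FockIndices.
Variable N : nat.
Implicit Types (i : fidx N) (a b : 'I_N).

Definition fock0 : fidx N := (0, [ffun=> 0%N]).
Definition shift (n : int) i : fidx N := (i.1 + n, i.2).
Definition incr a i : fidx N := (i.1, [ffun b => (i.2 b + (b == a))%N]).
(** The subtraction is truncated, so an index with vanishing exponent at a is left unchanged.
    Operators built on [decr] are given the weight zero there. *)
Definition decr a i : fidx N := (i.1, [ffun b => (i.2 b - (b == a))%N]).

Lemma fidxP i (j : fidx N) : i.1 = j.1 -> (forall b, i.2 b = j.2 b) -> i = j.
Proof. by case: i j => [i f] [j g] /= -> fg; congr (_, _); apply/ffunP. Qed.

Lemma incrC a b i : incr a (incr b i) = incr b (incr a i).
Proof. by apply: fidxP => // c; rewrite !ffunE addnAC. Qed.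

Lemma decrC a b i : decr a (decr b i) = decr b (decr a i).
Proof. by apply: fidxP => // c; rewrite !ffunE -!subnDA addnC. Qed.

Lemma incr_decrC a b i : a != b -> incr a (decr b i) = decr b (incr a i).
Proof.
move=> ab; apply: fidxP => // c; rewrite !ffunE.
by have [->|_] := eqVneq c a; rewrite ?(negbTE ab) ?subn0 // !addn0.
Qed.

Lemma incrK a : cancel (incr a) (decr a).
Proof. by move=> i; apply: fidxP => // c; rewrite !ffunE addnK. Qed.

Lemma decrK a i : (0 < i.2 a)%N -> incr a (decr a i) = i.
Proof.
move=> a0; apply: fidxP => // c; rewrite !ffunE.
by have [->|_] := eqVneq c a; rewrite ?subn0 ?addn0 // subnK.
Qed.

Lemma incr_at a b i : (incr a i).2 b = (i.2 b + (b == a))%N.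
Proof. by rewrite ffunE. Qed.
Lemma decr_at a b i : (decr a i).2 b = (i.2 b - (b == a))%N.
Proof. by rewrite ffunE. Qed.

Lemma sum_incr a i : (\sum_b (incr a i).2 b = (\sum_b i.2 b).+1)%N.
Proof.
rewrite [LHS](bigD1 a) //= [in RHS](bigD1 a) //= incr_at eqxx addn1 addSn; congr (_ + _).+1.
by apply: eq_bigr => b /negbTE ba; rewrite incr_at ba addn0.
Qed.

Variable K : fieldType.
Definition weight (g : 'I_N -> K) i : K := \prod_b g b ^+ i.2 b.

Lemma weight_incr g a i : weight g (incr a i) = g a * weight g i.
Proof.
rewrite /weight [LHS](bigD1 a) //= [in RHS](bigD1 a) //= incr_at eqxx addn1 exprS -mulrA.
congr (_ * (_ * _)); apply: eq_bigr => b /negbTE ba; by rewrite incr_at ba addn0.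
Qed.

Lemma weight_decr g a i : (0 < i.2 a)%N -> weight g i = g a * weight g (decr a i).
Proof. by move=> a0; rewrite -{1}(decrK a0) weight_incr. Qed.

Lemma weight_shift g n i : weight g (shift n i) = weight g i.
Proof. by []. Qed.

Lemma weight0 g : weight g fock0 = 1.
Proof. by rewrite /weight big1 // => b _; rewrite ffunE. Qed.

Lemma weight_neq0 g i : (forall a, g a != 0) -> weight g i != 0.
Proof. by move=> g0; apply/prodf_neq0 => a _; rewrite expf_neq0. Qed.
End FockIndices.

(** Every ordered monomial arises from 1 by left multiplications, first by u or its inverse and then
    by the x^a. *)
Lemma fidx_ind N (P : fidx N -> Prop) : P (fock0 N) ->
  (forall i, P i -> P (shift 1 i)) -> (forall i, P i -> P (shift (-1) i)) ->
  (forall a i, P i -> P (incr a i)) -> forall i, P i.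
Proof.
move=> P0 Pp Pm Pi i.
have [m le_m] := ubnP (\sum_a i.2 a); elim: m i le_m => // m IH i le_m.
have [[a a0]|n0] := pselect (exists a, (0 < i.2 a)%N).
  rewrite -(decrK a0); apply: Pi; apply: IH.
  by move: le_m; rewrite -{1}(decrK a0) sum_incr ltnS.
have -> : i = shift i.1 (fock0 N).
  apply: fidxP => [|b]; first by rewrite /= add0r.
  rewrite ffunE; apply/eqP; rewrite -leqn0 leqNgt; apply/negP => b0.
  by apply: n0; exists b.
elim/int_rect: i.1 => [|n IHn|n IHn].
- by rewrite /shift addr0.
- have -> : shift n.+1 (fock0 N) = shift 1 (shift n (fock0 N)); last exact: Pp.
  by apply: fidxP => //=; rewrite -addn1 PoszD addrA.
have -> : shift (- n.+1%:Z) (fock0 N) = shift (-1) (shift (- n%:Z) (fock0 N)); last exact: Pm.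
by apply: fidxP => //=; rewrite -addn1 PoszD opprD addrA.
Qed.

Section WeightedShift.
Variables (K : fieldType) (I : choiceType) (i0 : I).
Local Notation E := (lend_alg (basis_neq0 K i0)).

Definition wshift (w : I -> K) (f : I -> I) : E :=
  mk_lend (linext_linear (fun i => w i *: basis K (f i))).

Lemma wshift_basis w f i : wshift w f (basis K i) = w i *: basis K (f i).
Proof. exact: linext_basis. Qed.

Lemma wshiftM_basis w f w' f' i :
  (wshift w f * wshift w' f' : E) (basis K i) = (w' i * w (f' i)) *: basis K (f (f' i)).
Proof.
by rewrite lappM wshift_basis lapp_scale wshift_basis scalerA.
Qed.

Lemma lend_basis_ext (g h : E) : (forall i, g (basis K i) = h (basis K i)) -> g = h.
Proof. by move=> gh; apply: lendP; apply: linear_basis_ext => //; exact: lapp_linear. Qed.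

Lemma wshift_exch w f w' f' c : (forall i, f (f' i) = f' (f i)) ->
  (forall i, w' i * w (f' i) = c * (w i * w' (f i))) ->
  wshift w f * wshift w' f' = c *: (wshift w' f' * wshift w f).
Proof.
move=> ff ww; apply: lend_basis_ext => i.
by rewrite lappZ !wshiftM_basis ff scalerA -ww.
Qed.
(** Where the weight w vanishes the first term on the right is zero and [f' (f i)] need not be i.
    This exception is needed because [decr] is truncated. *)
Lemma wshift_exch_sub w f w' f' w'' c d : (forall i, f (f' i) = i) ->
  (forall i, if w i == 0 then w' i * w (f' i) = - (d * w'' i) else
     f' (f i) = i /\ w' i * w (f' i) = c * (w i * w' (f i)) - d * w'' i) ->
  wshift w f * wshift w' f' = c *: (wshift w' f' * wshift w f) - d *: wshift w'' id.
Proof.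
move=> ff ww; apply: lend_basis_ext => i.
rewrite -scaleNr lappD !lappZ !wshiftM_basis wshift_basis ff.
have := ww i; case: eqP => [->|_ [-> ->]].
  by move=> ->; rewrite mul0r scale0r scaler0 add0r scalerA mulNr.
by rewrite !scalerA -scalerDl mulNr.
Qed.

Lemma wshift_kill w f w' f' i : w i = 0 ->
  (wshift w' f' * wshift w f : E) (basis K i) = 0.
Proof. by move=> w0; rewrite wshiftM_basis w0 mul0r scale0r. Qed.

Lemma wshift_proj (D : I -> bool) w f i : (w i != 0 -> D (f i) = D i) ->
  wshift w f (proj_vec D (basis K i)) = proj_vec D (wshift w f (basis K i)).
Proof.
have prl := @proj_vec_linear K _ D.
move=> Df; rewrite wshift_basis (linearZ_fun prl) !proj_vec_basis.
have [w0|/Df->] := eqVneq (w i) 0; last first.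
  by case: ifP => _; rewrite ?wshift_basis // scaler0 (linear0_fun (lapp_linear _)).
rewrite w0 scale0r; case: ifP => _; first by rewrite wshift_basis w0 scale0r.
by rewrite (linear0_fun (lapp_linear _)).
Qed.

Lemma wshiftM w f w' f' :
  wshift w f * wshift w' f' = wshift (fun i => w' i * w (f' i)) (f \o f').
Proof. by apply: lend_basis_ext => i; rewrite wshiftM_basis wshift_basis. Qed.

Lemma wshift1 w f : (forall i, w i = 1) -> (forall i, f i = i) -> wshift w f = 1.
Proof.
by move=> w1 f1; apply: lend_basis_ext => i; rewrite wshift_basis w1 f1 scale1r lapp1.
Qed.

Lemma wshift_inverse w f v g : (forall i, f (g i) = i) -> (forall i, g (f i) = i) ->
  (forall i, v i != 0) -> (forall i, v (f i) = v i) -> (forall i, w i = (v i)^-1) ->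
  (wshift (fun=> 1) f * wshift v id) * wshift w g = 1 /\
  wshift w g * (wshift (fun=> 1) f * wshift v id) = 1.
Proof.
move=> fg gf v0 vf wv; rewrite !wshiftM; split; apply: wshift1 => i //=.
  by rewrite mulr1 wv -[in v (g i)]vf fg mulVf.
by rewrite mulr1 wv vf divff.
Qed.

Lemma wshift_prod (J : Type) (t : seq J) (w : J -> I -> K) :
  \prod_(j <- t) wshift (w j) id = wshift (fun i => \prod_(j <- t) w j i) id.
Proof.
elim: t => [|j t IH].
  by rewrite big_nil wshift1 // => i; rewrite big_nil.
rewrite big_cons IH wshiftM; apply: lend_basis_ext => i.
by rewrite !wshift_basis big_cons mulrC.
Qed.
End WeightedShift.

(** * The q-oscillators as weighted shifts *)

Section Fock.
Variables (K : fieldType) (N : nat) (r s : K) (R : 'I_N -> 'I_N -> K).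
Hypothesis r_neq0 : r != 0.
Hypothesis s_neq0 : 'I_N -> s != 0.
Hypothesis R_neq0 : forall a b, R a b != 0.
Hypothesis RV : forall a b : 'I_N, (a < b)%N -> R b a = (R a b)^-1.
Hypothesis RD : forall a, R a a = r.

Local Notation E := (lend_alg (basis_neq0 K (fock0 N))).
Local Notation op := (@wshift K (fidx N) (fock0 N)).
Implicit Types (a b c d : 'I_N) (i : fidx N).

(** The factor for moving x^a past one x^b on the way to its place in the ordered monomial; letters
    b >= a need not be passed. *)
Definition xweight a b : K := if (b < a)%N then R b a / r else 1.
Definition kweight a b : K := s / R a b.
(** For a < b the factor is not the s / r of [Ex_gt]: lowering the exponent of x^a also takes away
    the factor R a b / r with which x^b used to pass it, and s / r divided by R a b / r is s / R a
    b. *)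
Definition Eweight a b : K :=
  if (b < a)%N then s * r else if (a < b)%N then s / R a b else 1.
(* [E_d (x^d)^n = Enum n (x^d)^(n-1) K_d] on vectors killed by [E_d]. *)
Definition Enum (n : nat) : K := - s ^+ n * (r ^+ n - r^-1 ^+ n).

(** The coefficients are those of left multiplication by x^a on the ordered monomials, found again
    in [x_monomial]; the power of r s comes from passing the power of u. *)
Definition fock_x a : E := op (fun i => (r * s)^-1 ^ i.1 * weight (xweight a) i) (incr a).
Definition fock_k a : E := op (weight (kweight a)) id.
Definition fock_E a : E :=
  op (fun i => (r * s) ^ i.1 * weight (Eweight a) i * Enum (i.2 a)) (decr a).
Definition fock_u : E := op (fun=> 1) (shift 1).

Lemma Enum0 : Enum 0 = 0.
Proof. by rewrite /Enum !expr0 subrr mulr0. Qed.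

(** This is [Ex_eq] applied to (x^d)^n, where k_d passes each x^d with the factor s / r. Together
    with [Enum0] the recursion determines [Enum]. *)
Lemma EnumS n : Enum n.+1 = s * r * Enum n - s * lam r * (s / r) ^+ n.
Proof.
rewrite /Enum /lam !exprMn !exprS; move: (s ^+ n) (r ^+ n) (r^-1 ^+ n) => S P Q.
by field.
Qed.

Lemma fock_xx a b : (b < a)%N -> fock_x a * fock_x b = (R b a / r) *: (fock_x b * fock_x a).
Proof.
move=> ba; apply: wshift_exch => [i|i]; first by rewrite incrC.
rewrite !weight_incr /xweight ba ltnNge (ltnW ba) /=; ring.
Qed.

Lemma fock_kx a b : fock_k b * fock_x a = (s / R b a) *: (fock_x a * fock_k b).
Proof. by apply: wshift_exch => // i; rewrite weight_incr /kweight; ring. Qed.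

Lemma fock_Ex_lt a d : (a < d)%N -> fock_E d * fock_x a = (s * r) *: (fock_x a * fock_E d).
Proof.
move=> ad; have [e1 e2] := ltn_ord_neq ad.
apply: wshift_exch => [i|i] /=; first by rewrite incr_decrC ?e1.
rewrite weight_incr incr_at e2 addn0.
(* At exponent zero [decr] is truncated, but both sides vanish with [Enum 0]. *)
case: (posnP (i.2 d)) => [->|d0]; first by rewrite Enum0; ring.
rewrite (weight_decr (xweight a) d0) /Eweight /xweight ad ltnNge (ltnW ad) /=; ring.
Qed.

Lemma fock_Ex_gt a d : (d < a)%N -> fock_E d * fock_x a = (s / r) *: (fock_x a * fock_E d).
Proof.
move=> da; have [e1 e2] := ltn_ord_neq da.
apply: wshift_exch => [i|i] /=; first by rewrite incr_decrC ?e2.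
rewrite weight_incr incr_at e1 addn0.
case: (posnP (i.2 d)) => [->|d0]; first by rewrite Enum0; ring.
rewrite (weight_decr (xweight a) d0) /Eweight /xweight da ltnNge (ltnW da) /=.
by field; rewrite r_neq0 R_neq0.
Qed.

Lemma fock_kE b d : fock_k b * fock_E d = (R b d / s) *: (fock_E d * fock_k b).
Proof.
apply: wshift_exch => // i /=.
case: (posnP (i.2 d)) => [->|d0]; first by rewrite Enum0; ring.
rewrite (weight_decr (kweight b) d0) /kweight.
by field; rewrite R_neq0 s_neq0.
Qed.

Lemma fock_EE c d : (c < d)%N -> fock_E c * fock_E d = (r * R c d) *: (fock_E d * fock_E c).
Proof.
move=> cd; have [e1 e2] := ltn_ord_neq cd.
apply: wshift_exch => [i|i] /=; first by rewrite decrC.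
rewrite !decr_at e1 e2 !subn0.
case: (posnP (i.2 d)) => [->|d0]; first by rewrite Enum0; ring.
case: (posnP (i.2 c)) => [->|c0]; first by rewrite Enum0; ring.
rewrite (weight_decr (Eweight d) c0) (weight_decr (Eweight c) d0) /Eweight.
rewrite cd ltnNge (ltnW cd) /=.
by field; rewrite R_neq0.
Qed.

Lemma fock_kk a b : fock_k a * fock_k b = fock_k b * fock_k a.
Proof. by rewrite -[RHS]scale1r; apply: wshift_exch => // i; ring. Qed.

Lemma fock_ku a : fock_k a * fock_u = fock_u * fock_k a.
Proof. by rewrite -[RHS]scale1r; apply: wshift_exch => // i; rewrite weight_shift; ring. Qed.

Lemma rs_neq0 a : r * s != 0.
Proof. by rewrite mulf_neq0 ?s_neq0. Qed.

Lemma fock_xu a : fock_x a * fock_u = (r * s)^-1 *: (fock_u * fock_x a).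
Proof.
apply: wshift_exch => // i; rewrite weight_shift /= expfzDr ?invr_eq0 ?rs_neq0 //.
by rewrite expr1z; ring.
Qed.

Lemma fock_Eu a : fock_E a * fock_u = (r * s) *: (fock_u * fock_E a).
Proof.
apply: wshift_exch => // i; rewrite weight_shift /= expfzDr ?rs_neq0 //.
by rewrite expr1z; ring.
Qed.

Lemma xweight_diag d : xweight d d = 1.
Proof. by rewrite /xweight ltnn. Qed.

Lemma Eweight_diag d : Eweight d d = 1.
Proof. by rewrite /Eweight ltnn. Qed.

(** The weights of x^d and E_d combine with the last term of [EnumS] to the weight of k_d, so that
    the correction in [Ex_eq] is a multiple of k_d. *)
Lemma weight_xEk d i :
  weight (xweight d) i * weight (Eweight d) i * (s / r) ^+ i.2 d = weight (kweight d) i.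
Proof.
rewrite /weight -big_split [RHS](bigD1 d) //= [in LHS](bigD1 d) //= /kweight RD.
rewrite -exprMn /xweight /Eweight ltnn mulr1 expr1n mul1r mulrC; congr (_ * _).
apply: eq_bigr => b bd; rewrite -exprMn; congr (_ ^+ _).
have [bd'|db|/val_inj e] := ltngtP b d; last by rewrite e eqxx in bd.
  by rewrite (RV bd') invrK; field.
by rewrite mul1r.
Qed.

Lemma fock_Ex_eq d :
  fock_E d * fock_x d = (s * r) *: (fock_x d * fock_E d) - (s * lam r) *: fock_k d.
Proof.
apply: wshift_exch_sub => [i|i]; first exact: incrK.
rewrite weight_incr incr_at eqxx addn1 EnumS /= -weight_xEk Eweight_diag !mul1r.
(* For passing the power of u, x^d and E_d carry opposite powers of r s, which cancel. *)
have V : (r * s)^-1 ^ i.1 * (r * s) ^ i.1 = 1.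
  by rewrite -expfzMl mulVf ?exp1rz ?(rs_neq0 d).
move: ((r * s)^-1 ^ i.1) ((r * s) ^ i.1) V => P Q PQ.
have e x y z : P * x * (Q * y * z) = x * y * z.
  by rewrite -[RHS]mul1r -PQ; ring.
rewrite !e; case: (posnP (i.2 d)) => [->|d0].
  by rewrite Enum0 mulr0 eqxx mulr0 sub0r expr0 !mulr1 mulrN mulrC.
have e' : weight (xweight d) i * weight (Eweight d) i *
    (s * r * Enum (i.2 d) - s * lam r * (s / r) ^+ i.2 d) =
  s * r * (Q * weight (Eweight d) i * Enum (i.2 d) * (P * weight (xweight d) (decr d i))) -
  s * lam r * (weight (xweight d) i * weight (Eweight d) i * (s / r) ^+ i.2 d).
  rewrite (weight_decr (xweight d) d0) xweight_diag !mul1r.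
  move: (weight (xweight d) _) (weight (Eweight d) _) (Enum _) ((s / r) ^+ _) (lam r) => x y z w L.
  have -> : Q * y * z * (P * x) = x * y * z by rewrite -[RHS]e; ring.
  ring.
(* The weight of E_d can vanish at a positive exponent n too, namely when r^(2n) = 1; the relation
   then reduces to its correction term. *)
case: eqP => [Z|_]; last by split; [exact: decrK|exact: e'].
rewrite e' Z; ring.
Qed.

Definition fock_det_inv : E :=
  op (fun i => (\prod_a weight (kweight a) i)^-1) (shift (-1)).

Lemma fock_det : (fock_u * \prod_a fock_k a) * fock_det_inv = 1 /\
  fock_det_inv * (fock_u * \prod_a fock_k a) = 1.
Proof.
have p0 i : \prod_a weight (kweight a) i != 0.
  apply/prodf_neq0 => a _; apply: weight_neq0 => b.
  by rewrite mulf_neq0 ?invr_neq0 ?s_neq0.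
have pS n i : \prod_a weight (kweight a) (shift n i) = \prod_a weight (kweight a) i by [].
have sh m n i : shift m (shift n i) = shift (n + m) i by rewrite /shift /= addrA.
have s0 i : shift 0 i = i by case: i => ? ?; rewrite /shift addr0.
have -> : \prod_a fock_k a = op (fun i => \prod_a weight (kweight a) i) id.
  exact: (wshift_prod _ _ (fun a => weight (kweight a))).
by apply: wshift_inverse => // i; rewrite sh ?addNr ?addrN s0.
Qed.
End Fock.

Section FockRepresentation.
Variables (K : fieldType) (N : nat) (r q0 : K) (q : 'I_N.+1 -> 'I_N.+1 -> K).
Hypothesis r_neq0 : r != 0.
Hypothesis q_neq0 : forall A B, q A B != 0.
Hypothesis qV : forall A B, q A B = r ^+ 2 / q B A.
Hypothesis q_diag : forall A, q A A = r.
Hypothesis q_const : forall a : 'I_N, q (lift ord0 a) ord0 = q0.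
Local Notation rl := (rho r (qlow q)).
Local Notation s := (mixed_coef r q0).

Let Rn a b : rl a b != 0.
Proof. exact: (rho_neq0 r_neq0 (qlow_neq0 q_neq0) (qlow_diag q_diag) a b). Qed.
Let RV (a b : 'I_N) : (a < b)%N -> rl b a = (rl a b)^-1.
Proof. by move=> ab; exact: (rhoV r_neq0 (qlow_neq0 q_neq0) (qlowV qV) (ord_neq ab)). Qed.
Let RD a : rl a a = r. Proof. exact: (rho_diag r_neq0 (qlow_diag q_diag) a). Qed.
Let s0 (a : 'I_N) : s != 0. Proof. exact: (mixed_coef_neq0 r_neq0 q_neq0 q_diag q_const a). Qed.

Definition fock_mx := osc_full (fock_x r s rl) (fock_E r s rl) (fock_k s rl) (fock_u K N).

Lemma fock_mx_RTT A B C D : RTT r q fock_mx A B C D = 0.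
Proof.
apply: (osc_full_RTT r_neq0 q_neq0 qV q_diag q_const).
- exact: fock_xx.
- exact: fock_kx.
- exact: fock_Ex_lt.
- exact: fock_Ex_gt.
- exact: fock_Ex_eq.
- exact: fock_EE.
- exact: fock_kE.
- exact: fock_kk.
- exact: fock_xu.
- exact: fock_Eu.
- exact: fock_ku.
Qed.

Lemma fock_mx_det : exists xi, qdet r q fock_mx * xi = 1 /\ xi * qdet r q fock_mx = 1.
Proof.
exists (fock_det_inv s rl); rewrite (osc_full_det r q).
exact: fock_det.
Qed.
Local Notation E := (lend_alg (basis_neq0 K (fock0 N))).
Local Notation l := (lift ord0).
Local Notation delta := (basis K).

Definition fock_weight a (i : fidx N) : K := (r * s)^-1 ^ i.1 * weight (xweight r rl a) i.

Lemma fock_weight_neq0 a i : fock_weight a i != 0.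
Proof.
apply: mulf_neq0; first by rewrite expfz_neq0 // invr_eq0 mulf_neq0 ?(s0 a).
apply: weight_neq0 => b.
by rewrite /xweight; case: ifP => _; rewrite ?oner_eq0 // mulf_neq0 ?invr_neq0.
Qed.

Lemma fock_mx_u i : fock_mx ord0 ord0 (delta i) = delta (shift 1 i).
Proof. by rewrite /fock_mx osc_fullE wshift_basis scale1r. Qed.

Lemma fock_mx_x a i : fock_mx (l a) ord0 (delta i) = fock_weight a i *: delta (incr a i).
Proof. by rewrite /fock_mx osc_fullE wshift_basis. Qed.

(** Entries above the diagonal are zero, those below end in an E, which kills the vacuum by [Enum0],
    and each k has weight 1 on the vacuum. *)
Lemma fock_mx_vac a b :
  fock_mx (l a) (l b) (delta (fock0 N)) = (a == b)%:R *: delta (fock0 N).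
Proof.
rewrite /fock_mx osc_fullE; have [ab|ba|/val_inj<-] := ltngtP a b.
- by rewrite osc0 // (ltn_ord_neq ab) scale0r.
- rewrite oscE // (ltn_ord_neq ba) scale0r; apply: wshift_kill.
  by rewrite ffunE Enum0 mulr0.
by rewrite osck eqxx [LHS]wshift_basis weight0.
Qed.

(** A diagonal entry keeps the index, and x^a E_b moves one unit of exponent from b to a. Where the
    exponent at b is zero the weight vanishes, so only genuine moves have to respect D. *)
Lemma fock_mx_proj (D : fidx N -> bool) a b i :
  (forall (c d : 'I_N) (j : fidx N), (0 < j.2 d)%N -> D (incr c (decr d j)) = D j) ->
  fock_mx (l a) (l b) (proj_vec D (delta i)) = proj_vec D (fock_mx (l a) (l b) (delta i)).
Proof.
move=> D_move; have prl := @proj_vec_linear K _ D.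
rewrite /fock_mx osc_fullE; have [ab|ba|/val_inj<-] := ltngtP a b.
- by rewrite osc0 // !lapp0 (linear0_fun prl).
- rewrite (oscE _ _ _ ba) (_ : _ * _ = wshift (fock0 N) (fun i => (r * s) ^ i.1
    * weight (Eweight r s rl b) i * Enum r s (i.2 b) * fock_weight a (decr b i))
    (incr a \o decr b)); last exact: wshiftM.
  apply: wshift_proj; rewrite mulf_eq0 => /norP[w0 _]; move: w0.
  rewrite mulf_eq0 => /norP[_ w0].
  by apply: D_move; rewrite lt0n; apply: contraNneq w0 => ->; rewrite Enum0.
by rewrite osck; exact: wshift_proj.
Qed.
End FockRepresentation.

(** * Ordered monomials *)

Section Monomials.
Variables (K : fieldType) (N : nat) (r s : K) (R : 'I_N -> 'I_N -> K) (B : unitAlgType K).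
Variables (u : B) (x : 'I_N -> B).
Hypothesis rs_neq0 : 'I_N -> r * s != 0.
Hypothesis u_unit : u \is a GRing.unit.
Hypothesis xx : forall a b : 'I_N, (b < a)%N -> x a * x b = (R b a / r) *: (x b * x a).
Hypothesis xu : forall a, x a * u = (r * s)^-1 *: (u * x a).

Definition monomial (i : fidx N) : B := u ^ i.1 * \prod_(a < N) x a ^+ i.2 a.

Lemma monomial0 : monomial (fock0 N) = 1.
Proof. by rewrite /monomial expr0z mul1r big1 // => a _; rewrite ffunE. Qed.

Lemma monomial_shift n i : monomial (shift n i) = u ^ n * monomial i.
Proof. by rewrite /monomial mulrA -exprzDr // addrC. Qed.

Lemma x_expu a (n : int) : x a * u ^ n = (r * s)^-1 ^ n *: (u ^ n * x a).
Proof.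
have c0 := rs_neq0 a; elim/int_rect: n => [|n IH|n IH].
- by rewrite !expr0z scale1r mul1r mulr1.
- rewrite -!exprnP in IH *; rewrite !exprS mulrA xu -scalerAl -[u * x a * _]mulrA IH.
  by rewrite -scalerAr scalerA !mulrA.
rewrite -addn1 PoszD opprD !(exprzDr u_unit) mulrA IH expfzDr ?invr_eq0 // !exprN1 invrK.
rewrite -!scalerAl -scalerA -!mulrA; congr (_ *: _).
have -> : x a / u = (r * s) *: (u^-1 * x a).
  rewrite -[x a / u]mul1r -(mulVr u_unit) -!mulrA [u * _]mulrA.
  rewrite (_ : u * x a = (r * s) *: (x a * u)); last by rewrite xu scalerA divff // scale1r.
  by rewrite -scalerAl -!scalerAr mulrK.
by rewrite -scalerAr.
Qed.

Lemma x_exp_comm (a b : 'I_N) m :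
  (b < a)%N -> x a * x b ^+ m = (R b a / r) ^+ m *: (x b ^+ m * x a).
Proof.
move=> ba; elim: m => [|m IH]; first by rewrite !expr0 scale1r mul1r mulr1.
by rewrite !exprS mulrA xx // -scalerAl -[x b * x a * _]mulrA IH -scalerAr scalerA !mulrA.
Qed.

(** A sorted list of letters replaces the full range so that induction applies: x^a passes the
    smaller letters at the head and is absorbed when its own letter comes first; the larger ones
    have weight 1. *)
Lemma x_word a (l : seq 'I_N) (f : 'I_N -> nat) : sorted ltn (map val l) -> a \in l ->
  x a * \prod_(b <- l) x b ^+ f b =
  (\prod_(b <- l) xweight r R a b ^+ f b) *: \prod_(b <- l) x b ^+ (f b + (b == a)).
Proof.
elim: l => // b l IH /=; rewrite (path_sortedE ltn_trans) => /andP[/allP lb sl].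
rewrite inE !big_cons; have [e _|ab /= al] := eqVneq a b.
  subst b.
  have lt c : c \in l -> (a < c)%N by move=> cl; apply: lb; exact: map_f.
  have -> : \prod_(c <- l) xweight r R a c ^+ f c = 1.
    rewrite big_seq big1 // => c /lt ac.
    by rewrite /xweight ltnNge (ltnW ac) /= expr1n.
  rewrite /xweight ltnn expr1n mulr1 scale1r addn1 exprS mulrA; congr (_ * _).
  apply: eq_big_seq => c /lt ac.
  by rewrite -val_eqE /= (gtn_eqF ac) addn0.
have ba : (b < a)%N by apply: lb; exact: map_f.
rewrite {1}/xweight ba addn0 mulrA x_exp_comm // -scalerAl -mulrA IH // -scalerAr scalerA.
by [].
Qed.

Lemma x_monomial a i :
  x a * monomial i = ((r * s)^-1 ^ i.1 * weight (xweight r R a) i) *: monomial (incr a i).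
Proof.
rewrite /monomial mulrA x_expu -scalerAl -mulrA x_word ?mem_index_enum //; last first.
  by rewrite /index_enum unlock -enumT val_enum_ord iota_ltn_sorted.
rewrite -scalerAr scalerA; congr (_ *: (_ * _)); apply: eq_bigr => b _.
by rewrite ffunE.
Qed.

Lemma word_monomial (w : seq 'I_N) : exists c (j : fidx N),
  [/\ \prod_(a <- w) x a = c *: monomial j, j.1 = 0 & (\sum_b j.2 b)%N = size w].
Proof.
elim: w => [|a w [c [j [e j0 js]]]].
  exists 1, (fock0 N); rewrite big_nil monomial0 scale1r; split=> //.
  by rewrite big1 // => b _; rewrite ffunE.
exists (c * ((r * s)^-1 ^ j.1 * weight (xweight r R a) j)), (incr a j).
split=> //; last by rewrite sum_incr js.
by rewrite big_cons e -scalerAr x_monomial scalerA.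
Qed.

Lemma monomial_word (i : fidx N) : exists2 w : seq 'I_N,
  size w = (\sum_b i.2 b)%N & monomial i = u ^ i.1 * \prod_(a <- w) x a.
Proof.
exists (flatten [seq nseq (i.2 a) a | a <- index_enum 'I_N]).
  rewrite size_flatten /shape -map_comp sumnE big_map; apply: eq_bigr => b _.
  by rewrite /= size_nseq.
rewrite /monomial big_flatten big_map; congr (_ * _); apply: eq_bigr => a _.
by rewrite big_nseq iter_mulr_1.
Qed.

Section Words.
Variables (A : algType K) (iota : {lrmorphism A -> B}) (h : int) (n : nat).

(** The homogeneous component is defined with all words of length n. As the x^a commute up to
    scalars, each word is a multiple of one ordered monomial, and each ordered monomial comes from a
    word. *)
Lemma words_span z :
  (exists b : n.-tuple 'I_N -> A,
     z = \sum_(t : n.-tuple 'I_N) u ^ h * (\prod_(a <- t) x a) * iota (b t)) <->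
  zeta_span iota monomial (fun i : fidx N => (i.1, \sum_b i.2 b)%N == (h, n)) z.
Proof.
split=> [[b ->]|].
  apply: span_sum => t _; have [c [j [-> j0 js]]] := word_monomial t.
  rewrite -scalerAr -scalerAl -monomial_shift; apply: spanZ; apply: zeta_span_gen.
  by rewrite /= j0 js size_tuple add0r.
elim=> [|c _ v [i [a [/eqP[ih ik] ->]]] _ [b ->]].
  by exists (fun=> 0); rewrite big1 // => t _; rewrite raddf0 mulr0.
have [w ws wE] := monomial_word i.
have wn : size w == n by rewrite ws ik.
pose t0 := Tuple wn.
(* The new coefficient goes to one tuple, the word that spells the ordered monomial. *)
exists (fun t => (if t == t0 then c *: a else 0) + b t).
under [RHS]eq_bigr => t _ do rewrite raddfD mulrDr.
rewrite big_split; congr (_ + _).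
rewrite (bigD1 t0) //= eqxx [X in _ + X]big1 => [|t /negbTE->]; last by rewrite raddf0 mulr0.
by rewrite addr0 linearZ -scalerAr wE ih.
Qed.
End Words.
End Monomials.

(** * Homogeneous components *)

Section SubBimodule.
Variables (K : fieldType) (A : algType K) (H : hopf_algebra A) (M : lmodType K).
Variable G : bicovariant_bimodule H M.
Variables (S : lmodType K) (g : {linear S -> M}) (R : {linear M -> S}).
Hypothesis gK : cancel g R.
Hypothesis lact_stable : forall a x, g (R (lact G a (g x))) = lact G a (g x).
Hypothesis ract_stable : forall x a, g (R (ract G (g x) a)) = ract G (g x) a.
Hypothesis coactl_stable : forall x,
  tmap idfun (g \o R) (coactl G (g x)) = coactl G (g x).
Hypothesis coactr_stable : forall x,
  tmap (g \o R) idfun (coactr G (g x)) = coactr G (g x).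

Let id_lin (V : lmodType K) : linear (@idfun V). Proof. by []. Qed.
Let g_lin : linear g. Proof. exact: linearP. Qed.
Let R_lin : linear R. Proof. exact: linearP. Qed.
Let D_lin : linear (comul H). Proof. exact: linearP. Qed.
Let dl_lin : linear (coactl G). Proof. exact: linearP. Qed.
Let dr_lin : linear (coactr G). Proof. exact: linearP. Qed.

(** The component is a retract of M: the left inverse R of g makes the tensor products of g with
    identities injective, so every law on S can be checked in M after applying g. *)
Definition sub_lact a x : S := R (lact G a (g x)).
Definition sub_ract x a : S := R (ract G (g x) a).
Definition sub_coactl_fun x : (A ⊗ S)%type := tmap idfun R (coactl G (g x)).
Definition sub_coactr_fun x : (S ⊗ A)%type := tmap R idfun (coactr G (g x)).

Fact sub_coactl_linear : linear sub_coactl_fun.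
Proof. exact: (linear_comp (tmap_linear (@id_lin A) R_lin) (linear_comp dl_lin g_lin)). Qed.
Fact sub_coactr_linear : linear sub_coactr_fun.
Proof. exact: (linear_comp (tmap_linear R_lin (@id_lin A)) (linear_comp dr_lin g_lin)). Qed.
HB.instance Definition _ :=
  GRing.isLinear.Build K S (A ⊗ S)%type *:%R sub_coactl_fun sub_coactl_linear.
HB.instance Definition _ :=
  GRing.isLinear.Build K S (S ⊗ A)%type *:%R sub_coactr_fun sub_coactr_linear.
Local Notation dl := sub_coactl_fun.
Local Notation dr := sub_coactr_fun.

Lemma sub_lactE a x : g (sub_lact a x) = lact G a (g x). Proof. exact: lact_stable. Qed.
Lemma sub_ractE x a : g (sub_ract x a) = ract G (g x) a. Proof. exact: ract_stable. Qed.

Lemma sub_coactlE x : tmap idfun g (dl x) = coactl G (g x).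
Proof.
rewrite -[RHS]coactl_stable; exact: (tmap_comp (@id_lin A) R_lin (@id_lin A) g_lin).
Qed.

Lemma sub_coactrE x : tmap g idfun (dr x) = coactr G (g x).
Proof.
rewrite -[RHS]coactr_stable; exact: (tmap_comp R_lin (@id_lin A) g_lin (@id_lin A)).
Qed.

Lemma tmap_cancel (V W V' W' : lmodType K) (f : V -> W) (f' : W -> V) (h : V' -> W')
    (h' : W' -> V') : linear f -> linear f' -> linear h -> linear h' ->
  cancel f f' -> cancel h h' -> cancel (tmap f h) (tmap f' h').
Proof.
move=> fl fl' hl hl' fK hK z; rewrite -[RHS]tmap_id -[LHS]/((_ \o _) z) tmap_comp //.
by apply: eq_tmap.
Qed.

Let g_inj : injective g := can_inj gK.
Let idK (V : Type) : cancel (@idfun V) idfun. Proof. by []. Qed.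
Let gl_inj : injective (tmap (@idfun A) g) :=
  can_inj (tmap_cancel (@id_lin A) (@id_lin A) g_lin R_lin (@idK A) gK).
Let gr_inj : injective (tmap g (@idfun A)) :=
  can_inj (tmap_cancel g_lin R_lin (@id_lin A) (@id_lin A) gK (@idK A)).
Let gll_inj : injective (tmap (@idfun A) (tmap (@idfun A) g)) :=
  can_inj (tmap_cancel (@id_lin A) (@id_lin A) (tmap_linear (@id_lin A) g_lin)
    (tmap_linear (@id_lin A) R_lin) (@idK A)
    (tmap_cancel (@id_lin A) (@id_lin A) g_lin R_lin (@idK A) gK)).
Let glr_inj : injective (tmap (@idfun A) (tmap g (@idfun A))) :=
  can_inj (tmap_cancel (@id_lin A) (@id_lin A) (tmap_linear g_lin (@id_lin A))
    (tmap_linear R_lin (@id_lin A)) (@idK A)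
    (tmap_cancel g_lin R_lin (@id_lin A) (@id_lin A) gK (@idK A))).
Let grr_inj : injective (tmap g (tmap (@idfun A) (@idfun A))) :=
  can_inj (tmap_cancel g_lin R_lin (tmap_linear (@id_lin A) (@id_lin A))
    (tmap_linear (@id_lin A) (@id_lin A)) gK
    (tmap_cancel (@id_lin A) (@id_lin A) (@id_lin A) (@id_lin A) (@idK A) (@idK A))).

Fact sub_lact_bil : bilinear_map sub_lact.
Proof.
have [h1 h2] := lact_bil G; split=> [x c a b|a c x y]; rewrite /sub_lact.
  by rewrite h1 linearP.
by rewrite linearP h2 linearP.
Qed.

Fact sub_ract_bil : bilinear_map sub_ract.
Proof.
have [h1 h2] := ract_bil G; split=> [a c x y|x c a b]; rewrite /sub_ract.
  by rewrite linearP h1 linearP.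
by rewrite h2 linearP.
Qed.

Fact sub_lact1 x : sub_lact 1 x = x.
Proof. by rewrite /sub_lact lact1 gK. Qed.
Fact sub_lactM a b x : sub_lact (a * b) x = sub_lact a (sub_lact b x).
Proof. by apply: g_inj; rewrite !sub_lactE lactM. Qed.
Fact sub_ract1 x : sub_ract x 1 = x.
Proof. by rewrite /sub_ract ract1 gK. Qed.
Fact sub_ractM x a b : sub_ract x (a * b) = sub_ract (sub_ract x a) b.
Proof. by apply: g_inj; rewrite !sub_ractE ractM. Qed.
Fact sub_lractA a x b : sub_ract (sub_lact a x) b = sub_lact a (sub_ract x b).
Proof. by apply: g_inj; rewrite sub_ractE !sub_lactE sub_ractE lractA. Qed.

Fact sub_coactlA x : tassoc (tmap (comul H) idfun (dl x)) = tmap idfun dl (dl x).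
Proof.
have idl := tmap_linear (@id_lin A) (@id_lin A).
have gl := tmap_linear (@id_lin A) g_lin.
apply: gll_inj.
(* Both sides become the iterated coaction at [g x]; naturality of the associator and functoriality
   of [tmap] carry g outward. *)
transitivity (tmap idfun (coactl G) (coactl G (g x))).
  rewrite -coactlA -sub_coactlE.
  have e := tassoc_tmap (@id_lin A) (@id_lin A) g_lin.
  apply: (etrans (esym (e _))) => /=; congr tassoc.
  apply: (etrans (tmap_comp D_lin (@id_lin S) idl g_lin (dl x))).
  apply: (etrans _ (esym (tmap_comp (@id_lin A) g_lin D_lin (@id_lin M) (dl x)))).
  by apply: eq_tmap => // a /=; rewrite tmap_id.
rewrite -sub_coactlE.
apply: (etrans (tmap_comp (@id_lin A) g_lin (@id_lin A) dl_lin (dl x))).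
apply: (etrans _ (esym (tmap_comp (@id_lin A) sub_coactl_linear (@id_lin A) gl (dl x)))).
by apply: eq_tmap => // y /=; rewrite sub_coactlE.
Qed.

Fact sub_coactrA x : tassoc (tmap dr idfun (dr x)) = tmap idfun (comul H) (dr x).
Proof.
have idl := tmap_linear (@id_lin A) (@id_lin A).
have gl := tmap_linear g_lin (@id_lin A).
apply: grr_inj.
transitivity (tmap idfun (comul H) (coactr G (g x))).
  rewrite -coactrA -sub_coactrE.
  have e := tassoc_tmap g_lin (@id_lin A) (@id_lin A).
  apply: (etrans (esym (e _))) => /=; congr tassoc.
  apply: (etrans (tmap_comp sub_coactr_linear (@id_lin A) gl (@id_lin A) (dr x))).
  apply: (etrans _ (esym (tmap_comp g_lin (@id_lin A) dr_lin (@id_lin A) (dr x)))).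
  by apply: eq_tmap => // a /=; rewrite sub_coactrE.
rewrite -sub_coactrE.
apply: (etrans (tmap_comp g_lin (@id_lin A) (@id_lin M) D_lin (dr x))).
apply: (etrans _ (esym (tmap_comp (@id_lin S) D_lin g_lin idl (dr x)))).
by apply: eq_tmap => // y /=; rewrite tmap_id.
Qed.

Fact sub_coactlr x : tmap idfun dr (dl x) = tassoc (tmap dl idfun (dr x)).
Proof.
have glr := tmap_linear g_lin (@id_lin A).
have gl := tmap_linear (@id_lin A) g_lin.
apply: glr_inj.
transitivity (tmap idfun (coactr G) (coactl G (g x))).
  rewrite -sub_coactlE.
  apply: (etrans (tmap_comp (@id_lin A) sub_coactr_linear (@id_lin A) glr (dl x))).
  apply: (etrans _ (esym (tmap_comp (@id_lin A) g_lin (@id_lin A) dr_lin (dl x)))).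
  by apply: eq_tmap => // y /=; rewrite sub_coactrE.
rewrite coactlr -sub_coactrE; apply/esym.
have e := tassoc_tmap (@id_lin A) g_lin (@id_lin A).
apply: (etrans (esym (e _))) => /=; congr tassoc.
apply: (etrans (tmap_comp sub_coactl_linear (@id_lin A) gl (@id_lin A) (dr x))).
apply: (etrans _ (esym (tmap_comp g_lin (@id_lin A) dl_lin (@id_lin A) (dr x)))).
by apply: eq_tmap => // a /=; rewrite sub_coactlE.
Qed.

Let cl_bil (V : lmodType K) : bilinear_map (fun (a : A) (n : V) => (counit H a : K) *: n).
Proof.
split=> [m c a b|a c m n] /=; first by rewrite linearP scalerDl scalerA.
by rewrite scalerDr !scalerA mulrC.
Qed.
Let cr_bil (V : lmodType K) : bilinear_map (fun (n : V) (a : A) => (counit H a : K) *: n).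
Proof. by have [h1 h2] := cl_bil V; split. Qed.

Fact sub_coactl1 x : tlift (fun a n => (counit H a : K) *: n) (dl x) = x.
Proof.
apply: g_inj; rewrite -[RHS](coactl1 G) -sub_coactlE; move: (dl x).
apply: linear_tensor_ext => [||a n].
- exact: (linear_comp g_lin (tlift_linear (cl_bil S))).
- exact: (linear_comp (tlift_linear (cl_bil M)) (tmap_linear (@id_lin A) g_lin)).
by rewrite (tliftE (cl_bil S)) (tmapE (@id_lin A) g_lin) (tliftE (cl_bil M)) linearZ.
Qed.

Fact sub_coactr1 x : tlift (fun n a => (counit H a : K) *: n) (dr x) = x.
Proof.
apply: g_inj; rewrite -[RHS](coactr1 G) -sub_coactrE; move: (dr x).
apply: linear_tensor_ext => [||n a].
- exact: (linear_comp g_lin (tlift_linear (cr_bil S))).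
- exact: (linear_comp (tlift_linear (cr_bil M)) (tmap_linear g_lin (@id_lin A))).
by rewrite (tliftE (cr_bil S)) (tmapE g_lin (@id_lin A)) (tliftE (cr_bil M)) linearZ.
Qed.

Fact sub_coactlM a x b : dl (sub_ract (sub_lact a x) b) =
  tmap2 ( *%R) sub_ract (tmap2 ( *%R) sub_lact (comul H a) (dl x)) (comul H b).
Proof.
apply: gl_inj; rewrite sub_coactlE sub_ractE sub_lactE coactlM -sub_coactlE.
have mb := @mul_bil K A; have i := @id_lin A.
rewrite [RHS](tmap_tmap2 i g_lin i i i g_lin mb sub_ract_bil mb (ract_bil G)
   (fun _ _ => erefl) sub_ractE) tmap_id.
by rewrite (tmap_tmap2 i i i g_lin i g_lin mb sub_lact_bil mb (lact_bil G)
   (fun _ _ => erefl) sub_lactE) tmap_id.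
Qed.

Fact sub_coactrM a x b : dr (sub_ract (sub_lact a x) b) =
  tmap2 sub_ract ( *%R) (tmap2 sub_lact ( *%R) (comul H a) (dr x)) (comul H b).
Proof.
apply: gr_inj; rewrite sub_coactrE sub_ractE sub_lactE coactrM -sub_coactrE.
have mb := @mul_bil K A; have i := @id_lin A.
rewrite [RHS](tmap_tmap2 g_lin i i i g_lin i sub_ract_bil mb (ract_bil G) mb
   sub_ractE (fun _ _ => erefl)) tmap_id.
by rewrite (tmap_tmap2 i i g_lin i g_lin i sub_lact_bil mb (lact_bil G) mb
   sub_lactE (fun _ _ => erefl)) tmap_id.
Qed.

Definition sub_bimodule : bicovariant_bimodule H S :=
  @BicovariantBimodule K A H S sub_lact sub_ract dl dr sub_lact_bil sub_lact1 sub_lactM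
    sub_ract_bil sub_ract1 sub_ractM sub_lractA sub_coactlA sub_coactl1 sub_coactrA
    sub_coactr1 sub_coactlM sub_coactrM sub_coactlr.

Lemma sub_bimodule_morphism : bicovariant_morphism sub_bimodule G g.
Proof.
split; first exact: linearP.
- exact: sub_lactE.
- exact: sub_ractE.
- by move=> x; rewrite /= sub_coactlE.
- by move=> x; rewrite /= sub_coactrE.
Qed.
End SubBimodule.

(** * Straightening of T past the ordered monomials, and the grading *)

Section FockHypotheses.
Variables (K : fieldType) (N : nat) (r q0 : K) (q : 'I_N.+1 -> 'I_N.+1 -> K).
Hypothesis r_neq0 : r != 0.
Hypothesis q_neq0 : forall A B, q A B != 0.
Hypothesis qV : forall A B, q A B = r ^+ 2 / q B A.
Hypothesis q_diag : forall A, q A A = r.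
Hypothesis q_const : forall a : 'I_N, q (lift ord0 a) ord0 = q0.
Local Notation l := (lift ord0).
Local Notation rl := (rho r (qlow q)).
Local Notation s := (mixed_coef r q0).
Local Notation lam := (lam r).

Variables (A B : algType K) (H : hopf_algebra A) (iota : {lrmorphism A -> B}).
Variables (TA : 'I_N -> 'I_N -> A) (T : 'I_N.+1 -> 'I_N.+1 -> B).
Hypothesis A_ind : forall P : A -> Prop,
  alg_closed P -> (forall a b, P (TA a b)) -> forall z, P z.
Hypothesis counit_TA : forall a b, counit H (TA a b) = (a == b)%:R.
Hypothesis iotaT : forall a b, iota (TA a b) = T (l a) (l b).
Hypothesis T_RTT : forall a b c d, RTT r q T a b c d = 0.
Hypothesis T0 : forall a, T ord0 (l a) = 0.
Variable uV : B.
Hypotheses (TuV : T ord0 ord0 * uV = 1) (TVu : uV * T ord0 ord0 = 1).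
Variables (I : choiceType) (i0 : I).
Local Notation E := (lend_alg (basis_neq0 K i0)).
Local Notation delta := (basis K).
Variable fock : {lrmorphism B -> E}.
Variables (sh shN : I -> I) (inc : 'I_N -> I -> I) (xw : 'I_N -> I -> K).
Hypothesis fock_u : forall i, fock (T ord0 ord0) (delta i) = delta (sh i).
Hypothesis fock_x : forall a i, fock (T (l a) ord0) (delta i) = xw a i *: delta (inc a i).
Hypothesis fock_T_vac : forall a b,
  fock (T (l a) (l b)) (delta i0) = (a == b)%:R *: delta i0.
Hypothesis xw_neq0 : forall a i, xw a i != 0.
Hypothesis shK : cancel shN sh.
Hypothesis I_ind : forall P : I -> Prop, P i0 -> (forall i, P i -> P (sh i)) ->
  (forall i, P i -> P (shN i)) -> (forall a i, P i -> P (inc a i)) -> forall i, P i.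
Local Notation p := (diag_block TA).

Lemma fock_vacuum c : fock (iota c) (delta i0) = (counit H c : K) *: delta i0.
Proof.
move: c; apply: A_ind => [|a b]; last by rewrite iotaT counit_TA fock_T_vac.
split=> [|c x y xP yP|x y xP yP|x y xP xy yx].
- by rewrite (rmorph1 iota) (rmorph1 fock) (rmorph1 (counit H)) scale1r.
- rewrite (linearP iota) (linearP fock) (linearP (counit H)) lappD lappZ xP yP.
  by rewrite scalerDl scalerA.
- rewrite (rmorphM iota) (rmorphM fock) (rmorphM (counit H)) lappM yP lapp_scale xP.
  by rewrite scalerA mulrC.
have e : (counit H y : K) * (counit H x : K) = 1.
  by rewrite -(rmorphM (counit H)) yx (rmorph1 (counit H)).
have e2 : (counit H x : K) *: fock (iota y) (delta i0) = delta i0.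
  rewrite -lapp_scale -xP -lappM -(rmorphM fock) -(rmorphM iota) yx.
  by rewrite (rmorph1 iota) (rmorph1 fock).
transitivity ((counit H y * counit H x : K) *: fock (iota y) (delta i0)).
  by rewrite e scale1r.
by rewrite -scalerA e2.
Qed.

Variable zeta : I -> B.
Hypothesis zeta0 : zeta i0 = 1.
Hypothesis zeta_shift : forall i, T ord0 ord0 * zeta i = zeta (sh i).
Hypothesis zeta_incr : forall a i, T (l a) ord0 * zeta i = xw a i *: zeta (inc a i).
Local Notation Psi := (vec_map zeta).

Let fock_lin : linear fock. Proof. exact: linearP. Qed.
Let fockM z w y : fock (z * w) y = fock z (fock w y).
Proof. by rewrite (rmorphM fock). Qed.
Let Psi_lin : linear Psi. Proof. exact: linext_linear. Qed.
Let PsiE i : Psi (delta i) = zeta i. Proof. exact: linext_basis. Qed.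

Lemma zeta_shiftN i : uV * zeta i = zeta (shN i).
Proof. by rewrite -{1}(shK i) -zeta_shift mulrA TVu mul1r. Qed.

Lemma vec_map_u y : Psi (fock (T ord0 ord0) y) = T ord0 ord0 * Psi y.
Proof.
move: y; apply: linear_basis_ext => [||i].
- exact: (linear_comp Psi_lin (lapp_linear _)).
- exact: (linear_comp ((mul_bil B).2 _) Psi_lin).
by rewrite fock_u !PsiE zeta_shift.
Qed.

Lemma vec_map_x a y : Psi (fock (T (l a) ord0) y) = T (l a) ord0 * Psi y.
Proof.
move: y; apply: linear_basis_ext => [||i].
- exact: (linear_comp Psi_lin (lapp_linear _)).
- exact: (linear_comp ((mul_bil B).2 _) Psi_lin).
by rewrite fock_x (linearZ_fun Psi_lin) !PsiE zeta_incr.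
Qed.

Let Lx := RTT_Lx r_neq0 q_neq0 qV q_diag q_const T_RTT.
Let Lu := RTT_Lu r_neq0 q_neq0 qV q_diag q_const T0 T_RTT.

(** Stated for a vector, so that generators of B can be applied to it, and for all rows at once,
    since the rule for T and x mixes two rows. *)
Definition exchanges (y : {malg K[I]}) := forall a b,
  T (l a) (l b) * Psi y = \sum_c Psi (fock (T (l a) (l c)) y) * iota (TA c b).

Lemma exchanges_vac : exchanges (delta i0).
Proof.
move=> a b; rewrite PsiE zeta0 mulr1 (bigD1 a) //= fock_T_vac eqxx scale1r PsiE zeta0.
rewrite mul1r iotaT big1 ?addr0 // => c /negbTE ca.
by rewrite fock_T_vac eq_sym ca scale0r (linear0_fun Psi_lin) mul0r.
Qed.

Lemma exchanges_u y : exchanges y -> exchanges (fock (T ord0 ord0) y).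
Proof.
move=> Q a b; rewrite vec_map_u mulrA Lu -mulrA Q mulr_sumr; apply: eq_bigr => c _.
by rewrite -[in RHS]lappM -(rmorphM fock) Lu (rmorphM fock) lappM vec_map_u mulrA.
Qed.

Lemma vec_map_uV y : Psi (fock uV y) = uV * Psi y.
Proof.
rewrite -[LHS]mul1r -TVu -mulrA -vec_map_u -lappM -(rmorphM fock) TuV (rmorph1 fock).
by rewrite lapp1.
Qed.

Lemma uV_comm a b : T (l a) (l b) * uV = uV * T (l a) (l b).
Proof.
by rewrite -[LHS]mul1r -TVu -mulrA [T ord0 ord0 * _]mulrA -Lu -mulrA TuV mulr1.
Qed.

Lemma exchanges_uV y : exchanges y -> exchanges (fock uV y).
Proof.
move=> Q a b; rewrite vec_map_uV mulrA uV_comm -mulrA Q mulr_sumr; apply: eq_bigr => c _.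
by rewrite -[in RHS]lappM -(rmorphM fock) uV_comm (rmorphM fock) lappM vec_map_uV mulrA.
Qed.

(** The rule [Lx] is used twice: in B on the left-hand side, and through [fock] on the right-hand
    side. The hypothesis at the rows a and e then identifies the results. *)
Lemma exchanges_x e y : exchanges y -> exchanges (fock (T (l e) ord0) y).
Proof.
move=> Q a b; pose L c d := T (l c) (l d); pose x c := T (l c) ord0.
pose w : K := lam * ((a < e)%N%:R - 1).
transitivity (\sum_c s *: (rl e a *: (x e * (Psi (fock (L a c) y) * iota (TA c b)))
    + w *: (x a * (Psi (fock (L e c) y) * iota (TA c b))))).
  rewrite -scaler_sumr big_split -!scaler_sumr -!mulr_sumr -!Q vec_map_x mulrA Lx.
  by rewrite -scalerAl mulrDl -!scalerAl -!mulrA.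
apply: eq_bigr => c _.
rewrite -fockM Lx (linearZ_fun fock_lin) (linearD_fun fock_lin) !(linearZ_fun fock_lin).
rewrite lappZ lappD !lappZ !fockM !(linearZ_fun Psi_lin) (linearD_fun Psi_lin).
by rewrite !(linearZ_fun Psi_lin) !vec_map_x -scalerAl mulrDl -!scalerAl -!mulrA.
Qed.

Lemma exchanges_basis i : exchanges (delta i).
Proof.
move: i; apply: I_ind => [|i Q|i Q|a i Q].
- exact: exchanges_vac.
- by rewrite -fock_u; exact: exchanges_u.
- suff -> : delta (shN i) = fock uV (delta i) by exact: exchanges_uV.
  by rewrite -{2}(shK i) -fock_u -lappM -(rmorphM fock) TVu (rmorph1 fock) lapp1.
move: (exchanges_x a Q); rewrite fock_x => {}Q b c.
(* The operator x^a yields the next basis vector only up to a scalar, which is nonzero and can be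
   cancelled. *)
apply: (scalerI (xw_neq0 a i)); rewrite scalerAr -(linearZ_fun Psi_lin) Q scaler_sumr.
by apply: eq_bigr => d _; rewrite lapp_scale (linearZ_fun Psi_lin) scalerAl.
Qed.

Lemma exchange_basis a b i :
  T a b * zeta i = \sum_c Psi (fock (T a c) (delta i)) * iota (p c b).
Proof.
rewrite big_ord_recl; case: (unliftP ord0 b) => [b' ->|->].
  rewrite diag_blockE rmorph0 mulr0 add0r.
  case: (unliftP ord0 a) => [a' ->|->].
    rewrite -PsiE exchanges_basis; apply: eq_bigr => c _.
    by rewrite diag_blockE.
  rewrite T0 mul0r big1 // => c _; rewrite T0 rmorph0 lapp0 (linear0_fun Psi_lin).
  by rewrite mul0r.
rewrite diag_blockE rmorph1 mulr1 big1 ?addr0 => [|c _]; last first.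
  by rewrite diag_blockE rmorph0 mulr0.
case: (unliftP ord0 a) => [a' ->|->]; first by rewrite vec_map_x PsiE.
by rewrite vec_map_u PsiE.
Qed.

Variable dR : {linear B -> (B ⊗ A)%type}.
Hypothesis dR_monoid : monoid_morphism dR.
Hypothesis dRT : forall a b, dR (T a b) = \sum_c T a c ⊗ p c b.
Local Notation act := (fock_act dR fock).

Lemma dR_u : dR (T ord0 ord0) = T ord0 ord0 ⊗ 1.
Proof.
rewrite dRT big_ord_recl diag_blockE big1 ?addr0 // => c _.
by rewrite diag_blockE tpure0r.
Qed.

Lemma dR_x a : dR (T (l a) ord0) = T (l a) ord0 ⊗ 1.
Proof.
rewrite dRT big_ord_recl diag_blockE big1 ?addr0 // => c _.
by rewrite diag_blockE tpure0r.
Qed.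

(** In particular u and the x^a, being right coinvariant, act on F alone; hence the monomials create
    the basis vectors of F from the vacuum. *)
Lemma act_primitive z f c : dR z = z ⊗ 1 -> act z (f ⊗ c) = fock z f ⊗ c.
Proof.
move=> dz; rewrite /fock_act dz.
by rewrite (tmap2E (fock_app_bil fock) (@mul_bil K A)) mul1r.
Qed.

Lemma zeta_act_vac i c : act (zeta i) (delta (i0) ⊗ c) = delta i ⊗ c.
Proof.
move: i c; apply: I_ind => [|i Q|i Q|a i Q] c.
- by rewrite zeta0 fock_act1.
- by rewrite -zeta_shift fock_actM // Q (act_primitive _ _ dR_u) fock_u.
- rewrite -zeta_shiftN fock_actM // Q -{1}(shK i) -fock_u.
  by rewrite -(act_primitive _ _ dR_u) -fock_actM // TVu fock_act1.
apply: (scalerI (xw_neq0 a i)).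
rewrite -tpureZl -fock_x -(act_primitive _ _ (dR_x a)) -Q -fock_actM // zeta_incr.
by rewrite (linearZ_fun (f := fun z => act z _) ((fock_act_bil dR fock).1 _)).
Qed.

Section Degree.
Variable D : I -> bool.
Local Notation pr := (@proj_vec K I D).
Hypothesis fock_T_proj : forall a b i,
  fock (T (l a) (l b)) (pr (delta i)) = pr (fock (T (l a) (l b)) (delta i)).

Lemma fock_proj c f : fock (iota c) (pr f) = pr (fock (iota c) f).
Proof.
have prl := @proj_vec_linear K I D.
move: c f; apply: A_ind => [|a b].
  split=> [f|c x y xP yP f|x y xP yP f|x y xP xy yx f].
  - by rewrite (rmorph1 iota) (rmorph1 fock).
  - by rewrite (linearP iota) (linearP fock) !lappD !lappZ xP yP prl.
  - by rewrite (rmorphM iota) (rmorphM fock) !lappM yP xP.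
  have e g : fock (iota x) (fock (iota y) g) = g.
    by rewrite -lappM -(rmorphM fock) -(rmorphM iota) xy (rmorph1 iota) (rmorph1 fock).
  have e' g : fock (iota y) (fock (iota x) g) = g.
    by rewrite -lappM -(rmorphM fock) -(rmorphM iota) yx (rmorph1 iota) (rmorph1 fock).
  by rewrite -[in LHS](e f) -xP e'.
apply: linear_basis_ext => [||i].
- exact: (linear_comp (lapp_linear _) prl).
- exact: (linear_comp prl (lapp_linear _)).
by rewrite iotaT fock_T_proj.
Qed.
End Degree.
Variable deg : I -> int * nat.
Hypothesis deg_sh : forall i, deg (sh i) = ((deg i).1 + 1, (deg i).2).
Hypothesis deg_inc : forall a i, deg (inc a i) = ((deg i).1, (deg i).2.+1).

Definition graded (d : int * nat) : B -> Prop := zeta_span iota zeta (fun i => deg i == d).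

Lemma deg_shN i : deg (shN i) = ((deg i).1 - 1, (deg i).2).
Proof. by rewrite -{2 3}(shK i) deg_sh /= addrK; case: (deg _). Qed.

Lemma graded_zeta i : graded (deg i) (zeta i).
Proof. by rewrite -[zeta i]mulr1 -(rmorph1 iota); exact: zeta_span_gen. Qed.

Lemma graded_u d z : graded d z -> graded (d.1 + 1, d.2) (T ord0 ord0 * z).
Proof.
apply: (span_image (f := fun z => T ord0 ord0 * z) ((mul_bil B).2 _)).
move=> {}z [i [c [/eqP<- ->]]]; rewrite mulrA zeta_shift.
by apply: zeta_span_gen; rewrite deg_sh.
Qed.

Lemma graded_uV d z : graded d z -> graded (d.1 - 1, d.2) (uV * z).
Proof.
apply: (span_image (f := fun z => uV * z) ((mul_bil B).2 _)).
move=> {}z [i [c [/eqP<- ->]]]; rewrite mulrA zeta_shiftN.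
by apply: zeta_span_gen; rewrite deg_shN.
Qed.

Lemma graded_x a d z : graded d z -> graded (d.1, d.2.+1) (T (l a) ord0 * z).
Proof.
apply: (span_image (f := fun z => T (l a) ord0 * z) ((mul_bil B).2 _)).
move=> {}z [i [c [/eqP<- ->]]]; rewrite mulrA zeta_incr -scalerAl; apply: spanZ.
by apply: zeta_span_gen; rewrite deg_inc.
Qed.

Lemma graded_mulr c d z : graded d z -> graded d (z * iota c).
Proof. exact: zeta_span_mulr. Qed.

Variable dL : {linear B -> (A ⊗ B)%type}.
Hypothesis dL_monoid : monoid_morphism dL.
Hypothesis dLT : forall a b, dL (T a b) = \sum_c p a c ⊗ T c b.
Hypothesis dL_iota : forall c, dL (iota c) = tmap idfun iota (comul H c).
Hypothesis dR_iota : forall c, dR (iota c) = tmap iota idfun (comul H c).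

(** The image of A ⊗ S in A ⊗ B for S the component of degree d; [gradedr] is its mirror image. A
    projection that fixes the component fixes these tensors. *)
Definition gradedl d : A ⊗ B -> Prop := span (fun y => exists a z, graded d z /\ y = a ⊗ z).
Definition gradedr d : B ⊗ A -> Prop := span (fun y => exists z a, graded d z /\ y = z ⊗ a).

Lemma gradedl_mull d d' b w y : (forall z, graded d z -> graded d' (w * z)) ->
  gradedl d y -> gradedl d' ((b ⊗ w) * y).
Proof.
move=> dw; apply: (span_image (f := fun y => (b ⊗ w) * y) ((tmul_bil A B).2 _)).
move=> {}y [a [z [dz ->]]]; rewrite tensM.
by apply: span_gen; exists (b * a), (w * z); split=> //; exact: dw.
Qed.

Lemma gradedl_mulr d y X : gradedl d y -> gradedl d (y * tmap idfun iota X).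
Proof.
have il : linear iota by exact: linearP.
elim/tensor_ind: X => [|e a c X IH] dy.
  by rewrite (linear0_fun (tmap_linear (@linear_idfun K A) il)) mulr0; exact: span0.
rewrite (tmap_linear (@linear_idfun K A) il) mulrDr -tscalerAr; apply: spanD; last exact: IH.
apply: spanZ; rewrite (tmapE (@linear_idfun K A) il).
rewrite -[idfun a]/a; move: dy.
apply: (span_image (f := fun y : (A ⊗ B)%type => y * (a ⊗ iota c)) ((tmul_bil A B).1 _)).
move=> _ [b [z [dz ->]]]; rewrite tensM.
by apply: span_gen; exists (b * a), (z * iota c); split=> //; exact: graded_mulr.
Qed.

Lemma dL_u : dL (T ord0 ord0) = 1 ⊗ T ord0 ord0.
Proof.
rewrite dLT big_ord_recl diag_blockE big1 ?addr0 // => c _.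
by rewrite diag_blockE tpure0l.
Qed.

Lemma dL_x a : dL (T (l a) ord0) = \sum_b TA a b ⊗ T (l b) ord0.
Proof.
rewrite dLT big_ord_recl diag_blockE tpure0l add0r.
by apply: eq_bigr => b _; rewrite diag_blockE.
Qed.

Lemma monoid_morphV (C D : algType K) (d : B -> (C ⊗ D)%type) w :
  monoid_morphism d -> d (T ord0 ord0) * w = 1 -> d uV = w.
Proof.
by move=> [d1 dM] dw; rewrite -[LHS]mulr1 -dw mulrA -dM TVu d1 mul1r.
Qed.

Lemma dL_uV : dL uV = 1 ⊗ uV.
Proof. by apply: (monoid_morphV dL_monoid); rewrite dL_u tensM TuV mulr1. Qed.

Lemma dR_uV : dR uV = uV ⊗ 1.
Proof. by apply: (monoid_morphV dR_monoid); rewrite dR_u tensM TuV mulr1. Qed.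

(** The left coaction turns x^a into a combination of the x^b with coefficients in A and fixes u up
    to the unit, so that it keeps the degree of the second leg. *)
Lemma dL_zeta i : gradedl (deg i) (dL (zeta i)).
Proof.
move: i; apply: I_ind => [|i IH|i IH|a i IH].
- rewrite zeta0 dL_monoid.1; apply: span_gen; exists 1, 1; split=> //.
  by rewrite -zeta0; exact: graded_zeta.
- rewrite -zeta_shift dL_monoid.2 dL_u deg_sh; apply: gradedl_mull IH => z.
  exact: graded_u.
- rewrite -zeta_shiftN dL_monoid.2 dL_uV deg_shN.
  by apply: gradedl_mull IH => z; exact: graded_uV.
have -> : zeta (inc a i) = (xw a i)^-1 *: (T (l a) ord0 * zeta i).
  by rewrite zeta_incr scalerA mulVf // scale1r.
rewrite linearZ; apply: spanZ; rewrite dL_monoid.2 dL_x mulr_suml; apply: span_sum => b _.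
by rewrite deg_inc; apply: gradedl_mull IH => z; exact: graded_x.
Qed.

Lemma dR_zeta i : dR (zeta i) = zeta i ⊗ 1.
Proof.
move: i; apply: I_ind => [|i IH|i IH|a i IH].
- by rewrite zeta0 dR_monoid.1.
- by rewrite -zeta_shift dR_monoid.2 dR_u IH tensM mulr1.
- by rewrite -zeta_shiftN dR_monoid.2 dR_uV IH tensM mulr1.
have -> : zeta (inc a i) = (xw a i)^-1 *: (T (l a) ord0 * zeta i).
  by rewrite zeta_incr scalerA mulVf // scale1r.
have dl : linear dR by exact: linearP.
by rewrite (linearZ_fun dl) dR_monoid.2 dR_x IH tensM mulr1 -tpureZl.
Qed.

Lemma dL_graded d z : graded d z -> gradedl d (dL z).
Proof.
have dl : linear dL by exact: linearP.
apply: (span_image dl) => {}z [i [c [/eqP<- ->]]].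
by rewrite dL_monoid.2 dL_iota; apply: gradedl_mulr; exact: dL_zeta.
Qed.

Lemma dR_graded d z : graded d z -> gradedr d (dR z).
Proof.
have dl : linear dR by exact: linearP.
have il : linear iota by exact: linearP.
apply: (span_image dl) => {}z [i [c [/eqP<- ->]]].
rewrite dR_monoid.2 dR_iota dR_zeta; elim/tensor_ind: (comul H c) => [|e a b X IH].
  by rewrite (linear0_fun (tmap_linear il (@linear_idfun K A))) mulr0; exact: span0.
rewrite (tmap_linear il (@linear_idfun K A)) mulrDr -tscalerAr; apply: spanD; last exact: IH.
apply: spanZ; rewrite (tmapE il (@linear_idfun K A)) tensM mul1r.
apply: span_gen; exists (zeta i * iota a), b; split=> //.
exact: zeta_span_gen.
Qed.

Section FixedTensors.
Variables (d : int * nat) (P : B -> B).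
Hypotheses (P_lin : linear P) (P_id : forall z, graded d z -> P z = z).

Lemma gradedl_fixed y : gradedl d y -> tmap idfun P y = y.
Proof.
have pl := tmap_linear (@linear_idfun K A) P_lin.
apply: (span_ext pl (@linear_idfun K _)) => {}y [a [z [dz ->]]].
by rewrite (tmapE (@linear_idfun K A) P_lin) P_id.
Qed.

Lemma gradedr_fixed y : gradedr d y -> tmap P idfun y = y.
Proof.
have pl := tmap_linear P_lin (@linear_idfun K A).
apply: (span_ext pl (@linear_idfun K _)) => {}y [z [a [dz ->]]].
by rewrite (tmapE P_lin (@linear_idfun K A)) P_id.
Qed.
End FixedTensors.

Hypothesis B_ind : forall P : B -> Prop,
  alg_closed P -> (forall a b, P (T a b)) -> forall z, P z.
Hypothesis comul_p : forall a b, comul H (p a b) = \sum_c p a c ⊗ p c b.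
Hypothesis counit_p : forall a b, counit H (p a b) = (a == b)%:R.
Variable eB : {lrmorphism B -> K^o}.
Hypothesis fock_T_proj : forall d a b i,
  let pr := proj_vec (fun i => deg i == d) in
  fock (T (l a) (l b)) (pr (delta i)) = pr (fock (T (l a) (l b)) (delta i)).

Let zeta_indep := zeta_independent dR_monoid dR_iota fock_vacuum zeta_act_vac.

Lemma iota_inj : injective iota.
Proof. exact: (iota_injective dR_monoid dR_iota fock_vacuum zeta_act_vac). Qed.

Definition full_bimodule : bicovariant_bimodule H B :=
  matrix_bimodule B_ind comul_p counit_p eB dL_monoid dR_monoid dLT dRT dL_iota dR_iota.

Lemma full_free : freely_generates (ract full_bimodule) zeta.
Proof.
split=> [m|s b us e].
  apply: span_combination; first exact: (mract_bil iota).2.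
  have := zeta_span_all B_ind dR_monoid dRT exchange_basis zeta0 m.
  apply: span_sub => z [i [c [_ ->]]]; apply: span_gen; exists i, c.
  by [].
exact: zeta_indep us e.
Qed.

Section Component.
Variables (d : int * nat) (S : lmodType K) (g : {linear S -> B}).
Hypothesis g_inj : injective g.
Hypothesis g_image : forall z, (exists x, g x = z) <-> graded d z.

Let D i := deg i == d.
Let P := degree_proj iota dR fock zeta D.
Let P_lin : linear P. Proof. exact: degree_proj_linear. Qed.
Let P_id z : graded d z -> P z = z.
Proof. exact: (degree_proj_id dR_monoid dR_iota fock_vacuum zeta_act_vac). Qed.
Let P_graded z : graded d (P z).
Proof.
exact: (degree_proj_span B_ind dR_monoid dRT dR_iota fock_vacuum exchange_basis zeta0
  zeta_act_vac D z).
Qed.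

(** Preimages under the injective map g are unique, which makes the chosen retraction linear. *)
Lemma component_retraction : exists R : {linear B -> S}, forall z, g (R z) = P z.
Proof.
pose R z := projT1 (cid ((g_image (P z)).2 (P_graded z))).
have gR z : g (R z) = P z by rewrite /R; case: cid.
have Rl : linear R by move=> c x y; apply: g_inj; rewrite linearP !gR P_lin.
pose F1 := GRing.isLinear.Build K B S *:%R R Rl.
pose R' : {linear B -> S} := HB.pack R F1.
by exists R'.
Qed.

Let g_graded x : graded d (g x). Proof. by apply/g_image; exists x. Qed.

Lemma component_bimodule : exists (G' : bicovariant_bimodule H S) (e : {i | D i} -> S),
  [/\ bicovariant_morphism G' full_bimodule g, forall i, g (e i) = zeta (val i) &
      freely_generates (ract G') e].
Proof.
have [R gR] := component_retraction.
have gK : cancel g R by move=> x; apply: g_inj; rewrite gR P_id.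
have il : linear iota by exact: linearP.
have lact_stable a x : g (R (lact full_bimodule a (g x))) = lact full_bimodule a (g x).
  rewrite gR P_id //; apply: (zeta_span_mull B_ind dR_monoid dRT dR_iota fock_vacuum
    exchange_basis zeta0 zeta_act_vac); last exact: g_graded.
  apply: fock_proj => b c i; exact: fock_T_proj.
have ract_stable x a : g (R (ract full_bimodule (g x) a)) = ract full_bimodule (g x) a.
  by rewrite gR P_id //; exact: (zeta_span_mulr a (g_graded x)).
have coactl_stable x :
    tmap idfun (g \o R) (coactl full_bimodule (g x)) = coactl full_bimodule (g x).
  apply: (etrans (@eq_tmap K A B A B idfun idfun (g \o R) P (fun _ => erefl) gR _)).
  by apply: (gradedl_fixed P_lin P_id); exact: dL_graded.
have coactr_stable x :
    tmap (g \o R) idfun (coactr full_bimodule (g x)) = coactr full_bimodule (g x).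
  apply: (etrans (@eq_tmap K B A B A (g \o R) P idfun idfun gR (fun _ => erefl) _)).
  by apply: (gradedr_fixed P_lin P_id); exact: dR_graded.
pose G' := sub_bimodule gK lact_stable ract_stable coactl_stable coactr_stable.
have ze (i : {i | D i}) : exists x, g x = zeta (val i).
  by apply/g_image; rewrite -(eqP (valP i)); exact: graded_zeta.
pose e i := projT1 (cid (ze i)).
have ge i : g (e i) = zeta (val i) by rewrite /e; case: cid.
have gact i c : g (ract G' (e i) c) = zeta (val i) * iota c.
  by rewrite (sub_ractE ract_stable) ge.
exists G', e; split=> //; first exact: sub_bimodule_morphism.
split=> [m|s b us].
  apply: span_combination; first exact: (ract_bil G').2.
  rewrite -(gK m); have : graded d (g m) by exact: g_graded.
  have Rl : linear R by exact: linearP.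
  apply: (span_image Rl) => z [i [c [Di ->]]]; apply: span_gen.
  exists (Sub i Di), c; apply: g_inj; rewrite gact gR /= P_id //.
  exact: zeta_span_gen.
move=> /(congr1 g); rewrite raddf0 raddf_sum => e0 i si.
(* The coefficients are extended by zero to all indices, so that independence in B applies. *)
pose b' j := if insub j is Some i then b i else 0.
have b'E k : b' (val k) = b k by rewrite /b' valK.
rewrite -b'E; apply: (@zeta_indep (map val s) b') (map_f val si).
  by rewrite (map_inj_uniq val_inj).
rewrite big_map -[RHS]e0; apply: eq_bigr => k _.
by rewrite b'E; exact/esym/gact.
Qed.
End Component.
End FockHypotheses.

(** * The inhomogeneous quantum group *)

(* The two quantum groups enter only through their presentations. *)
Section Presentation.
Variables (K : fieldType) (N : nat) (r q0 : K) (q : 'I_N.+1 -> 'I_N.+1 -> K).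
Hypothesis r_neq0 : r != 0.
Hypothesis q_neq0 : forall A B, q A B != 0.
Hypothesis qV : forall A B, q A B = r ^+ 2 / q B A.
Hypothesis q_diag : forall A, q A A = r.
Hypothesis q_const : forall a : 'I_N, q (lift ord0 a) ord0 = q0.
Local Notation l := (lift ord0).

Variables (A : algType K) (B : unitAlgType K).
Variables (TA : 'I_N -> 'I_N -> A) (XA : A).
Hypothesis TA_RTT : forall a b c d, RTT r (qlow q) TA a b c d = 0.
Hypotheses (TA_det : qdet r (qlow q) TA * XA = 1) (TA_det' : XA * qdet r (qlow q) TA = 1).
Hypothesis A_ind : forall P : A -> Prop,
  alg_closed P -> (forall a b, P (TA a b)) -> forall z, P z.
Hypothesis A_univ : forall (C : algType K) (t : 'I_N -> 'I_N -> C) (xi : C),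
  (forall a b c d, RTT r (qlow q) t a b c d = 0) ->
  qdet r (qlow q) t * xi = 1 -> xi * qdet r (qlow q) t = 1 ->
  exists g : {lrmorphism A -> C}, (forall a b, g (TA a b) = t a b) /\ g XA = xi.

Variables (T : 'I_N.+1 -> 'I_N.+1 -> B) (X : B).
Hypothesis T_RTT : forall a b c d, RTT r q T a b c d = 0.
Hypothesis T0 : forall a, T ord0 (l a) = 0.
Hypotheses (T_det : qdet r q T * X = 1) (T_det' : X * qdet r q T = 1).
Hypothesis u_unit : T ord0 ord0 \is a GRing.unit.
Hypothesis B_ind : forall P : B -> Prop,
  alg_closed P -> (forall a b, P (T a b)) -> forall z, P z.
Hypothesis B_univ : forall (C : algType K) (t : 'I_N.+1 -> 'I_N.+1 -> C) (xi : C),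
  (forall a b c d, RTT r q t a b c d = 0) -> (forall a, t ord0 (l a) = 0) ->
  qdet r q t * xi = 1 -> xi * qdet r q t = 1 ->
  exists g : {lrmorphism B -> C}, forall a b, g (T a b) = t a b.

Variable H : hopf_algebra A.
Hypothesis comul_TA : forall a b, comul H (TA a b) = \sum_c TA a c ⊗ TA c b.
Hypothesis counit_TA : forall a b, counit H (TA a b) = (a == b)%:R.

Local Notation u := (T ord0 ord0).
Local Notation x := (fun a => T (l a) ord0).
Local Notation s := (mixed_coef r q0).
Local Notation E := (lend_alg (basis_neq0 K (fock0 N))).
Local Notation zeta := (monomial u x).
Local Notation deg := (fun i : fidx N => (i.1, \sum_b i.2 b)%N).

(** The full determinant is u times the determinant of the block, and the two factors commute; the
    block determinant is therefore invertible in B, as the universal property of A demands. *)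
Lemma inclusion_exists :
  exists iota : {lrmorphism A -> B}, forall a b, iota (TA a b) = T (l a) (l b).
Proof.
have dE := qdet_lift r q T0.
have Du := qdet_low_comm r_neq0 q_neq0 qV q_diag q_const T0 T_RTT.
move: T_det T_det'; rewrite dE => h1 h2.
have [h3 h4] := inverse_factor Du h1 h2.
have LR a b c d : RTT r (qlow q) (fun a b => T (l a) (l b)) a b c d = 0.
  by rewrite RTT_low.
by have [iota [iT _]] := A_univ LR h3 h4; exists iota.
Qed.

Lemma counit_exists : exists e : {lrmorphism B -> K^o}, forall a b, e (T a b) = (a == b)%:R.
Proof.
apply: (B_univ (xi := 1)) => [a b c d|a||].
- exact: (RTT_delta r q K^o a b c d).
- by rewrite (negbTE (neq_lift _ _)).
- by rewrite mulr1 counit_qdet.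
- by rewrite mul1r counit_qdet.
Qed.

Lemma fock_exists :
  exists fock : {lrmorphism B -> E}, forall a b, fock (T a b) = fock_mx r q0 q a b.
Proof.
have [xi [h1 h2]] := fock_mx_det r_neq0 q_neq0 q_diag q_const.
apply: B_univ h1 h2; first exact: (fock_mx_RTT r_neq0 q_neq0 qV q_diag q_const).
by move=> a; rewrite /fock_mx osc_fullE.
Qed.

(** A homogeneous component enters as any space S embedded onto the combinations of words, which
    keeps the argument independent of how [Gamma] is encoded. *)
Theorem presentation_bimodule :
  exists (iota : {lrmorphism A -> B}) (G : bicovariant_bimodule H B),
    [/\ (forall a b, iota (TA a b) = T (l a) (l b)) /\ injective iota,
        (forall c m, lact G c m = iota c * m) /\ (forall m c, ract G m c = m * iota c),
        [/\ monoid_morphism (coactl G), forall a, coactl G (x a) = \sum_b TA a b ⊗ x b,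
            coactl G u = 1 ⊗ u & forall c, coactl G (iota c) = tmap idfun iota (comul H c)],
        [/\ monoid_morphism (coactr G), forall a, coactr G (x a) = x a ⊗ 1,
            coactr G u = u ⊗ 1 & forall c, coactr G (iota c) = tmap iota idfun (comul H c)] &
        freely_generates (ract G) zeta /\
        forall h k (S : lmodType K) (g : S -> B), linear g -> injective g ->
          (forall z, (exists y, g y = z) <-> exists b : k.-tuple 'I_N -> A,
             z = \sum_(t : k.-tuple 'I_N) u ^ h * (\prod_(a <- t) x a) * iota (b t)) ->
          exists (G' : bicovariant_bimodule H S) (e : {i | deg i == (h, k)} -> S),
            [/\ bicovariant_morphism G' G g, forall i, g (e i) = zeta (val i) &
                freely_generates (ract G') e]].
Proof.
have [iota iotaT] := inclusion_exists; have [eB eBT] := counit_exists.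
have [fock fockT] := fock_exists.
have TuV := divrr u_unit; have TVu := mulVr u_unit.
have hBA := tens1_neq0 eB (counit H); have hAB := tens1_neq0 (counit H) eB.
have [dR [dR_monoid dRT dR_iota]] := right_coaction_exists r_neq0 q_neq0 qV q_diag q_const
  TA_RTT TA_det TA_det' A_ind T_RTT T0 TuV TVu B_univ comul_TA iotaT hBA.
have [dL [dL_monoid dLT dL_iota]] := left_coaction_exists r_neq0 q_neq0 qV q_diag q_const
  TA_RTT TA_det TA_det' A_ind T_RTT T0 TuV TVu B_univ comul_TA iotaT hAB.
have rs0 (a : 'I_N) : r * s != 0.
  by rewrite mulf_neq0 ?(mixed_coef_neq0 r_neq0 q_neq0 q_diag q_const a).
have xx a b := @RTT_xx K N r q r_neq0 q_neq0 qV q_diag B T T_RTT a b.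
have xu := RTT_xu r_neq0 q_neq0 qV q_diag q_const T_RTT.
have fock_u i : fock u (basis K i) = basis K (shift 1 i) by rewrite fockT fock_mx_u.
have fock_x a i : fock (x a) (basis K i) = fock_weight r q0 q a i *: basis K (incr a i).
  by rewrite fockT fock_mx_x.
have fock_vac a b : fock (T (l a) (l b)) (basis K (fock0 N)) = (a == b)%:R *: basis K (fock0 N).
  by rewrite fockT fock_mx_vac.
have xw0 a i := fock_weight_neq0 r_neq0 q_neq0 q_diag q_const a i.
have shK : cancel (@shift N (-1)) (shift 1).
  by case=> m f; rewrite /shift /= subrK.
have zeta_shift i : u * zeta i = zeta (shift 1 i) by rewrite monomial_shift // expr1z.
have zeta_incr a i : x a * zeta i = fock_weight r q0 q a i *: zeta (incr a i).
  exact: (x_monomial rs0 u_unit xx xu).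
have zeta0 : zeta (fock0 N) = 1 by exact: monomial0.
have I_ind := @fidx_ind N.
pose G := full_bimodule dR_monoid dRT dL_monoid dLT dL_iota dR_iota B_ind
  (comul_diag_block comul_TA) (counit_diag_block counit_TA) eB.
exists iota, G; split.
- split=> //.
  exact: (iota_inj A_ind counit_TA iotaT TVu fock_u fock_x fock_vac xw0 shK I_ind zeta0
    zeta_shift zeta_incr dR_monoid dRT dR_iota).
- by [].
- split=> //; [exact: (dL_x dLT)|exact: (dL_u dLT)].
- split=> //; [exact: (dR_x dRT)|exact: (dR_u dRT)].
split.
  exact: (full_free r_neq0 q_neq0 qV q_diag q_const A_ind counit_TA iotaT T_RTT T0 TuV TVu
    fock_u fock_x fock_vac xw0 shK I_ind zeta0 zeta_shift zeta_incr dR_monoid dRT dL_monoid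
    dLT dL_iota dR_iota B_ind (comul_diag_block comul_TA) (counit_diag_block counit_TA) eB).
move=> h k S g g_lin g_inj g_image.
pose g1 := GRing.isLinear.Build K S B *:%R g g_lin.
pose gL : {linear S -> B} := HB.pack g g1.
have g_im z : (exists y, g y = z) <-> graded iota zeta deg (h, k) z.
  by rewrite g_image; exact: (words_span rs0 u_unit xx xu iota h k z).
have deg_sh i : deg (shift 1 i) = ((deg i).1 + 1, (deg i).2) by [].
have deg_inc a i : deg (incr a i) = ((deg i).1, (deg i).2.+1).
  by congr (_, _); rewrite sum_incr.
have fock_proj d a b i :
    let pr := proj_vec (fun i => deg i == d) in
    fock (T (l a) (l b)) (pr (basis K i)) = pr (fock (T (l a) (l b)) (basis K i)).
  (* Moving one unit of exponent from one index to another keeps the total degree. *)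
  rewrite !fockT; apply: fock_mx_proj => c e j j0.
  by congr (_ == _); congr (_, _); rewrite -[in RHS](decrK j0) !sum_incr.
exact: (component_bimodule r_neq0 q_neq0 qV q_diag q_const A_ind counit_TA iotaT T_RTT T0 TuV TVu
    fock_u fock_x fock_vac xw0 shK I_ind zeta0 zeta_shift zeta_incr dR_monoid dRT deg_sh deg_inc
    dL_monoid dLT dL_iota dR_iota B_ind (comul_diag_block comul_TA)
    (counit_diag_block counit_TA) eB fock_proj (g_inj : injective gL) g_im).
Qed.
End Presentation.

Theorem corollary3p3p5 (R : realType) (N : nat) (r : R[i])
    (q : 'I_N.+1 -> 'I_N.+1 -> R[i]) (q0 : R[i])
    (r_neq0 : r != 0) (q_neq0 : forall A B, q A B != 0)
    (qV : forall A B, q A B = r ^+ 2 / q B A) (q_diag : forall A, q A A = r)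
    (q_const : forall a : 'I_N, q (lift ord0 a) ord0 = q0)
    (H : hopf_algebra (GL r (qlow q))) (H_GL : GL_hopf H) :
  exists (iota : {lrmorphism GL r (qlow q) -> IGL r q})
         (G : bicovariant_bimodule H (IGL r q)),
    [/\ (forall a b, iota (GLT r (qlow q) a b) = IGLT r q a b) /\ injective iota,
        (forall c m, lact G c m = iota c * m) /\
        (forall m c, ract G m c = m * iota c),
        [/\ monoid_morphism (coactl G),
            forall a, coactl G (IGLx r q a) =
                      \sum_b GLT r (qlow q) a b ⊗ IGLx r q b,
            coactl G (IGLu r q) = 1 ⊗ IGLu r q &
            forall c, coactl G (iota c) = tmap idfun iota (comul H c)],
        [/\ monoid_morphism (coactr G),
            forall a, coactr G (IGLx r q a) = IGLx r q a ⊗ 1,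
            coactr G (IGLu r q) = IGLu r q ⊗ 1 &
            forall c, coactr G (iota c) = tmap iota idfun (comul H c)] &
        freely_generates (ract G) (zeta r q) /\
        forall (h : int) (k : nat),
          exists (G' : bicovariant_bimodule H (Gamma iota h k))
                 (e : {i : zidx N | zdeg i == (h, k)} -> Gamma iota h k),
            [/\ bicovariant_morphism G' G (@gval _ _ _ _ iota h k),
                forall i, gval (e i) = zeta r q (val i) &
                freely_generates (ract G') e]].
Proof.
have [Dd Dd'] := GL_detXi r (qlow q).
have [Td Td'] := @IGL_detXi _ N r q.
have [comulT _ counitT _ _] := H_GL.
have u_unit : IGLmx r q ord0 ord0 \is a GRing.unit := @IGLu_unit _ N r q r_neq0 q_neq0.
have [iota [G [h1 h2 h3 h4 [h5 h6]]]] := presentation_bimodule r_neq0 q_neq0 qV q_diag q_const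
  (@GLT_RTT _ N r (qlow q)) Dd Dd' (@GL_ind _ N r (qlow q)) (@GL_univ _ N r (qlow q))
  (@IGL_RTT _ N r q) (@IGL_T0 _ N r q) Td Td' u_unit (@IGL_ind _ N r q) (@IGL_univ _ N r q)
  comulT counitT.
exists iota, G; split; [exact: h1|exact: h2|exact: h3|exact: h4|split; [exact: h5|move=> h k]].
have gi : injective (@gval _ N r q iota h k) by exact: val_inj.
have gl : linear (@gval _ N r q iota h k) by [].
apply: (h6 h k (Gamma iota h k) (@gval _ N r q iota h k) gl gi) => z.
split=> [[[y yG] <-]|zG]; first exact/asboolP.
by exists (MkGamma (asboolT zG)).
Qed.
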